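(* Let $i\in\{a,b\}$ and consider the discontinuous piecewise linear system in $\mathbb R^3$ $$(\dot x,\dot y,\dot z)^T=\begin{cases}X_{i,0}^+(x,y,z)+\varepsilon X_1^+(x,y,z), & z>0,\\ X_{i,0}^-(x,y,z)+\varepsilon X_1^-(x,y,z), & z<0,\end{cases}$$ where $$X_{a,0}^\pm(x,y,z)=\begin{pmatrix}x\\ -z\mp1\\ x+y\end{pmatrix},\qquad X_{b,0}^\pm(x,y,z)=\begin{pmatrix}x\\ z\mp1\\ x+y\end{pmatrix},$$ $$X_1^\pm(x,y,z)=\begin{pmatrix}\alpha_0^\pm+\alpha_1^\pm x+\alpha_2^\pm y+\alpha_3^\pm z\\ \beta_0^\pm+\beta_1^\pm x+\beta_2^\pm y+\beta_3^\pm z\\ \kappa_0^\pm+\kappa_1^\pm x+\kappa_2^\pm y+\kappa_3^\pm z\end{pmatrix}.$$ Then, for each $i\in\{a,b\}$, there exist real parameters $\alpha_j^\pm,\beta_j^\pm,\kappa_j^\pm$ ($j=0,1,2,3$) such that for every $\varepsilon\neq0$ sufficiently small the system admits at least $2$ limit cycles converging, as $\varepsilon\to0$, to some of the periodic orbits of the unperturbed system ($\varepsilon=0$) contained in the plane $\mathcal S=\{(x,y,z)\in\mathbb R^3:x=0\}$.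
   Context: The switching manifold is $\Sigma=\{z=0\}$. For $\varepsilon=0$ the plane $\mathcal S=\{x=0\}$ is invariant and contains a period annulus foliated by crossing periodic orbits, i.e. periodic orbits made of an orbit segment of $X_{i,0}^+$ in $z>0$ and an orbit segment of $X_{i,0}^-$ in $z<0$, meeting $\Sigma$ at points where both vector fields are transversal to $\Sigma$ and point to the same side. A limit cycle is an isolated periodic orbit. *)

(* Defs.v *)
From mathcomp Require Export all_boot all_order all_algebra.
From mathcomp Require Export all_classical all_reals all_analysis.
Export Order.TTheory GRing.Theory Num.Theory numFieldNormedType.Exports.

Set Implicit Arguments.
Unset Strict Implicit.
Unset Printing Implicit Defensive.


Open Scope classical_set_scope.
Open Scope ring_scope.

(* [above] is the superscript + (z > 0), [below] the superscript - (z < 0). *)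
Inductive side := above | below.

Inductive family := family_a | family_b.

Section vector_fields.
Context {R : realType}.
Implicit Types (p : 'rV[R]_3) (s : side).

Definition xc p : R := p 0 0.
Definition yc p : R := p 0 1.
Definition zc p : R := p 0 2.

Definition vec3 (a b c : R) : 'rV[R]_3 := \row_(j < 3) [:: a; b; c]`_j.

Definition sgs s : R := if s is above then 1 else -1.

Definition X0 (i : family) s p : 'rV[R]_3 :=
  match i with
  | family_a => vec3 (xc p) (- zc p - sgs s) (xc p + yc p)
  | family_b => vec3 (xc p) (zc p - sgs s) (xc p + yc p)
  end.

Definition affine (c : 'I_4 -> R) p : R :=
  c 0 + c 1 * xc p + c 2 * yc p + c 3 * zc p.

Definition X1 (alpha beta kappa : side -> 'I_4 -> R) s p : 'rV[R]_3 :=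
  vec3 (affine (alpha s) p) (affine (beta s) p) (affine (kappa s) p).

Definition perturbed i (alpha beta kappa : side -> 'I_4 -> R) (e : R) s p
  : 'rV[R]_3 := X0 i s p + e *: X1 alpha beta kappa s p.

Definition planeS : set ('rV[R]_3) := [set p | xc p = 0].

End vector_fields.

(* A discontinuous system is a pair Z of vector fields, Z above governing
   z > 0 and Z below governing z < 0. *)
Section piecewise_systems.
Context {R : realType}.
Implicit Types (Z : side -> 'rV[R]_3 -> 'rV[R]_3) (p : 'rV[R]_3) (G : set ('rV[R]_3)).

(* Filippov's convention: on z = 0 the admissible velocities form the segment
   joining the two one-sided fields. *)
Definition filippov Z p : set ('rV[R]_3) :=
  [set w | [/\ 0 < zc p -> w = Z above p,
               zc p < 0 -> w = Z below p &
               zc p = 0 -> exists2 l : R, 0 <= l <= 1 &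
                 w = l *: Z above p + (1 - l) *: Z below p]].

(* Absolutely continuous solutions of the inclusion g' \in filippov Z g;
   absolute continuity is expressed by writing g as the integral of a locally
   integrable velocity v. *)
Definition solution Z (g : R -> 'rV[R]_3) : Prop :=
  exists v : R -> 'rV[R]_3,
  [/\ forall j, locally_integrable setT (fun t => v t 0 j),
      forall (j : 'I_3) (a b : R), a <= b ->
        g b 0 j - g a 0 j = Rintegral lebesgue_measure `[a, b] (fun t => v t 0 j) &
      {ae lebesgue_measure, forall t, filippov Z (g t) (v t)}].

Definition periodic_solution Z (g : R -> 'rV[R]_3) (T : R) : Prop :=
  [/\ solution Z g, 0 < T, forall t, g (t + T) = g t
    & exists t, g t <> g 0].

Definition periodic_orbit Z G : Prop :=
  exists g T, periodic_solution Z g T /\ G = range g.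

(* p lies on z = 0, both fields are transversal to z = 0 at p and their third
   components have the same sign. *)
Definition crossing_point Z p : Prop :=
  zc p = 0 /\ 0 < zc (Z above p) * zc (Z below p).

Definition crossing_periodic_orbit Z G : Prop :=
  exists g T tau,
  [/\ periodic_solution Z g T /\ G = range g,
      0 < tau < T,
      forall t, 0 < t < tau -> 0 < zc (g t),
      forall t, tau < t < T -> zc (g t) < 0 &
      crossing_point Z (g 0) /\ crossing_point Z (g tau)].

(* Isolation is required among all periodic orbits, whatever the way they
   meet z = 0 and however many turns they make. *)
Definition limit_cycle Z G : Prop :=
  periodic_orbit Z G /\
  exists U : set ('rV[R]_3),
  [/\ open U, G `<=` U
    & forall G', periodic_orbit Z G' -> G' `<=` U -> G' = G].

Definition thickening (eta : R) G : set ('rV[R]_3) := \bigcup_(p in G) ball p eta.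

(* L e --> G in the Hausdorff distance as e --> 0, e != 0. *)
Definition hausdorff_cvg0 (L : R -> set ('rV[R]_3)) G : Prop :=
  forall eta : R, 0 < eta ->
  \forall e \near (0 : R)^',
    L e `<=` thickening eta G /\ G `<=` thickening eta (L e).

End piecewise_systems.

(* Main.v *)
Require Import Defs.
From mathcomp Require Import ring lra.

(** The two families are treated together: sg = 1 and (C, S) = (cos, sin) for the
    first one, sg = -1 and (C, S) = (cosh, sinh) for the second one.

    The perturbation is chosen with constant term -1 in its first component, on
    both sides, so that x' = x - e everywhere. A periodic solution then has x = e
    identically, and the problem is planar, in the coordinates Y = x + y and z.
    In the plane x = e, on the side of sign s, suitable affine functions P of s Y
    and Q of s z follow a linear flow P' = om (k P - sg Q), Q' = om (P + k Q)
    ([perturbed_normal_form]), where z = 0 is the line Q = sg h. Its trajectories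
    are explicit in terms of the angle u, and an arc of angle u from this line to
    itself goes from P = h A(u, -k) to P = - h A(u, k), with
    A(u, k) = sg (exp (k u) - C u) / S u ([arc_return]). A cycle with one arc on each
    side is therefore a solution (tau, sigma) of two scalar equations ([closing]),
    which reduce to tau = sigma when e = 0; these solutions form the period annulus.

    In the half-angle coordinate y = A(u, 0), half the sum of the equations says that
    y' is a function of y, close to y, and half their difference divided by e then
    becomes a displacement e M(y) + O(e^2), where
    M(y) = (y B'(y) - B(y)) + w B(y) + sg D and B(y) = u (1 + sg y^2) / (2 y). A
    simple zero of M persists, and the solution is unique in a fixed neighbourhood
    of it ([balanced_near], [closing_near]). The two free parameters w and D are
    adjusted so that M has two simple zeros ([two_zeros], [simple_zero]).

    Isolation has to be proved among all periodic solutions in the sense of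
    Filippov. In the open set which omits the points of z = 0 away from the two
    crossing points, both fields cross z = 0 in the same direction, so a periodic
    orbit is a succession of arcs, possibly of many turns. Because A is increasing
    in the angle ([Af_mono]), the return map of each half-space is increasing, so
    that the largest crossing values on both sides are those of a one-turn cycle; so
    are the smallest ones. Both are then equal to those of the given cycle, by local
    uniqueness, and the orbit is the cycle ([gate_value], [range_cycle],
    [cycle_limit]).

    Conversely a solution of the closing equations gives a periodic solution by
    gluing its two arcs ([cyc_primitive], [cycle_periodic_orbit]); the case e = 0 is
    included ([cycle_crossing]). The convergence of cycles follows from the continuity
    of arcs in all parameters and compactness of [0, 1] ([unif_itv],
    [cyc_set_cvg]). *)

Set Implicit Arguments.
Unset Strict Implicit.
Unset Printing Implicit Defensive.

(** * Differentiation of real functions *)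

Section calculus.
Context {R : realType}.
Implicit Types (f g : R -> R) (x a b : R).

Lemma der_eq f x d d' : is_derive x 1 f d -> d = d' -> is_derive x 1 f d'.
Proof. by move=> ? <-. Qed.
Lemma der_cst (c x : R) : is_derive x 1 (fun _ : R => c) (0 : R).
Proof. exact: is_derive_cst. Qed.
Lemma der_id x : is_derive x 1 (fun t : R => t) (1 : R).
Proof. exact: is_derive_id. Qed.
Lemma der_opp f x d : is_derive x 1 f d -> is_derive x 1 (fun t => - f t) (- d).
Proof. exact: is_deriveN. Qed.
Lemma der_add f g x d e : is_derive x 1 f d -> is_derive x 1 g e ->
  is_derive x 1 (fun t => f t + g t) (d + e).
Proof. exact: is_deriveD. Qed.
Lemma der_mul f g x d e : is_derive x 1 f d -> is_derive x 1 g e ->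
  is_derive x 1 (fun t => f t * g t) (d * g x + f x * e).
Proof.
move=> df dg; have H := is_deriveM df dg.
suff -> : d * g x + f x * e = f x *: e + g x *: d by exact: H.
by rewrite /GRing.scale /=; ring.
Qed.
Lemma der_comp f g x d e : is_derive (f x) 1 g e -> is_derive x 1 f d ->
  is_derive x 1 (fun t => g (f t)) (e * d).
Proof. move=> dg df; exact: (is_derive1_comp dg df). Qed.
Lemma der_inv f x d : is_derive x 1 f d -> f x != 0 ->
  is_derive x 1 (fun t => (f t)^-1) (- d / f x ^+ 2).
Proof.
move=> df f0; have H := is_deriveV f0 df.
suff -> : - d / f x ^+ 2 = - f x ^- 2 *: d by exact: H.
by rewrite /GRing.scale /= mulNr mulrC mulNr.
Qed.
Lemma der_expR f x d : is_derive x 1 f d ->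
  is_derive x 1 (fun t => expR (f t)) (expR (f x) * d).
Proof. exact: der_comp. Qed.
Lemma der_pow f x d n : is_derive x 1 f d ->
  is_derive x 1 (fun t => f t ^+ n.+1) (n.+1%:R * f x ^+ n * d).
Proof.
move=> df; elim: n => [|n IH].
  have -> : (fun t => f t ^+ 1) = f by apply/funext => t; rewrite expr1.
  by rewrite mul1r expr0 mul1r.
have -> : (fun t => f t ^+ n.+2) = (fun t => f t * f t ^+ n.+1).
  by apply/funext => t; rewrite exprS.
apply: (@der_eq _ _ (d * f x ^+ n.+1 + f x * (n.+1%:R * f x ^+ n * d))).
  exact: (@der_mul f (fun t => f t ^+ n.+1) x _ _ df IH).
by rewrite -(natr1 n.+1) exprS; ring.
Qed.

Lemma der_cont f x d : is_derive x 1 f d -> {for x, continuous f}.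
Proof.
move=> [df _]; apply: differentiable_continuous.
exact/derivable1_diffP.
Qed.

Lemma mvt f (df : R -> R) a b : a < b ->
  (forall x, a <= x <= b -> is_derive x 1 f (df x)) ->
  exists2 c, a < c < b & f b - f a = df c * (b - a).
Proof.
move=> ab df_.
have [||c] := @MVT R f df a b ab.
- by move=> x; rewrite in_itv /= => /andP[ax xb]; apply: df_; rewrite !ltW.
- apply: continuous_in_subspaceT => x; rewrite inE /= in_itv /= => xab.
  exact: (der_cont (df_ _ xab)).
- by rewrite in_itv /=; exists c.
Qed.

Lemma mvt_abs f (df : R -> R) a b (K : R) x y :
  (forall x, a <= x <= b -> is_derive x 1 f (df x)) ->
  (forall x, a <= x <= b -> `|df x| <= K) ->
  a <= x <= b -> a <= y <= b -> `|f x - f y| <= K * `|x - y|.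
Proof.
move=> df_ dK.
wlog : x y / x < y => [H xab yab|xy xab yab].
  have [xy|yx|->] := ltgtP x y; first exact: H.
    by rewrite distrC (distrC x); apply: H.
  by rewrite !subrr normr0 mulr0.
have [c cxy E] : exists2 c, x < c < y & f y - f x = df c * (y - x).
  by apply: mvt => // z ?; apply: df_; lra.
rewrite distrC (distrC x) E normrM ler_wpM2r //; apply: dK; lra.
Qed.

Lemma lt_of_der f (df : R -> R) a b : a < b ->
  {within `[a, b], continuous f} ->
  (forall x, a < x < b -> is_derive x 1 f (df x)) ->
  (forall x, a < x < b -> 0 < df x) -> f a < f b.
Proof.
move=> ab cf df_ dp.
have df' x : x \in `]a, b[ -> is_derive x 1 f (df x).
  by rewrite in_itv /=; apply: df_.
have [c] := MVT ab df' cf; rewrite in_itv /= => cab E; rewrite -subr_gt0 E mulr_gt0 ?subr_gt0 //.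
exact: dp.
Qed.

Lemma eq_of_der0 f a b : a <= b ->
  {within `[a, b], continuous f} ->
  (forall x, a < x < b -> is_derive x 1 f 0) -> f a = f b.
Proof.
rewrite le_eqVlt => /predU1P[->//|ab] cf df_.
have df' x : x \in `]a, b[ -> is_derive x 1 f ((fun=> 0) x).
  by rewrite in_itv /=; apply: df_.
have [c _ /eqP] := MVT ab df' cf.
by rewrite mul0r subr_eq0 => /eqP.
Qed.

Lemma within_cont f a b : (forall x, {for x, continuous f}) ->
  {within `[a, b], continuous f}.
Proof. move=> cf; exact: continuous_subspaceT. Qed.

Lemma within_cont_in f a b : (forall x, a <= x <= b -> {for x, continuous f}) ->
  {within `[a, b], continuous f}.
Proof.
move=> cf; apply: continuous_in_subspaceT => x.
by rewrite inE /= in_itv /=; exact: cf.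
Qed.

End calculus.

(** [der] computes a derivative by structural recursion on the function, with the
    [is_derive] hypotheses of the context as leaves; [deriv] leaves in addition the
    equation between the computed and the expected derivative. *)
Ltac der_step :=
  match goal with
  | |- is_derive _ _ (fun t => t) _ => notypeclasses refine (der_id _)
  | |- is_derive _ _ (fun _ => ?c) _ => notypeclasses refine (der_cst _ _)
  | |- is_derive _ _ (fun t => @?f t + @?g t) _ => notypeclasses refine (@der_add _ f g _ _ _ _ _)
  | |- is_derive _ _ (fun t => - @?f t) _ => notypeclasses refine (@der_opp _ f _ _ _)
  | |- is_derive _ _ (fun t => @?f t * @?g t) _ => notypeclasses refine (@der_mul _ f g _ _ _ _ _)
  | |- is_derive _ _ (fun t => (@?f t)^-1) _ => notypeclasses refine (@der_inv _ f _ _ _ _)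
  | |- is_derive _ _ (fun t => expR (@?f t)) _ => notypeclasses refine (@der_expR _ f _ _ _)
  | |- is_derive _ _ (fun t => (@?f t) ^+ _) _ => notypeclasses refine (@der_pow _ f _ _ _ _)
  | H : forall x, is_derive x _ ?g _ |- is_derive _ _ (fun t => ?g (@?f t)) _ =>
      notypeclasses refine (@der_comp _ f g _ _ _ _ _)
  | H : forall x, is_derive x _ ?g _ |- is_derive _ _ ?g _ => exact: H
  | |- is_derive _ _ (fun t => ?g (@?f t)) _ =>
      notypeclasses refine (@der_comp _ f g _ _ _ _ _)
  | |- is_derive _ _ _ _ => solve [eauto]
  end.
Ltac der := repeat der_step.
Ltac deriv := notypeclasses refine (@der_eq _ _ _ _ _ _ _); [der|cbv beta].

(** * Two equations close to a model: difference estimates *)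

Lemma near_one_bound (R : realFieldType) (K s x : R) : 8 * K * s <= 1 ->
  `|x - 1| <= 2 * K * s -> `|x| <= 5 / 4.
Proof. by rewrite !ler_norml => H /andP[? ?]; lra. Qed.

(** The unknowns y, y' satisfy E1 y = h * E2 y' and B1 y = h * kap * B2 y' - d,
    where E1, E2 are close to the identity, B1, B2 to one function B, and h, kap
    to 1; s measures the size of the perturbation. The first equation gives
    y' = y / h up to O(s^2), and the second one is then compared with the explicit
    function B y - h * kap * B (y / h). *)
Section core_fixed.
Context {R : realType}.
Variables (p q K : R) (B dB : R -> R).
Hypotheses (p0 : 0 < p) (qK : q <= K) (K1 : 1 <= K).
Let I y := p <= y <= q.
Hypothesis dBP : forall y, I y -> is_derive y 1 B (dB y).
Hypothesis bB : forall y, I y -> `|B y| <= K.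
Hypothesis bdB : forall y, I y -> `|dB y| <= K.
Hypothesis lipdB : forall y u, I y -> I u -> `|dB y - dB u| <= K * `|y - u|.

Lemma normM_le (x y a b : R) : `|x| <= a -> `|y| <= b -> `|x * y| <= a * b.
Proof. by move=> ? ?; rewrite normrM ler_pM. Qed.
Lemma normD_le (x y a b : R) : `|x| <= a -> `|y| <= b -> `|x + y| <= a + b.
Proof. by move=> ? ?; rewrite (le_trans (ler_normD _ _))// lerD. Qed.
Lemma normB_le (x y a b : R) : `|x| <= a -> `|y| <= b -> `|x - y| <= a + b.
Proof. by move=> ? ?; rewrite (le_trans (ler_normB _ _))// lerD. Qed.

(** Lipschitz closeness instead of a bound on the derivative of F - G: it is what
    survives composition with the implicitly defined y'. *)
Definition C1close (F G : R -> R) (c : R) :=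
  forall y u, I y -> I u ->
    `|F y - G y| <= c /\ `|(F y - G y) - (F u - G u)| <= c * `|y - u|.

Variables (s h kap d : R) (E1 E2 B1 B2 : R -> R).
Hypotheses (s0 : 0 <= s) (s1 : 8 * K * s <= 1).
Hypothesis (cE1 : C1close E1 id (K * s ^+ 2)) (cE2 : C1close E2 id (K * s ^+ 2)).
Hypothesis (cB1 : C1close B1 B (K * s ^+ 2)) (cB2 : C1close B2 B (K * s ^+ 2)).
Hypothesis (h1 : `|h - 1| <= 2 * K * s) (kap1 : `|kap - 1| <= 2 * K * s).

Let hh : 3 / 4 <= h <= 5 / 4.
Proof.
by move: h1 s1; rewrite ler_norml => /andP[? ?] ?; apply/andP; split; lra.
Qed.
Let kk : 3 / 4 <= kap <= 5 / 4.
Proof.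
by move: kap1 s1; rewrite ler_norml => /andP[? ?] ?; apply/andP; split; lra.
Qed.
Let hV : `|h^-1| <= 4 / 3.
Proof.
have /andP[? ?] := hh; have h0 : 0 < h by lra.
have v0 : 0 < h^-1 by rewrite invr_gt0.
rewrite gtr0_norm// -(ler_pM2l h0) mulfV ?gt_eqF//; lra.
Qed.
Let Ks : K * s ^+ 2 <= s / 8.
Proof. by have ? := s0; have ? := s1; rewrite expr2; nra. Qed.
Let Ks0 : 0 <= K * s ^+ 2.
Proof. by have ? := K1; rewrite mulr_ge0 ?sqr_ge0//; lra. Qed.
Let s8 : s <= 1 / 8.
Proof. by have ? := s0; have ? := s1; have ? := K1; nra. Qed.

Lemma sol_shift y y' : I y -> I y' -> E1 y = h * E2 y' ->
  `|y' - y / h| <= 4 * (K * s ^+ 2).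
Proof.
move=> Iy Iy' E; have ? := Ks0; have /andP[? ?] := hh.
have [e1 _] := cE1 Iy Iy; have [e2 _] := cE2 Iy' Iy'.
have -> : y' - y / h = (E1 y - id y) / h - (E2 y' - id y').
  by rewrite /= E; field; apply: lt0r_neq0; lra.
apply: le_trans (normB_le (normM_le e1 hV) e2) _; nra.
Qed.

(** Subtracting the first equation at (y, y') and at (u, u') keeps the factor
    `|y - u|, thanks to the Lipschitz part of the closeness. *)
Lemma sol_shift2 y y' u u' : I y -> I y' -> I u -> I u' ->
  E1 y = h * E2 y' -> E1 u = h * E2 u' ->
  `|(y' - y / h) - (u' - u / h)| <= 4 * (K * s ^+ 2) * `|y - u| /\
  `|y' - u'| <= 2 * `|y - u|.
Proof.
move=> Iy Iy' Iu Iu' E E'.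
have [_ e1] := cE1 Iy Iu; have [_ e2] := cE2 Iy' Iu'.
have /andP[? ?] := hh; have h0 : h != 0 by apply: lt0r_neq0; lra.
have X : (y' - y / h) - (u' - u / h) =
    (E1 y - id y - (E1 u - id u)) / h - (E2 y' - id y' - (E2 u' - id u')).
  by rewrite /= E E'; field.
have b1 := normB_le (normM_le e1 hV) e2; rewrite -X in b1.
have b2 : `|y' - u'| <= `|(y' - y / h) - (u' - u / h)| + `|y - u| * (4 / 3).
  have -> : y' - u' = ((y' - y / h) - (u' - u / h)) + (y - u) / h by field.
  by apply: normD_le => //; apply: normM_le.
move: b1 b2 (normr_ge0 (y - u)) (normr_ge0 (y' - u')) Ks s8 Ks0 {X}.
move: `|_ - (u' - u / h)| `|y' - u'| `|y - u| (K * s ^+ 2) => a f c k.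
move=> b1 b2 c0 f0 k1 k2 k3; have k64 : k <= 1 / 64 by lra.
have f2 : f <= 2 * c by nra.
split => //; nra.
Qed.

Let Iconv y u (t : R) : I y -> I u -> 0 <= t <= 1 -> I (y + t * (u - y)).
Proof. by rewrite /I => *; apply/andP; split; nra. Qed.

(** The second difference of B is the derivative, at some time c, of the difference
    of B along the segments from y / h to y' and from u / h to u'; both segments
    have length O(s^2), and so has their difference, relative to y - u. *)
Lemma four_point y y' u u' : I (y / h) -> I y' -> I (u / h) -> I u' ->
  `|y' - y / h| <= 4 * (K * s ^+ 2) ->
  `|(y' - y / h) - (u' - u / h)| <= 4 * (K * s ^+ 2) * `|y - u| ->
  `|(B y' - B u') - (B (y / h) - B (u / h))| <= 16 * K * (K * s ^+ 2) * `|y - u|.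
Proof.
move=> Iy Iy' Iu Iu' e1 e2.
pose al := y' - y / h; pose be := u' - u / h.
pose F t := B (y / h + t * al) - B (u / h + t * be).
pose dF t := dB (y / h + t * al) * al - dB (u / h + t * be) * be.
have dFP (t : R) : 0 <= t <= 1 -> is_derive t 1 F (dF t).
  move=> t01; have I1 := Iconv Iy Iy' t01; have I2 := Iconv Iu Iu' t01.
  rewrite /F; deriv.
  by rewrite /dF /=; ring.
have [c c01 E] := mvt ltr01 dFP.
have -> : (B y' - B u') - (B (y / h) - B (u / h)) = dF c.
  have <- : F 1 - F 0 = dF c by rewrite E; ring.
  rewrite /F; have -> : y / h + 1 * al = y' by rewrite /al; ring.
  have -> : u / h + 1 * be = u' by rewrite /be; ring.
  by rewrite !mul0r !addr0; ring.
have c01' : 0 <= c <= 1 by lra.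
have I1 := Iconv Iy Iy' c01'; have I2 := Iconv Iu Iu' c01'.
have -> : dF c = (dB (y / h + c * al) - dB (u / h + c * be)) * al +
    dB (u / h + c * be) * (al - be) by rewrite /dF; ring.
have cc : `|c| <= 1 by rewrite ger0_norm; lra.
have b1 : `|(y / h + c * al) - (u / h + c * be)| <=
    `|y - u| * (4 / 3) + 1 * (4 * (K * s ^+ 2) * `|y - u|).
  have -> : (y / h + c * al) - (u / h + c * be) = (y - u) / h + c * (al - be).
    by ring.
  by apply: normD_le; apply: normM_le.
have b2 := lipdB I1 I2.
have b3 : `|dB (y / h + c * al) - dB (u / h + c * be)| <= K * (2 * `|y - u|).
  have K0 : 0 <= K by have ? := K1; lra.
  apply: le_trans b2 (ler_wpM2l K0 _); apply: le_trans b1 _.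
  move: (normr_ge0 (y - u)) Ks s8; move: `|_ - _| (K * s ^+ 2) => c' k ? ? ?; nra.
apply: le_trans (normD_le (normM_le b3 e1) (normM_le (bdB I2) e2)) _.
move: (normr_ge0 (y - u)) Ks0 K1; move: `|y - u| (K * s ^+ 2) => c' k ? ? ?.
have : 0 <= K * k * c' by rewrite !mulr_ge0//; lra.
lra.
Qed.

(** The defect of the second equation, to be used where the first one holds. *)
Definition disp y y' := B1 y - h * kap * B2 y' + d.

(** The displacement has slope M up to nu + O(s^2) as soon as the explicit model
    B x - h * kap * B (x / h) has slope M up to nu. In the application M is of
    order s, hence dominates the error. *)
Lemma disp_diff y y' u u' (M nu : R) : I y -> I y' -> I u -> I u' ->
  I (y / h) -> I (u / h) ->
  E1 y = h * E2 y' -> E1 u = h * E2 u' ->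
  (forall x, Num.min y u <= x <= Num.max y u ->
     `|dB x - kap * dB (x / h) - M| <= nu) ->
  `|disp y y' - disp u u' - M * (y - u)| <=
    (nu + 40 * K * (K * s ^+ 2)) * `|y - u|.
Proof.
move=> Iy Iy' Iu Iu' Iyh Iuh E E' nuP.
have e1 := sol_shift Iy Iy' E.
have [e2 e3] := sol_shift2 Iy Iy' Iu Iu' E E'.
have e4 := four_point Iyh Iy' Iuh Iu' e1 e2.
have [_ f1] := cB1 Iy Iu; have [_ f2] := cB2 Iy' Iu'.
have /andP[? ?] := hh; have h0 : h != 0 by apply: lt0r_neq0; lra.
pose G x := B x - h * kap * B (x / h).
pose G' x := dB x - kap * dB (x / h).
have GP : `|G y - G u - M * (y - u)| <= nu * `|y - u|.
  wlog : y u Iy Iu Iyh Iuh nuP {Iy' Iu' E E' e1 e2 e3 e4 f1 f2} / u < y => [H|yu].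
    have [uy|yu|->] := ltgtP u y; first exact: H.
      have -> : G y - G u - M * (y - u) = - (G u - G y - M * (u - y)) by ring.
      rewrite normrN (distrC y); apply: H => // x xx.
      by apply: nuP; rewrite minC maxC.
    by rewrite !subrr mulr0 subrr normr0 mulr0.
  have dG (x : R) : u <= x <= y -> is_derive x 1 G (G' x).
    move=> uxy; have Ix : I x by rewrite /I in Iy Iu *; lra.
    have Ixh : I (x / h).
      have hv0 : 0 <= h^-1 by rewrite invr_ge0; lra.
      by rewrite /I in Iyh Iuh *; apply/andP; split; nra.
    rewrite /G; deriv.
    by rewrite /G' /=; field.
  have [c cuy Ec] := mvt yu dG.
  rewrite Ec -mulrBl normrM ler_wpM2r//; apply: nuP.
  by rewrite (min_idPr (ltW yu)) (max_idPl (ltW yu)); lra.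
have -> : disp y y' - disp u u' - M * (y - u) =
   (G y - G u - M * (y - u)) + (B1 y - B y - (B1 u - B u))
   - h * kap * (((B2 y' - B y') - (B2 u' - B u')) +
      ((B y' - B u') - (B (y / h) - B (u / h)))).
  by rewrite /disp /G; ring.
have hk : `|h * kap| <= 25 / 16.
  apply: le_trans (normM_le (_ : `|h| <= 5 / 4) (_ : `|kap| <= 5 / 4)) _.
  - exact: near_one_bound s1 h1.
  - exact: near_one_bound s1 kap1.
  - lra.
apply: le_trans (normB_le (normD_le GP f1) (normM_le hk (normD_le f2 e4))) _.
have : 0 <= K * s ^+ 2 * `|y - u| by rewrite mulr_ge0.
have : K * s ^+ 2 * `|y - u| <= K * (K * s ^+ 2 * `|y - u|).
  by rewrite ler_peMl// mulr_ge0.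
have : K * s ^+ 2 * `|y' - u'| <= 2 * (K * s ^+ 2 * `|y - u|).
  by rewrite (mulrCA 2); apply: ler_wpM2l.
move: `|y - u| `|y' - u'| (K * s ^+ 2) => a c k.
move=> g1 g2 g3; have : 0 <= K * (k * a) by lra.
have -> : 16 * K * k * a = 16 * (K * (k * a)) by ring.
have -> : (nu + 40 * K * k) * a = nu * a + 40 * (K * (k * a)) by ring.
lra.
Qed.

End core_fixed.

(** * First-order expansion of the displacement *)

Section slope.
Context {R : realType}.

Lemma mvt_between (p q : R) (f df : R -> R) (x y : R) :
  (forall z, p <= z <= q -> is_derive z 1 f (df z)) ->
  p <= x <= q -> p <= y <= q ->
  exists2 c, Num.min x y <= c <= Num.max x y & f x - f y = df c * (x - y).
Proof.
move=> dfP; wlog : x y / x < y => [H Ix Iy|xy Ix Iy].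
  have [->|] := eqVneq x y.
    by exists y; rewrite ?minxx ?maxxx ?lexx// !subrr mulr0.
  rewrite neq_lt => /orP[xy|yx]; first exact: H.
  have [c cc E] := H y x yx Iy Ix; exists c; first by rewrite minC maxC.
  by rewrite -opprB E -mulrN opprB.
have [c cc E] : exists2 c, x < c < y & f y - f x = df c * (y - x).
  by apply: mvt => // z ?; apply: dfP; lra.
exists c; first by rewrite (min_idPl (ltW xy)) (max_idPr (ltW xy)); lra.
by rewrite -opprB E -mulrN opprB.
Qed.

Lemma lip_within (f : R -> R) (a b L : R) :
  (forall x y, a <= x <= b -> a <= y <= b -> `|f x - f y| <= L * `|x - y|) ->
  {within `[a, b], continuous f}.
Proof.
move=> lip; apply/subspace_continuousP => x; rewrite /= in_itv /= => xab.
have L1 : 0 < `|L| + 1 by rewrite ltr_wpDl.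
apply/cvgrPdist_lt => e e0; rewrite near_withinE; near=> y.
rewrite /= in_itv /= => yab; apply: le_lt_trans (lip _ _ xab yab) _.
have : `|x - y| < e / (`|L| + 1).
  by near: y; apply: cvgr_dist_lt => //; rewrite divr_gt0.
rewrite ltr_pdivlMr// mulrC; apply: le_lt_trans; rewrite ler_wpM2r//.
by rewrite (le_trans (ler_norm _))// lerDl.
Unshelve. all: by end_near. Qed.

Variables (p q K : R) (B dB ddB : R -> R) (ys b w e : R).
Hypotheses (p0 : 0 < p) (qK : q <= K) (K1 : 1 <= K).
Hypotheses (bK : `|b| <= K) (wK : `|w| <= K).
Let I y := p <= y <= q.
Hypothesis Iys : I ys.
Hypothesis dBP : forall y, I y -> is_derive y 1 B (dB y).
Hypothesis ddBP : forall y, I y -> is_derive y 1 dB (ddB y).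
Hypothesis bB : forall y, I y -> `|B y| <= K.
Hypothesis bdB : forall y, I y -> `|dB y| <= K.
Hypothesis bddB : forall y, I y -> `|ddB y| <= K.

Variables (ep h kap d : R).
Let s := `|ep|.
Hypotheses (s1 : 8 * K * s <= 1).
Hypotheses (h2 : `|h - 1 - b * ep| <= K * s ^+ 2)
  (kap2 : `|kap - 1 + w * ep| <= K * s ^+ 2) (d2 : `|d - e * ep| <= K * s ^+ 2).

Let s0 : 0 <= s. Proof. exact: normr_ge0. Qed.
Let Ks : K * s ^+ 2 <= K * s.
Proof. have ? := K1; have ? := s1; have ? := s0; rewrite expr2; nra. Qed.

Lemma h_bound : `|h - 1| <= 2 * K * s.
Proof.
have -> : h - 1 = (h - 1 - b * ep) + b * ep by ring.
apply: le_trans (normD_le h2 (normM_le bK (lexx _))) _.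
by have := Ks; rewrite /s; lra.
Qed.
Lemma kap_bound : `|kap - 1| <= 2 * K * s.
Proof.
have -> : kap - 1 = (kap - 1 + w * ep) - w * ep by ring.
apply: le_trans (normB_le kap2 (normM_le wK (lexx _))) _.
by have := Ks; rewrite /s; lra.
Qed.

Let hV : 0 < h /\ `|h^-1| <= 4 / 3.
Proof.
have := h_bound; rewrite ler_norml => /andP[? ?].
have ? := s1; have h0 : 0 < h by lra.
have v0 : 0 < h^-1 by rewrite invr_gt0.
by split => //; rewrite gtr0_norm// -(ler_pM2l h0) mulfV ?gt_eqF//; lra.
Qed.

Lemma scale_bound x : I x -> `|x - x / h| <= 3 * K ^+ 2 * s /\
  `|x - x / h - b * ep * x| <= 4 * K ^+ 3 * s ^+ 2.
Proof.
move=> /andP[px xq]; have [h0 hv] := hV.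
have xK : `|x| <= K by rewrite gtr0_norm; have := p0; have := qK; lra.
have Kp : 0 <= K by have := K1; lra.
split.
  have -> : x - x / h = x * (h - 1) / h by field; apply: lt0r_neq0.
  apply: le_trans (normM_le (normM_le xK h_bound) hv) _.
  have : 0 <= K ^+ 2 * s by rewrite mulr_ge0 ?sqr_ge0.
  lra.
have -> : x - x / h - b * ep * x = x * ((h - 1 - b * ep) - b * ep * (h - 1)) / h.
  by field; apply: lt0r_neq0.
apply: le_trans (normM_le (normM_le xK (normB_le h2
  (normM_le (normM_le bK (lexx _)) h_bound))) hv) _.
rewrite -/s.
have : 0 <= K ^+ 2 * s ^+ 2 by rewrite mulr_ge0 ?sqr_ge0.
have : K ^+ 2 * s ^+ 2 <= K ^+ 3 * s ^+ 2.
  by rewrite ler_wpM2r ?sqr_ge0// [leRHS]exprS ler_peMl ?sqr_ge0.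
lra.
Qed.

Let m := b * ys * ddB ys + w * dB ys.

(** With kap = 1 - w ep and h = 1 + b ep at first order, the slope
    (dB x - dB (x / h)) + (1 - kap) * dB (x / h) of the model is ep times
    b x ddB x + w dB x at first order, hence close to ep * m near ys. *)
Lemma slope_bound (rho nu eta x : R) :
  (forall z, I z -> `|z - ys| <= rho -> `|ddB z - ddB ys| <= nu) ->
  I x -> I (x / h) -> `|x - ys| <= eta -> 2 * eta <= rho ->
  6 * K ^+ 2 * s <= rho ->
  `|dB x - kap * dB (x / h) - ep * m| <=
    s * (3 * K ^+ 2 * nu + 8 * K ^+ 4 * s + 2 * K ^+ 2 * eta).
Proof.
move=> nuP Ix Ixh xe e2 r2.
have Kp : 0 <= K by have := K1; lra.
have [sb1 sb2] := scale_bound Ix.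
have [z zb Ez] := mvt_between ddBP Ix Ixh.
have zx : `|z - x| <= `|x - x / h|.
  move: zb; have [/ltW xy|xy] := ltP x (x / h).
    by move=> /andP[? ?]; rewrite ger0_norm ?ler0_norm; lra.
  by move=> /andP[? ?]; rewrite ler0_norm ?ger0_norm; lra.
have zys : `|z - ys| <= rho.
  have -> : z - ys = (z - x) + (x - ys) by ring.
  apply: le_trans (normD_le (le_trans zx sb1) xe) _; lra.
have Iz : I z.
  move: zb Ix Ixh; rewrite /I; have [/ltW xy|xy] := ltP x (x / h); lra.
have t1 := normM_le (nuP z Iz zys) sb1.
have t2 : `|x - x / h - b * ep * ys| <= 4 * K ^+ 3 * s ^+ 2 + K * s * eta.
  have -> : x - x / h - b * ep * ys = (x - x / h - b * ep * x) + b * ep * (x - ys).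
    by ring.
  exact: normD_le sb2 (normM_le (normM_le bK (lexx _)) xe).
have t3 : `|dB (x / h) - dB ys| <= K * (eta + 3 * K ^+ 2 * s).
  have := mvt_abs ddBP bddB Ixh Iys; move/le_trans; apply; rewrite ler_wpM2l//.
  have -> : x / h - ys = (x - ys) - (x - x / h) by ring.
  exact: normB_le.
have -> : dB x - kap * dB (x / h) - ep * m =
   (ddB z - ddB ys) * (x - x / h) + ddB ys * (x - x / h - b * ep * ys) +
   (- (kap - 1 + w * ep) * dB (x / h) + w * ep * (dB (x / h) - dB ys)).
  transitivity ((dB x - dB (x / h)) + (1 - kap) * dB (x / h) - ep * m); first by ring.
  by rewrite Ez /m; ring.
have kk : `|- (kap - 1 + w * ep)| <= K * s ^+ 2 by rewrite normrN.
apply: le_trans (normD_le (normD_le t1 (normM_le (bddB Iys) t2))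
   (normD_le (normM_le kk (bdB Ixh)) (normM_le (normM_le wK (lexx _)) t3))) _.
rewrite -/s.
have ? := s0.
have : K ^+ 2 * s ^+ 2 <= K ^+ 4 * s ^+ 2.
  by rewrite ler_wpM2r ?sqr_ge0// (exprD K 2 2) ler_peMl ?sqr_ge0// exprn_ege1.
lra.
Qed.

Hypothesis Mys : b * (ys * dB ys - B ys) + w * B ys + e = 0.

(** The first-order term in ep of the model displacement at ys is the left-hand
    side of [Mys]; only second-order terms remain. *)
Lemma base_bound : I (ys / h) ->
  `|B ys - h * kap * B (ys / h) + d| <= 27 * K ^+ 5 * s ^+ 2.
Proof.
move=> Iysh; have Kp : 0 <= K by have := K1; lra.
have [h0 hv] := hV.
have yK : `|ys| <= K.
  by move/andP: Iys => [? ?]; rewrite gtr0_norm; have := p0; have := qK; lra.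
have [sb1 _] := scale_bound Iys.
pose r := B (ys / h) - B ys - dB ys * (ys / h - ys).
have rb : `|r| <= K * (3 * K ^+ 2 * s) * (3 * K ^+ 2 * s).
  have [z zb Ez] := mvt_between dBP Iysh Iys.
  have Iz : I z.
    move: zb Iysh Iys; rewrite /I; have [/ltW xy|xy] := ltP (ys / h) ys; lra.
  have -> : r = (dB z - dB ys) * (ys / h - ys) by rewrite /r Ez; ring.
  apply: normM_le; last by rewrite distrC.
  apply: le_trans (mvt_abs ddBP bddB Iz Iys) _; rewrite ler_wpM2l//.
  apply: le_trans sb1.
  move: zb; have [/ltW xy|xy] := ltP (ys / h) ys => /andP[? ?].
    by rewrite ler0_norm ?ger0_norm; lra.
  by rewrite ger0_norm ?ler0_norm; lra.
have hk : `|h * kap| <= 25 / 16.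
  apply: le_trans (normM_le (_ : `|h| <= 5 / 4) (_ : `|kap| <= 5 / 4)) _.
  - exact: near_one_bound s1 h_bound.
  - exact: near_one_bound s1 kap_bound.
  - lra.
have hb := h_bound; have kb := kap_bound.
have -> : B ys - h * kap * B (ys / h) + d =
   B ys * (- (h - 1 - b * ep) - (kap - 1 + w * ep) - (h - 1) * (kap - 1)) +
   dB ys * ys * ((h - 1 - b * ep) + (kap - 1) * (h - 1)) + (d - e * ep)
   - h * kap * r.
  transitivity (B ys - h * kap * B (ys / h) + d -
     ep * (b * (ys * dB ys - B ys) + w * B ys + e)); first by rewrite Mys; ring.
  by rewrite /r; field; apply: lt0r_neq0.
have h2' : `|- (h - 1 - b * ep)| <= K * s ^+ 2 by rewrite normrN.
apply: le_trans (normB_le (normD_le (normD_le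
  (normM_le (bB Iys) (normB_le (normB_le h2' kap2) (normM_le hb kb)))
  (normM_le (normM_le (bdB Iys) yK) (normD_le h2 (normM_le kb hb)))) d2)
  (normM_le hk rb)) _.
have P1 n : (n <= 5)%N -> 0 <= K ^+ n * s ^+ 2 /\ K ^+ n * s ^+ 2 <= K ^+ 5 * s ^+ 2.
  move=> n5; split; first by rewrite mulr_ge0 ?sqr_ge0// exprn_ge0.
  by rewrite ler_wpM2r ?sqr_ge0//; apply: ler_weXn2l.
have [_ q1] := P1 1%N isT; have [_ q2] := P1 2 isT; have [_ q3] := P1 3 isT.
have [_ q4] := P1 4 isT; have [q5 _] := P1 5 isT.
move: q1 q2 q3 q4 q5; rewrite expr1; lra.
Qed.

End slope.

(** * Persistence of a simple zero *)

Lemma near0_small {R : realType} (dl : R) : 0 < dl ->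
  \forall ep \near (0 : R)^', 0 < `|ep| /\ `|ep| <= dl.
Proof.
move=> dl0; near=> ep; split.
  by rewrite normr_gt0; near: ep; exact: nbhs_dnbhs_neq.
by near: ep; exact: dnbhs0_le.
Unshelve. all: by end_near. Qed.

Lemma near0_mul {R : realType} (c a : R) : 0 < c -> 0 < a ->
  \forall ep \near (0 : R)^', 0 < `|ep| /\ c * `|ep| <= a.
Proof.
move=> c0 a0; near=> ep; have [s0 s1] : 0 < `|ep| /\ `|ep| <= a / c.
  by near: ep; apply: near0_small; rewrite divr_gt0.
by split => //; rewrite mulrC -ler_pdivlMr.
Unshelve. all: by end_near. Qed.

Lemma near0_natmul {R : realType} (n : nat) (k a : R) : (0 < n)%N -> 0 < k -> 0 < a ->
  \forall ep \near (0 : R)^', 0 < `|ep| /\ n%:R * k * `|ep| <= a.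
Proof. by move=> n0 k0 a0; apply: near0_mul => //; rewrite mulr_gt0// ltr0n. Qed.

Section intervals.
Context {R : realType}.
Implicit Types p q c eta x y u : R.

Lemma itv_ball p q c eta x : `|x - c| <= eta -> p <= c - eta -> c + eta <= q ->
  p <= x <= q.
Proof. by rewrite ler_norml => /andP[? ?] ? ?; lra. Qed.

Lemma ball_itv c eta x : c - eta <= x <= c + eta -> `|x - c| <= eta.
Proof. by rewrite ler_norml; lra. Qed.

Lemma itv_ball2 p q c eta x y dl : `|x - c| <= eta -> `|x - y| <= dl ->
  p <= c - (eta + dl) -> c + (eta + dl) <= q -> p <= y <= q.
Proof. by rewrite !ler_norml => /andP[? ?] /andP[? ?] ? ?; lra. Qed.

Lemma ball_between c eta x y u : `|y - c| <= eta -> `|u - c| <= eta ->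
  Num.min y u <= x <= Num.max y u -> `|x - c| <= eta.
Proof.
rewrite !ler_norml => /andP[? ?] /andP[? ?].
by have [/ltW ?|?] := ltP y u => /andP[? ?]; lra.
Qed.

Lemma itv_ge2 p q x y u : p <= x <= q -> p <= y <= q -> x <= u <= y -> p <= u <= q.
Proof. by move=> /andP[? ?] /andP[? ?] /andP[? ?]; lra. Qed.

Lemma itv_margins p q c eta k s : 0 < eta -> eta <= (c - p) / 8 -> eta <= (q - c) / 8 ->
  6 * k * s <= eta -> [/\ p <= c - (eta + 3 * k * s), c + (eta + 3 * k * s) <= q,
    p <= c - eta & c + eta <= q].
Proof. by move=> ? ? ? ?; split; lra. Qed.

Lemma slope_arith (nu M k2 k4 s eta : R) : 0 <= M -> 3 * k2 * nu = M / 16 ->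
  640 * k4 * s <= M -> 32 * k2 * eta <= M ->
  3 * k2 * nu + 8 * k4 * s + 2 * k2 * eta <= M / 4 + M / 16.
Proof. by move=> ? ? ? ?; lra. Qed.

Lemma diff_arith (M k2 k4 s : R) : 0 <= M -> k2 * s <= k4 * s -> 640 * k4 * s <= M ->
  M / 4 + M / 16 + 40 * (k2 * s) <= M / 2.
Proof. by move=> ? ? ?; lra. Qed.

Lemma sq_small (K s : R) : 1 <= K -> 0 <= s -> 8 * K * s <= 1 ->
  K * s ^+ 2 <= K ^+ 2 * s.
Proof.
move=> K1 s0 s1; have sK : s <= K by nra.
have : 0 <= K * s * (K - s) by rewrite !mulr_ge0// ?subr_ge0//; lra.
lra.
Qed.

Lemma itv_le c x : 0 < x -> c - x <= c + x.
Proof. by move=> ?; lra. Qed.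

(** [root_below] and [root_above] bracket the value E1 y between the values of
    h * E2 at distance 2 eta of c on either side, which gives y' by the
    intermediate value theorem. *)
Lemma root_below (K s h c eta y Ey Ev : R) : 1 <= K -> 0 <= s -> 8 * K * s <= 1 ->
  10 * K ^+ 2 * s <= eta -> `|h - 1| <= 2 * K * s -> 0 < c - 2 * eta -> c + 2 * eta <= K ->
  `|Ev - (c - 2 * eta)| <= K * s ^+ 2 -> `|Ey - y| <= K * s ^+ 2 -> `|y - c| <= eta ->
  h * Ev <= Ey.
Proof.
move=> K1 s0 s1 s2 h1 c1 c2; have Ks := sq_small K1 s0 s1.
move: h1; rewrite !ler_norml => /andP[? ?] /andP[? ?] /andP[? ?] /andP[? ?].
have K2s : 0 <= K ^+ 2 * s by rewrite mulr_ge0 ?sqr_ge0.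
have Ks2 : 0 <= K * s ^+ 2 by rewrite mulr_ge0 ?sqr_ge0//; lra.
have h0 : 0 <= h by lra.
have e1 : h * Ev <= h * (c - 2 * eta + K * s ^+ 2) by apply: ler_wpM2l => //; lra.
have e2 : h * (c - 2 * eta + K * s ^+ 2) <=
    (1 + 2 * K * s) * (c - 2 * eta + K * s ^+ 2) by apply: ler_wpM2r; lra.
have e3 : K * s * (c - 2 * eta) <= K * s * K by apply: ler_wpM2l; [rewrite mulr_ge0//; lra|lra].
have e4 : K * s * (K * s ^+ 2) <= 1 / 8 * (K * s ^+ 2) by apply: ler_wpM2r => //; lra.
lra.
Qed.

Lemma root_above (K s h c eta y Ey Ev : R) : 1 <= K -> 0 <= s -> 8 * K * s <= 1 ->
  10 * K ^+ 2 * s <= eta -> `|h - 1| <= 2 * K * s -> 0 < c - 2 * eta -> c + 2 * eta <= K ->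
  `|Ev - (c + 2 * eta)| <= K * s ^+ 2 -> `|Ey - y| <= K * s ^+ 2 -> `|y - c| <= eta ->
  Ey <= h * Ev.
Proof.
move=> K1 s0 s1 s2 h1 c1 c2; have Ks := sq_small K1 s0 s1.
move: h1; rewrite !ler_norml => /andP[? ?] /andP[? ?] /andP[? ?] /andP[? ?].
have K2s : 0 <= K ^+ 2 * s by rewrite mulr_ge0 ?sqr_ge0.
have Ks2 : 0 <= K * s ^+ 2 by rewrite mulr_ge0 ?sqr_ge0//; lra.
have h0 : 0 <= h by lra.
have e1 : h * (c + 2 * eta - K * s ^+ 2) <= h * Ev by apply: ler_wpM2l => //; lra.
have e2 : (1 - 2 * K * s) * (c + 2 * eta - K * s ^+ 2) <=
    h * (c + 2 * eta - K * s ^+ 2) by apply: ler_wpM2r; lra.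
have e3 : K * s * (c + 2 * eta) <= K * s * K by apply: ler_wpM2l; [rewrite mulr_ge0//; lra|lra].
have e4 : 0 <= K * s * (K * s ^+ 2) by rewrite mulr_ge0// mulr_ge0//; lra.
lra.
Qed.

(** A function of slope close to em is of opposite signs at both ends of the interval
    of radius eta if it is small enough, compared to em * eta, at the centre. *)
Lemma sign_change (D0 DL DR em eta : R) : 0 < `|em| * eta ->
  `|DR - D0 - em * eta| <= `|em| / 2 * eta -> `|DL - D0 + em * eta| <= `|em| / 2 * eta ->
  `|D0| <= 2 / 5 * (`|em| * eta) ->
  Num.min DL DR <= 0 <= Num.max DL DR.
Proof.
rewrite !ler_norml ge_min le_max.
have [m0|m0] := ltP 0 em.
  have -> : `|em| = em by rewrite gtr0_norm.
  move=> e0 /andP[? ?] /andP[? ?] /andP[? ?].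
  by apply/andP; split; apply/orP; [left|right]; lra.
have -> : `|em| = - em by rewrite ler0_norm.
move=> e0 /andP[? ?] /andP[? ?] /andP[? ?].
by apply/andP; split; apply/orP; [right|left]; lra.
Qed.

Lemma scale_arith (k s eta eta0 : R) : 0 < eta -> 2 * eta <= eta0 ->
  10 * k * s <= eta -> 3 * k * s <= 3 * eta0.
Proof. by move=> *; lra. Qed.

Lemma half_margin (eta a : R) : 0 < eta -> 2 * eta <= a ->
  [/\ eta <= 3 * a, 2 * eta <= 3 * a & eta <= a].
Proof. by move=> ? ?; split; lra. Qed.

Lemma triple_le (x a : R) : x <= a -> 0 < a -> x <= 3 * a.
Proof. by move=> ? ?; lra. Qed.

Lemma half_absorb (a c : R) : a * c <= a / 2 * c -> a * c <= 0.
Proof. by move=> ?; lra. Qed.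

Lemma base_arith (K a : R) : K * a <= K ^+ 5 * a -> K ^+ 2 * a <= K ^+ 5 * a ->
  0 <= K ^+ 5 * a ->
  K * a + 27 * K ^+ 5 * a + 25 / 16 * (K * a + K * (4 * (K * a))) <= 40 * K ^+ 5 * a.
Proof. by move=> ? ? ?; lra. Qed.

Lemma margin_l (p c x : R) : x <= (c - p) / 8 -> 0 < x -> p <= c - 3 * x.
Proof. by move=> ? ?; lra. Qed.

Lemma margin_r (q c x : R) : x <= (q - c) / 8 -> 0 < x -> c + 3 * x <= q.
Proof. by move=> ? ?; lra. Qed.

End intervals.

(** ys is a simple zero of M y = b * (y * dB y - B y) + w * B y + e, and m is the
    derivative of M at ys. The system [balanced] is close to its degenerate limit
    y = y', B y = B y', to order ep^2 for the functions and with explicit first-order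
    terms for the constants h, kap, d. *)
Section core.
Context {R : realType}.
Variables (p q K : R) (B dB ddB : R -> R) (ys b w e : R).
Hypotheses (p0 : 0 < p) (qK : q <= K) (K1 : 1 <= K).
Hypotheses (bK : `|b| <= K) (wK : `|w| <= K) (pys : p < ys) (ysq : ys < q).
Let I y := p <= y <= q.
Hypothesis dBP : forall y, I y -> is_derive y 1 B (dB y).
Hypothesis ddBP : forall y, I y -> is_derive y 1 dB (ddB y).
Hypothesis bB : forall y, I y -> `|B y| <= K.
Hypothesis bdB : forall y, I y -> `|dB y| <= K.
Hypothesis bddB : forall y, I y -> `|ddB y| <= K.
Hypothesis cddB : {for ys, continuous ddB}.
Hypothesis Mys : b * (ys * dB ys - B ys) + w * B ys + e = 0.
Let m := b * ys * ddB ys + w * dB ys.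
Hypothesis m0 : m != 0.
Variables (E1 E2 B1 B2 : R -> R -> R) (h kap d : R -> R).
Hypothesis closeP : \forall ep \near 0^',
  [/\ C1close p q (E1 ep) id (K * `|ep| ^+ 2), C1close p q (E2 ep) id (K * `|ep| ^+ 2),
     C1close p q (B1 ep) B (K * `|ep| ^+ 2) & C1close p q (B2 ep) B (K * `|ep| ^+ 2)] /\
  [/\ `|h ep - 1 - b * ep| <= K * `|ep| ^+ 2,
     `|kap ep - 1 + w * ep| <= K * `|ep| ^+ 2 & `|d ep - e * ep| <= K * `|ep| ^+ 2].

Definition balanced ep y y' :=
  E1 ep y = h ep * E2 ep y' /\ B1 ep y = h ep * kap ep * B2 ep y' - d ep.

Let lipdB y u : I y -> I u -> `|dB y - dB u| <= K * `|y - u|.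
Proof. exact: mvt_abs. Qed.

Let Iys : I ys. Proof. by apply/andP; split; apply: ltW. Qed.

Let disp' ep := disp (h ep) (kap ep) (d ep) (B1 ep) (B2 ep).

Let disp0 ep y y' :
  B1 ep y = h ep * kap ep * B2 ep y' - d ep <-> disp' ep y y' = 0.
Proof.
by rewrite /disp' /disp; split => [->|/eqP]; [ring|rewrite addr_eq0 subr_eq addrC => /eqP].
Qed.

(** On the curve defined by the first equation, the displacement has slope ep * m,
    up to one half of it. *)
Lemma disp_near : exists eta0, [/\ 0 < eta0, p <= ys - 3 * eta0, ys + 3 * eta0 <= q
  & \forall ep \near 0^', forall y y' u u', `|y - ys| <= eta0 -> `|u - ys| <= eta0 ->
    I y' -> I u' -> E1 ep y = h ep * E2 ep y' -> E1 ep u = h ep * E2 ep u' ->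
    `|disp' ep y y' - disp' ep u u' - ep * m * (y - u)| <= `|ep| * `|m| / 2 * `|y - u|
    /\ `|y' - u'| <= 2 * `|y - u|].
Proof.
have ? := K1; have ? := pys; have ? := ysq; have Kp : 0 < K by lra.
have am0 : 0 < `|m| by rewrite normr_gt0.
pose nu := `|m| / (48 * K ^+ 2).
have K2 : 0 < K ^+ 2 by rewrite exprn_gt0.
have nuE : 3 * K ^+ 2 * nu = `|m| / 16 by rewrite /nu; field; rewrite lt0r_neq0.
have nu0 : 0 < nu by apply: divr_gt0 => //; lra.
have [rho /= rho0 rhoP] : exists2 rho : R, 0 < rho &
    forall z, `|z - ys| < rho -> `|ddB z - ddB ys| <= nu.
  have /nbhs_ballP[r r0 rP] : \forall z \near ys, `|ddB ys - ddB z| <= nu.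
    by move/cvgrPdist_le: cddB; apply.
  exists r => // z zr; rewrite distrC; apply: rP.
  by rewrite /ball /= distrC.
pose eta0 := Num.min (Num.min (rho / 4) (`|m| / (32 * K ^+ 2)))
                     (Num.min ((ys - p) / 8) ((q - ys) / 8)).
have K4 : 0 < K ^+ 4 by rewrite exprn_gt0.
have eta00 : 0 < eta0.
  rewrite !lt_min; apply/andP; split; apply/andP; split; last 2 first.
  - lra.
  - lra.
  - lra.
  by apply: divr_gt0 => //; lra.
have e1 : eta0 <= rho / 4 by rewrite !ge_min lexx.
have e2 : eta0 <= `|m| / (32 * K ^+ 2) by rewrite !ge_min lexx !orbT.
have e2' : 32 * K ^+ 2 * eta0 <= `|m| by have := e2; rewrite ler_pdivlMr; lra.
have e3 : eta0 <= (ys - p) / 8 by rewrite !ge_min lexx !orbT.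
have e4 : eta0 <= (q - ys) / 8 by rewrite !ge_min lexx !orbT.
have r1 : 2 * eta0 <= rho / 2 by lra.
have r2' : eta0 <= rho / 2 by lra.
move: eta0 eta00 e1 e2 e2' e3 e4 r1 r2' => eta0 eta00 e1 e2 e2' e3 e4 r1 r2'.
exists eta0; split => //; [exact: margin_l e3 eta00|exact: margin_r e4 eta00|].
near=> ep => y y' u u' yy uu Iy' Iu' Ey Eu.
have [s0 s1'] : 0 < `|ep| /\ 8 * K * `|ep| <= 1.
  by near: ep; exact: (@near0_natmul _ 8 _ _ isT Kp ltr01).
have [_ s2'] : 0 < `|ep| /\ 6 * K ^+ 2 * `|ep| <= eta0.
  by near: ep; exact: (@near0_natmul _ 6 _ _ isT K2 eta00).
have [_ s3'] : 0 < `|ep| /\ 640 * K ^+ 4 * `|ep| <= `|m|.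
  by near: ep; exact: (@near0_natmul _ 640 _ _ isT K4 am0).
have [[cE1 cE2 cB1 cB2] [h2 kap2 d2]] : [/\ C1close p q (E1 ep) id (K * `|ep| ^+ 2), C1close p q (E2 ep) id (K * `|ep| ^+ 2),
     C1close p q (B1 ep) B (K * `|ep| ^+ 2) & C1close p q (B2 ep) B (K * `|ep| ^+ 2)] /\
  [/\ `|h ep - 1 - b * ep| <= K * `|ep| ^+ 2,
     `|kap ep - 1 + w * ep| <= K * `|ep| ^+ 2 & `|d ep - e * ep| <= K * `|ep| ^+ 2].
  by near: ep.
have h1 := h_bound K1 bK s1' h2.
have k1 := kap_bound K1 wK s1' kap2.
have [i1 i2 i3 i4] := itv_margins eta00 e3 e4 s2'.
have Ix x : `|x - ys| <= eta0 -> I x /\ I (x / h ep).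
  move=> xx; have Ixx : I x := itv_ball xx i3 i4.
  have [xh _] := scale_bound p0 qK K1 bK s1' h2 Ixx.
  by split => //; exact: (itv_ball2 xx xh).
have [Iy Iyh] := Ix y yy; have [Iu Iuh] := Ix u uu.
have nuP x : Num.min y u <= x <= Num.max y u ->
    `|dB x - kap ep * dB (x / h ep) - ep * m| <= `|ep| * (`|m| / 4 + `|m| / 16).
  move=> xyu; have xx := ball_between yy uu xyu.
  have [Ixx Ixh] := Ix x xx.
  have rhoP' z : I z -> `|z - ys| <= rho / 2 -> `|ddB z - ddB ys| <= nu.
    by move=> _ zz; apply/rhoP/(le_lt_trans zz); rewrite ltr_pdivrMr// ltr_pMr// ltr1n.
  have := slope_bound p0 qK K1 bK wK Iys ddBP bdB bddB s1' h2 kap2 rhoP' Ixx Ixh xx.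
  have r2 : 6 * K ^+ 2 * `|ep| <= rho / 2 := le_trans s2' r2'.
  move=> /(_ r1 r2); rewrite -/m => H; apply: le_trans H _.
  by apply: ler_wpM2l => //; exact: slope_arith (normr_ge0 m) nuE s3' e2'.
have H := disp_diff K1 dBP bdB lipdB (d ep) (ltW s0) s1' cE1 cE2 cB1 cB2 h1 k1
  Iy Iy' Iu Iu' Iyh Iuh Ey Eu nuP.
have [_ yu'] := sol_shift2 K1 (ltW s0) s1' cE1 cE2 h1 Iy Iy' Iu Iu' Ey Eu.
split => //; apply: le_trans H _; apply: ler_wpM2r => //.
have K24 : K ^+ 2 * `|ep| <= K ^+ 4 * `|ep|.
  by apply: ler_wpM2r => //; rewrite (exprD K 2 2) ler_peMl ?sqr_ge0// exprn_ege1.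
have -> : 40 * K * (K * `|ep| ^+ 2) = `|ep| * (40 * (K ^+ 2 * `|ep|)) by ring.
rewrite -mulrDr -mulrA; apply: ler_wpM2l => //; exact: diff_arith (normr_ge0 m) K24 s3'.
Unshelve. all: by end_near. Qed.

Lemma base_near ep y' : 0 < `|ep| -> 8 * K * `|ep| <= 1 -> 
  [/\ C1close p q (E1 ep) id (K * `|ep| ^+ 2), C1close p q (E2 ep) id (K * `|ep| ^+ 2),
     C1close p q (B1 ep) B (K * `|ep| ^+ 2) & C1close p q (B2 ep) B (K * `|ep| ^+ 2)] /\
  [/\ `|h ep - 1 - b * ep| <= K * `|ep| ^+ 2,
     `|kap ep - 1 + w * ep| <= K * `|ep| ^+ 2 & `|d ep - e * ep| <= K * `|ep| ^+ 2] ->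
  I (ys / h ep) -> I y' -> E1 ep ys = h ep * E2 ep y' ->
  `|disp' ep ys y'| <= 40 * K ^+ 5 * `|ep| ^+ 2.
Proof.
move=> s0 s1 [[cE1 cE2 cB1 cB2] [h2 kap2 d2]] Iyh Iy' E.
have ? := K1; have h1 := h_bound K1 bK s1 h2.
have k1 := kap_bound K1 wK s1 kap2.
have b1 := base_bound p0 qK K1 bK wK Iys dBP ddBP bB bdB bddB s1 h2 kap2 d2 Mys Iyh.
have b2 := sol_shift K1 s1 cE1 cE2 h1 Iys Iy' E.
have [b3 _] := cB1 _ _ Iys Iys; have [b4 _] := cB2 _ _ Iy' Iy'.
have b5 := le_trans (mvt_abs dBP bdB Iy' Iyh) (ler_wpM2l (_ : 0 <= K) b2).
have hk : `|h ep * kap ep| <= 25 / 16.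
  apply: le_trans (normM_le (_ : `|h ep| <= 5 / 4) (_ : `|kap ep| <= 5 / 4)) _.
  - exact: near_one_bound s1 h1.
  - exact: near_one_bound s1 k1.
  - lra.
have -> : disp' ep ys y' = (B1 ep ys - B ys) + (B ys - h ep * kap ep * B (ys / h ep) + d ep)
    - h ep * kap ep * ((B2 ep y' - B y') + (B y' - B (ys / h ep))).
  by rewrite /disp' /disp; ring.
apply: le_trans (normB_le (normD_le b3 b1) (normM_le hk (normD_le b4 (b5 _)))) _; first lra.
have K5 n : (n <= 5)%N -> 0 <= K ^+ n * `|ep| ^+ 2 /\
    K ^+ n * `|ep| ^+ 2 <= K ^+ 5 * `|ep| ^+ 2.
  move=> n5; split; first by rewrite mulr_ge0 ?sqr_ge0// exprn_ge0//; lra.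
  by rewrite ler_wpM2r ?sqr_ge0//; apply: ler_weXn2l.
have [_ q1] := K5 1%N isT; have [_ q2] := K5 2 isT; have [q5 _] := K5 5 isT.
move: q1 q2 q5; rewrite expr1; exact: base_arith.
Qed.

(** Near ys the displacement is a function of y, through the first equation, with
    slope at least `|ep * m| / 2, and it is O(ep^2) at ys: it has exactly one zero,
    at a distance O(ep) from ys. *)
Theorem balanced_near : exists eta0, [/\ 0 < eta0, p <= ys - eta0, ys + eta0 <= q,
  \forall ep \near 0^', forall y y' u u', `|y - ys| <= eta0 -> `|u - ys| <= eta0 ->
    `|y' - ys| <= eta0 -> `|u' - ys| <= eta0 ->
    balanced ep y y' -> balanced ep u u' -> y = u /\ y' = u'
  & forall eta, 0 < eta -> \forall ep \near 0^', exists y y',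
     [/\ `|y - ys| <= eta, `|y' - ys| <= eta & balanced ep y y']].
Proof.
have ? := K1; have ? := pys; have ? := ysq; have Kp : 0 < K by lra.
have am0 : 0 < `|m| by rewrite normr_gt0.
have ? := p0; have ? := qK; have [eta0 [eta00 pe eq dP]] := disp_near.
have Inear x : `|x - ys| <= 3 * eta0 -> I x.
  by move=> xx; apply: (itv_ball xx).
exists eta0; split => //; [lra|lra| |].
  near=> ep => y y' u u' yy uu yy' uu' [Ey By] [Eu Bu].
  have [s0 _] : 0 < `|ep| /\ `|ep| <= 1 by near: ep; exact: near0_small.
  have [H1 H2] : `|disp' ep y y' - disp' ep u u' - ep * m * (y - u)| <=
      `|ep| * `|m| / 2 * `|y - u| /\ `|y' - u'| <= 2 * `|y - u|.
    have Iy' : I y' by apply: Inear; exact: triple_le yy' eta00.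
    have Iu' : I u' by apply: Inear; exact: triple_le uu' eta00.
    move: y y' u u' yy uu Iy' Iu' Ey Eu {yy' uu' By Bu}; near: ep; exact: dP.
  have E : y = u.
    move: H1; move/disp0: By => ->; move/disp0: Bu => ->.
    rewrite subrr sub0r normrN !normrM => H1.
    apply/eqP; rewrite -subr_eq0 -normr_le0 -(pmulr_rle0 _ (mulr_gt0 s0 am0)).
    exact: half_absorb H1.
  split => //; move: H2; rewrite E subrr normr0 mulr0 normr_le0 subr_eq0.
  by move/eqP.
move=> eta1 eta10.
pose eta := Num.min eta1 eta0 / 2.
have K2 : 0 < K ^+ 2 by rewrite exprn_gt0.
have K5 : 0 < K ^+ 5 by rewrite exprn_gt0.
have eta_gt0 : 0 < eta by rewrite /eta divr_gt0// lt_min eta10.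
have meta : 0 < `|m| * eta by rewrite mulr_gt0.
have etale1 : 2 * eta <= eta1 by rewrite /eta mulrC divfK ?pnatr_eq0// ge_min lexx.
have etale0 : 2 * eta <= eta0 by rewrite /eta mulrC divfK ?pnatr_eq0// ge_min lexx orbT.
have l1 : eta <= 3 * eta0 by have [] := half_margin eta_gt0 etale0.
have l2 : 2 * eta <= 3 * eta0 by have [] := half_margin eta_gt0 etale0.
have l3 : eta <= eta0 by have [] := half_margin eta_gt0 etale0.
have l4 : eta <= eta1 by have [] := half_margin eta_gt0 etale1.
move: eta eta_gt0 meta etale1 etale0 l1 l2 l3 l4 =>
  eta eta_gt0 meta etale1 etale0 l1 l2 l3 l4.
near=> ep.
have [s0 s1'] : 0 < `|ep| /\ 8 * K * `|ep| <= 1.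
  by near: ep; exact: (@near0_natmul _ 8 _ _ isT Kp ltr01).
have [_ s2'] : 0 < `|ep| /\ 10 * K ^+ 2 * `|ep| <= eta.
  by near: ep; exact: (@near0_natmul _ 10 _ _ isT K2 eta_gt0).
have [_ s3'] : 0 < `|ep| /\ 100 * K ^+ 5 * `|ep| <= `|m| * eta.
  by near: ep; exact: (@near0_natmul _ 100 _ _ isT K5 meta).
have cl : [/\ C1close p q (E1 ep) id (K * `|ep| ^+ 2), C1close p q (E2 ep) id (K * `|ep| ^+ 2),
     C1close p q (B1 ep) B (K * `|ep| ^+ 2) & C1close p q (B2 ep) B (K * `|ep| ^+ 2)] /\
  [/\ `|h ep - 1 - b * ep| <= K * `|ep| ^+ 2,
     `|kap ep - 1 + w * ep| <= K * `|ep| ^+ 2 & `|d ep - e * ep| <= K * `|ep| ^+ 2].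
  by near: ep.
have dPe y y' u u' : `|y - ys| <= eta0 -> `|u - ys| <= eta0 ->
    I y' -> I u' -> E1 ep y = h ep * E2 ep y' -> E1 ep u = h ep * E2 ep u' ->
    `|disp' ep y y' - disp' ep u u' - ep * m * (y - u)| <= `|ep| * `|m| / 2 * `|y - u|
    /\ `|y' - u'| <= 2 * `|y - u|.
  by move: y y' u u'; near: ep.
have [[cE1 cE2 cB1 cB2] [h2 kap2 d2]] := cl.
have h1 := h_bound K1 bK s1' h2.
have Ks : K * `|ep| ^+ 2 <= K ^+ 2 * `|ep|.
  exact: sq_small.
(* solve the first equation for y' as a function psi of y *)
have psiP y : exists y', `|y - ys| <= eta ->
    `|y' - ys| <= 2 * eta /\ E1 ep y = h ep * E2 ep y'.
  have [yy|] := boolP (`|y - ys| <= eta); last by exists 0.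
  have Iy : I y := Inear _ (le_trans yy l1).
  pose f t := h ep * E2 ep t.
  have I1 : I (ys - 2 * eta) by apply: Inear; rewrite addrAC subrr add0r normrN gtr0_norm// mulr_gt0.
  have I2 : I (ys + 2 * eta) by apply: Inear; rewrite addrAC subrr add0r gtr0_norm// mulr_gt0.
  have cf : {within `[ys - 2 * eta, ys + 2 * eta], continuous f}.
    apply: (@lip_within _ f _ _ (`|h ep| * (K * `|ep| ^+ 2 + 1))) => x z xx zz.
    have Ix : I x by exact: itv_ge2 I1 I2 xx.
    have Iz : I z by exact: itv_ge2 I1 I2 zz.
    rewrite /f -mulrBr normrM -mulrA ler_wpM2l//.
    have [_ H] := cE2 _ _ Ix Iz.
    have -> : E2 ep x - E2 ep z = (E2 ep x - id x - (E2 ep z - id z)) + (x - z).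
      by rewrite /=; ring.
    by rewrite mulrDl mul1r; apply: normD_le.
  have [a1 _] := cE2 _ _ I1 I1; have [a2 _] := cE2 _ _ I2 I2.
  have [a3 _] := cE1 _ _ Iy Iy.
  have qb1 : ys + 2 * eta <= K by case/andP: I2 => _ /le_trans; apply.
  have pb1 : 0 < ys - 2 * eta by case/andP: I1 => + _; apply: lt_le_trans.
  have f1 : f (ys - 2 * eta) <= E1 ep y := root_below K1 (ltW s0) s1' s2' h1 pb1 qb1 a1 a3 yy.
  have f2 : E1 ep y <= f (ys + 2 * eta) := root_above K1 (ltW s0) s1' s2' h1 pb1 qb1 a2 a3 yy.
  have lab : ys - 2 * eta <= ys + 2 * eta by apply: itv_le; rewrite mulr_gt0.
  have [|c] := IVT (v := E1 ep y) lab cf.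
    by have f12 := le_trans f1 f2; rewrite (min_idPl f12) (max_idPr f12) f1.
  rewrite in_itv /= => cc Ec; exists c => _; split; last by rewrite -Ec.
  exact: ball_itv.
have [psi psiE] := choice psiP.
pose D y := disp' ep y (psi y).
have Ipsi y : `|y - ys| <= eta -> I (psi y).
  by move=> yy; have [H _] := psiE y yy; exact: Inear (le_trans H l2).
have D1 y u : `|y - ys| <= eta -> `|u - ys| <= eta ->
    `|D y - D u - ep * m * (y - u)| <= `|ep| * `|m| / 2 * `|y - u|.
  move=> yy uu; have [_ Ey] := psiE y yy; have [_ Eu] := psiE u uu.
  by have [H _] := dPe _ _ _ _ (le_trans yy l3) (le_trans uu l3) (Ipsi y yy) (Ipsi u uu) Ey Eu.
have nb y := @ball_itv _ ys eta y.
have cD : {within `[ys - eta, ys + eta], continuous D}.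
  apply: (@lip_within _ D _ _ (`|ep| * `|m| / 2 + `|ep| * `|m|)) => x z xx zz.
  rewrite -[D x - D z](subrK (ep * m * (x - z))) mulrDl.
  apply: normD_le; last by rewrite !normrM.
  exact: D1 (nb x xx) (nb z zz).
have nys : `|ys - ys| <= eta by rewrite subrr normr0 ltW.
have D0 : `|D ys| <= 40 * K ^+ 5 * `|ep| ^+ 2.
  have [_ E] := psiE ys nys.
  apply: base_near => //; last exact: Ipsi.
  apply: Inear; rewrite distrC.
  have [+ _] := scale_bound p0 qK K1 bK s1' h2 Iys.
  by move/le_trans; apply; exact: scale_arith eta_gt0 etale0 s2'.
(* 2 / 5 < 1 / 2: the value at ys is beaten by half of the variation ep * m * eta *)
have D0' : `|D ys| <= 2 / 5 * (`|ep| * `|m| * eta).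
  apply: le_trans D0 _.
  have -> : 40 * K ^+ 5 * `|ep| ^+ 2 = 2 / 5 * (`|ep| * (100 * K ^+ 5 * `|ep|)) by field.
  rewrite -[`|ep| * `|m| * eta]mulrA; apply: ler_wpM2l; first by rewrite divr_ge0.
  exact: ler_wpM2l.
have etaR : `|ys + eta - ys| <= eta by rewrite addrAC subrr add0r gtr0_norm.
have etaL : `|ys - eta - ys| <= eta by rewrite addrAC subrr add0r normrN gtr0_norm.
have signs : Num.min (D (ys - eta)) (D (ys + eta)) <= 0 <=
             Num.max (D (ys - eta)) (D (ys + eta)).
  apply: (@sign_change _ (D ys) _ _ (ep * m) eta); rewrite ?normrM//.
  - by rewrite !mulr_gt0.
  - have := D1 _ _ etaR nys.
    by rewrite (addrAC ys eta) subrr add0r (gtr0_norm eta_gt0).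
  - have := D1 _ _ etaL nys.
    by rewrite (addrAC ys (- eta)) subrr add0r normrN (gtr0_norm eta_gt0) mulrN opprK.
have [y] := IVT (itv_le ys eta_gt0) cD signs.
rewrite in_itv /= => yy Dy; have ny := nb y yy.
have [H1 H2] := psiE y ny.
exists y, (psi y); split; [exact: le_trans ny l4|exact: le_trans H1 etale1|split => //].
by apply/disp0.
Unshelve. all: by end_near. Qed.

End core.

(** * Circular and hyperbolic functions, treated together *)

Section trig.
Context {R : realType}.
Implicit Types (i : family) (x y t k : R).

Definition ch x : R := (expR x + expR (- x)) / 2.
Definition sh x : R := (expR x - expR (- x)) / 2.

Lemma der_ch x : is_derive x 1 ch (sh x).
Proof. by rewrite /ch; deriv; rewrite /sh; field. Qed.
Lemma der_sh x : is_derive x 1 sh (ch x).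
Proof. by rewrite /sh; deriv; rewrite /ch; field. Qed.
Lemma ch2 x : ch x ^+ 2 - sh x ^+ 2 = 1.
Proof.
have e0 := lt0r_neq0 (expR_gt0 x).
by rewrite /ch /sh expRN; field.
Qed.
Lemma ch0 : ch 0 = 1. Proof. by rewrite /ch oppr0 expR0; field. Qed.
Lemma sh0 : sh 0 = 0. Proof. by rewrite /sh oppr0 subrr mul0r. Qed.
Lemma ch_ge1 x : 1 <= ch x.
Proof.
have e0 := expR_gt0 x; have : 0 <= (expR x - 1) ^+ 2 / expR x.
  by rewrite divr_ge0 ?sqr_ge0 ?ltW.
have -> : (expR x - 1) ^+ 2 / expR x = 2 * (ch x - 1).
  by rewrite /ch expRN; field; exact: lt0r_neq0.
lra.
Qed.
Lemma sh_gt0 x : 0 < x -> 0 < sh x.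
Proof. by move=> x0; rewrite /sh divr_gt0// subr_gt0 ltr_expR; lra. Qed.

Definition sgf i : R := if i is family_a then 1 else -1.
Definition Cf i : R -> R := if i is family_a then cos else ch.
Definition Sf i : R -> R := if i is family_a then sin else sh.
(** Angles of the arcs: before the first zero of [Sf] in the circular case. *)
Definition domt i t := (0 < t) && (if i is family_a then t < pi else true).
(** The range of the half-angle coordinate tan (t / 2), resp. tanh (t / 2), of
    which [thf] is the inverse. In this coordinate both families have rational
    formulas. *)
Definition domy i y := (0 < y) && (if i is family_a then true else y < 1).
Definition thf i y : R :=
  if i is family_a then 2 * atan y else ln ((1 + y) / (1 - y)).

Lemma sgsg i : sgf i * sgf i = 1.
Proof. by case: i => /=; ring. Qed.
Lemma Cf0 i : Cf i 0 = 1. Proof. by case: i => /=; rewrite ?cos0 ?ch0. Qed.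
Lemma Sf0 i : Sf i 0 = 0. Proof. by case: i => /=; rewrite ?sin0 ?sh0. Qed.
Lemma der_Cf i x : is_derive x 1 (Cf i) (- sgf i * Sf i x).
Proof.
case: i => /=; first by apply: (der_eq (is_derive_cos x)); ring.
by apply: (der_eq (der_ch x)); ring.
Qed.
Lemma der_Sf i x : is_derive x 1 (Sf i) (Cf i x).
Proof. by case: i => /=; [exact: is_derive_sin|exact: der_sh]. Qed.
Lemma CfSf i x : Cf i x ^+ 2 + sgf i * Sf i x ^+ 2 = 1.
Proof. by case: i => /=; rewrite ?mul1r ?cos2Dsin2// mulN1r ch2. Qed.
Lemma Sf_gt0 i t : domt i t -> 0 < Sf i t.
Proof.
by case: i => /= /andP[t0 t1]; [apply: sin_gt0_pi; rewrite t0|exact: sh_gt0].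
Qed.
Lemma domt_le i t u : domt i t -> 0 < u <= t -> domt i u.
Proof.
case: i => /= /andP[t0 t1] /andP[u0 ut]; rewrite /domt u0//=.
exact: le_lt_trans ut t1.
Qed.
Lemma domt_gt0 i t : domt i t -> 0 < t. Proof. by case/andP. Qed.
(** An arc of angle pi or more has passed a point where it is below its starting
    height; this happens in the circular case only. *)
Lemma not_domt i t : 0 < t -> ~~ domt i t ->
  sgf i = 1 /\ exists2 u, 0 < u <= t & Sf i u = 0 /\ Cf i u < 0.
Proof.
case: i => t0; rewrite /domt t0//= -leNgt => pit; split => //.
by exists pi; rewrite ?pi_gt0// sinpi cospi ltrN10.
Qed.

Lemma domy_q i y : domy i y -> 0 < 1 + sgf i * y ^+ 2.
Proof.
case: i => /= /andP[y0 y1]; first by rewrite mul1r; have := sqr_ge0 y; lra.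
by rewrite expr2; nra.
Qed.
Lemma domy_gt0 i y : domy i y -> 0 < y. Proof. by case/andP. Qed.
Lemma domy_itv i p q y : domy i p -> domy i q -> p <= y <= q -> domy i y.
Proof.
case: i => /= /andP[p0 p1] /andP[q0 q1] /andP[py yq]; rewrite /domy.
  by rewrite (lt_le_trans p0 py).
by rewrite (lt_le_trans p0 py) (le_lt_trans yq q1).
Qed.

Lemma der_thf i y : domy i y -> is_derive y 1 (thf i) (2 / (1 + sgf i * y ^+ 2)).
Proof.
case: i => /= /andP[y0 y1].
  have H := is_derive1_atan y.
  have -> : thf family_a = (fun t => 2 * atan t) by [].
  by deriv; rewrite mul1r; ring.
have u0 : 0 < 1 - y by lra.
have v0 : 0 < (1 + y) / (1 - y) by rewrite divr_gt0//; lra.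
have H := is_derive1_ln v0.
have -> : thf family_b = (fun t => ln ((1 + t) / (1 - t))) by [].
deriv; first by rewrite lt0r_neq0.
have q0 : 0 < 1 - y ^+ 2 by rewrite expr2; nra.
by field; repeat (apply/andP; split); apply: lt0r_neq0; lra.
Qed.

Lemma thfP i y : domy i y -> [/\ domt i (thf i y),
  Sf i (thf i y) = 2 * y / (1 + sgf i * y ^+ 2) &
  Cf i (thf i y) = (1 - sgf i * y ^+ 2) / (1 + sgf i * y ^+ 2)].
Proof.
case: i => /= /andP[y0 y1].
  have a0 : 0 < atan y by rewrite -(@atan0 R) lt_atan.
  have a1 := atan_ltpi2 y.
  have c0 : 0 < cos (atan y).
    by apply: cos_gt0_pihalf; rewrite a1 atan_gtNpi2.
  have sE : sin (atan y) = y * cos (atan y).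
    by have := atanK y; rewrite /tan => {2}<-; rewrite divfK// lt0r_neq0.
  have cE : cos (atan y) ^+ 2 = (1 + y ^+ 2)^-1.
    have := cos2Dsin2 (atan y); rewrite sE exprMn => E.
    have q0 : 1 + y ^+ 2 != 0 by rewrite lt0r_neq0//; have := sqr_ge0 y; lra.
    by apply: (mulIf q0); rewrite mulVf// -[RHS]E; ring.
  split.
  - by rewrite /domt mulr_gt0//=; lra.
  - by rewrite mulrC mulr_natr sin_mulr2n sE mul1r -cE; ring.
  - rewrite mulrC mulr_natr cos_mulr2n mul1r cE; field.
    by rewrite lt0r_neq0//; have := sqr_ge0 y; lra.
have u0 : 0 < 1 - y by lra.
have u1 : 0 < 1 + y by lra.
have v0 : 0 < (1 + y) / (1 - y) by rewrite divr_gt0.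
have q0 : 0 < 1 - y ^+ 2 by rewrite expr2; nra.
have e : expR (ln ((1 + y) / (1 - y))) = (1 + y) / (1 - y) by rewrite lnK.
split.
- by rewrite /domt andbT ln_gt0// ltr_pdivlMr//; lra.
- by rewrite /sh expRN e; field; repeat (apply/andP; split); apply: lt0r_neq0; lra.
- by rewrite /ch expRN e; field; repeat (apply/andP; split); apply: lt0r_neq0; lra.
Qed.

Lemma domt_thf i t : domt i t -> exists2 y, domy i y & thf i y = t.
Proof.
case: i => /= /andP[t0 t1].
  exists (tan (t / 2)); last first.
    by rewrite tanK; [field|rewrite in_itv /=; lra].
  have p0 := @pi_gt0 R.
  rewrite /domy andbT /tan divr_gt0//.
    by apply: sin_gt0_pihalf; lra.
  by apply: cos_gt0_pihalf; lra.
have e1 : 1 < expR t by rewrite expR_gt1.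
exists ((expR t - 1) / (expR t + 1)).
  rewrite /domy divr_gt0 ?ltr_pdivrMr//=; lra.
suff -> : (1 + (expR t - 1) / (expR t + 1)) / (1 - (expR t - 1) / (expR t + 1)) = expR t.
  by rewrite expRK.
by field; repeat (apply/andP; split); apply: lt0r_neq0; lra.
Qed.

End trig.

(** * The half-turn curves and their limits *)

Section curves.
Context {R : realType}.
Implicit Types (i : family) (x y t k : R).

Lemma bounded_itv (f : R -> R) (p q : R) : p <= q ->
  (forall y, p <= y <= q -> {for y, continuous f}) ->
  exists2 N, 1 <= N & forall y, p <= y <= q -> `|f y| <= N.
Proof.
move=> pq cf.
have cg : {within `[p, q], continuous (fun y => `|f y|)}.
  apply: within_cont_in => y yy; apply: continuous_comp; first exact: cf.
  exact: norm_continuous.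
have [c _ cmax] := EVT_max pq cg.
exists (Num.max 1 `|f c|); first by rewrite le_max lexx.
move=> y yy; rewrite le_max; apply/orP; right; apply: cmax.
by rewrite in_itv.
Qed.

Lemma C1close_der (p q c : R) (F G df : R -> R) :
  (forall y, p <= y <= q -> is_derive y 1 (fun y => F y - G y) (df y)) ->
  (forall y, p <= y <= q -> `|F y - G y| <= c /\ `|df y| <= c) ->
  C1close p q F G c.
Proof.
move=> dF bF y u yy uu; split; first by have [] := bF y yy.
apply: (mvt_abs dF) => // z zz; by have [] := bF z zz.
Qed.

Lemma C1close_le (p q c c' : R) (F G : R -> R) : c <= c' ->
  C1close p q F G c -> C1close p q F G c'.
Proof.
move=> cc H y u yy uu; have [h1 h2] := H y u yy uu; split.
  exact: le_trans h1 cc.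
by apply: le_trans h2 _; rewrite ler_wpM2r.
Qed.

Lemma ch_le2 x : `|x| <= 1 / 2 -> ch x <= 2.
Proof.
rewrite ler_norml => /andP[x1 x2].
have e2 (z : R) : z <= 1 / 2 -> expR z <= 2.
  move=> z2; have := expR_ge1Dx (- z); rewrite expRN => H.
  have e0 := expR_gt0 z.
  have : 1 / 2 <= (expR z)^-1 by lra.
  by rewrite -(ler_pM2r e0) mulVf ?lt0r_neq0//; lra.
by have := e2 x x2; have := e2 (- x) _; rewrite /ch; lra.
Qed.

Lemma hyper_small x : `|x| <= 1 / 2 ->
  [/\ `|sh x| <= 2 * `|x|, `|ch x - 1| <= 2 * x ^+ 2 & `|sh x - x| <= 2 * x ^+ 2 * `|x|].
Proof.
move=> x2; have x0 : - `|x| <= 0 <= `|x| by rewrite oppr_le0 !normr_ge0.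
have xx : - `|x| <= x <= `|x| by rewrite -ler_norml.
have zb (z : R) : - `|x| <= z <= `|x| -> `|z| <= `|x| by rewrite -ler_norml.
have shb (z : R) : - `|x| <= z <= `|x| -> `|sh z| <= 2 * `|x|.
  move=> zz; have := @mvt_abs _ sh ch (- `|x|) `|x| 2 z 0.
  rewrite sh0 !subr0 => H; apply: le_trans (H _ _ zz x0) _.
  - by move=> u _; exact: der_sh.
  - move=> u uu; rewrite ger0_norm; last by have := ch_ge1 u; lra.
    by apply: ch_le2; apply: le_trans x2; exact: zb.
  - by rewrite ler_wpM2l//; exact: zb.
have chb (z : R) : - `|x| <= z <= `|x| -> `|ch z - 1| <= 2 * x ^+ 2.
  move=> zz; have := @mvt_abs _ ch sh (- `|x|) `|x| (2 * `|x|) z 0.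
  rewrite ch0 subr0 => H; apply: le_trans (H _ _ zz x0) _.
  - by move=> u _; exact: der_ch.
  - exact: shb.
  - by rewrite -mulrA -real_normK ?num_real// expr2 !ler_wpM2l//; exact: zb.
split; [exact: shb|exact: chb|].
have := @mvt_abs _ (fun u => sh u - u) (fun u => ch u - 1) (- `|x|) `|x| (2 * x ^+ 2) x 0.
rewrite sh0 !subr0; apply => //.
by move=> u _; have H := der_sh u; deriv; ring.
Qed.

(** [Wf] is 1 / Sf in the half-angle coordinate. [Ec] and [sgf i * k * Bc] are the
    half-sum and half-difference of the ends of an arc with rates k and -k (see
    [AfE] below), [B0] is the limit of [Bc] at k = 0. *)
Definition Wf i y := (1 + sgf i * y ^+ 2) / (2 * y).
Definition dWf i y := (sgf i - (y ^+ 2)^-1) / 2.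
Definition dth i y : R := 2 / (1 + sgf i * y ^+ 2).
Definition Ec i k y := y + sgf i * (ch (k * thf i y) - 1) * Wf i y.
Definition Bc i k y := sh (k * thf i y) / k * Wf i y.
Definition B0 i y := thf i y * Wf i y.
Definition dB0 i y := sgf i * thf i y / 2 + y^-1 - thf i y / (2 * y ^+ 2).
Definition ddB0 i y := (thf i y / y - 2 / (1 + sgf i * y ^+ 2)) / y ^+ 2.

Lemma der_W i y : domy i y -> is_derive y 1 (Wf i) (dWf i y).
Proof.
move=> dy; have y0 := lt0r_neq0 (domy_gt0 dy).
rewrite /Wf; deriv; first by rewrite mulf_neq0.
by rewrite /dWf; field.
Qed.

Lemma der_B0 i y : domy i y -> is_derive y 1 (B0 i) (dB0 i y).
Proof.
move=> dy; have y0 := lt0r_neq0 (domy_gt0 dy).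
have H1 := der_W dy; have H2 := der_thf dy; have q0 := lt0r_neq0 (domy_q dy).
rewrite /B0; deriv.
by rewrite /dB0 /dWf /Wf; field; rewrite y0.
Qed.

Lemma der_dB0 i y : domy i y -> is_derive y 1 (dB0 i) (ddB0 i y).
Proof.
move=> dy; have y0 := lt0r_neq0 (domy_gt0 dy).
have H2 := der_thf dy; have q0 := lt0r_neq0 (domy_q dy).
rewrite /dB0; deriv => //; first by rewrite mulf_neq0// expf_neq0.
by rewrite /ddB0; field; rewrite y0.
Qed.

Lemma cont_ddB0 i y : domy i y -> {for y, continuous (ddB0 i)}.
Proof.
move=> dy; have y0 := lt0r_neq0 (domy_gt0 dy).
have H2 := der_thf dy; have q0 := lt0r_neq0 (domy_q dy).
have [d dP] : exists d, is_derive y 1 (ddB0 i) d.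
  by eexists; rewrite /ddB0; der => //; rewrite expf_neq0.
exact: der_cont dP.
Qed.

Lemma cont_dth i y : domy i y -> {for y, continuous (dth i)}.
Proof.
move=> dy; have q0 := lt0r_neq0 (domy_q dy).
have [d dP] : exists d, is_derive y 1 (dth i) d.
  by eexists; rewrite /dth; der.
exact: der_cont dP.
Qed.
Lemma cont_dW i y : domy i y -> {for y, continuous (dWf i)}.
Proof.
move=> dy; have y0 := lt0r_neq0 (domy_gt0 dy).
have [d dP] : exists d, is_derive y 1 (dWf i) d.
  by eexists; rewrite /dWf; der; rewrite expf_neq0.
exact: der_cont dP.
Qed.

(** [Ec] and [Bc] are even in k, so that they differ from their limits by O(k^2). *)
Lemma curves_close i p q : domy i p -> domy i q -> p <= q ->
  exists2 K, 1 <= K & forall k, k != 0 -> K * `|k| <= 1 / 2 ->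
   C1close p q (Ec i k) id (K * `|k| ^+ 2) /\ C1close p q (Bc i k) (B0 i) (K * `|k| ^+ 2).
Proof.
move=> dp dq pq; have dI y : p <= y <= q -> domy i y := domy_itv dp dq.
have [N1 N11 b1] := bounded_itv pq (fun y yy => der_cont (der_thf (dI y yy))).
have [N2 N21 b2] := bounded_itv pq (fun y yy => cont_dth (dI y yy)).
have [N3 N31 b3] := bounded_itv pq (fun y yy => der_cont (der_W (dI y yy))).
have [N4 N41 b4] := bounded_itv pq (fun y yy => cont_dW (dI y yy)).
pose N := Num.max (Num.max N1 N2) (Num.max N3 N4).
have NE : [/\ N1 <= N, N2 <= N, N3 <= N & N4 <= N].
  by rewrite /N !le_max !lexx !orbT.
have [n1 n2 n3 n4] := NE.
have Np1 : 1 <= N by apply: le_trans n1.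
have sgn : `|sgf i : R| <= 1 by rewrite /sgf; case: (i); rewrite ?normrN normr1.
have Np : 0 <= N by lra.
have N4p n : (n <= 4)%N -> N ^+ n <= N ^+ 4 by move=> n4'; exact: ler_weXn2l.
exists (4 * N ^+ 4).
  have : 1 <= N ^+ 4 by rewrite exprn_ege1.
  lra.
move=> k k0 kN.
have kk : 0 <= k ^+ 2 := sqr_ge0 k.
have small y : p <= y <= q -> [/\ `|thf i y| <= N, `|dth i y| <= N, `|Wf i y| <= N,
    `|dWf i y| <= N & `|k * thf i y| <= 1 / 2].
  move=> yy; have t1 := le_trans (b1 y yy) n1; split => //.
  - exact: le_trans (b2 y yy) n2.
  - exact: le_trans (b3 y yy) n3.
  - exact: le_trans (b4 y yy) n4.
  - rewrite normrM mulrC; apply: le_trans kN; rewrite ler_wpM2r//.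
    apply: le_trans t1 _; have := N4p 1%N isT; rewrite expr1; lra.
have hyp y : p <= y <= q -> [/\ `|sh (k * thf i y)| <= 2 * (`|k| * N),
    `|ch (k * thf i y) - 1| <= 2 * (k ^+ 2 * N ^+ 2) &
    `|sh (k * thf i y) / k - thf i y| <= 2 * (k ^+ 2 * N ^+ 3)].
  move=> yy; have [t1 _ _ _ s1] := small y yy.
  have [h1 h2 h3] := hyper_small s1.
  have kt : `|k * thf i y| <= `|k| * N by rewrite normrM ler_wpM2l.
  have kt2 : (k * thf i y) ^+ 2 <= k ^+ 2 * N ^+ 2.
    rewrite exprMn ler_wpM2l// -(real_normK (num_real (thf i y))).
    by rewrite ler_pXn2r ?nnegrE.
  split; [by apply: le_trans h1 _; rewrite ler_wpM2l|by apply: le_trans h2 _; rewrite ler_wpM2l|].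
  have -> : sh (k * thf i y) / k - thf i y = (sh (k * thf i y) - k * thf i y) / k by field.
  rewrite normrM normfV ler_pdivrMr ?normr_gt0//; apply: le_trans h3 _.
  have -> : 2 * (k ^+ 2 * N ^+ 3) * `|k| = 2 * (k ^+ 2 * N ^+ 2) * (`|k| * N) by ring.
  apply: ler_pM => //; first by rewrite mulr_ge0// sqr_ge0.
  by rewrite ler_wpM2l.
have K3 : N ^+ 3 * k ^+ 2 <= N ^+ 4 * k ^+ 2 by rewrite ler_wpM2r// N4p.
have K40 : 0 <= N ^+ 4 * k ^+ 2 by rewrite mulr_ge0// exprn_ge0.
rewrite real_normK ?num_real//; split.
  apply: (@C1close_der _ _ _ _ _ (fun y => sgf i * (sh (k * thf i y) * (k * dth i y) * Wf i y
       + (ch (k * thf i y) - 1) * dWf i y))) => y yy.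
    have dy := dI y yy; have H1 := der_thf dy; have H2 := der_W dy.
    have H3 := der_ch (k * thf i y).
    by rewrite /Ec; deriv; rewrite /dth /=; ring.
  have [t1 t2 t3 t4 t5] := small y yy; have [h1 h2 h3] := hyp y yy; split.
    have -> : Ec i k y - id y = sgf i * (ch (k * thf i y) - 1) * Wf i y by rewrite /Ec /=; ring.
    by apply: le_trans (normM_le (normM_le sgn h2) t3) _; clear -K3 K40; lra.
  apply: le_trans (normM_le sgn (normD_le (normM_le (normM_le h1 (normM_le (lexx _) t2)) t3)
    (normM_le h2 t4))) _.
  have -> : 2 * (`|k| * N) * (`|k| * N) * N = 2 * (N ^+ 3 * `|k| ^+ 2) by ring.
  by rewrite real_normK ?num_real//; clear -K3 K40; lra.
apply: (@C1close_der _ _ _ _ _ (fun y => (ch (k * thf i y) - 1) * dth i y * Wf i y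
       + (sh (k * thf i y) / k - thf i y) * dWf i y)) => y yy.
  have dy := dI y yy; have H1 := der_thf dy; have H2 := der_W dy.
  have H3 := der_sh (k * thf i y).
  by rewrite /Bc /B0; deriv; rewrite /dth /=; field; rewrite k0 lt0r_neq0// domy_q.
have [t1 t2 t3 t4 t5] := small y yy; have [h1 h2 h3] := hyp y yy; split.
  have -> : Bc i k y - B0 i y = (sh (k * thf i y) / k - thf i y) * Wf i y by rewrite /Bc /B0; ring.
  by apply: le_trans (normM_le h3 t3) _; clear -K3 K40; lra.
apply: le_trans (normD_le (normM_le (normM_le h2 t2) t3) (normM_le h3 t4)) _.
clear -K3 K40; lra.
Qed.

End curves.

(** * The closing equations *)

Section parameters.
Context {R : realType}.
Implicit Types (i : family) (x y t k e : R).

(** For the flow P' = k P - sg Q, Q' = P + k Q, the arc of angle t which starts and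
    ends at Q = sg * h starts at P = h * A(t, -k) and ends at P = - h * A(t, k)
    (see [arc_return]). *)
Definition Af i t k : R := sgf i * (expR (k * t) - Cf i t) / Sf i t.

Lemma sgf_pm i : sgf i = 1 :> R \/ sgf i = -1 :> R.
Proof. by case: i; [left|right]. Qed.

Lemma near0_params (w K0 : R) : 0 < K0 ->
  \forall e \near (0 : R)^', [/\ e != 0, `|w| * `|e| <= 1 / 2, 4 * `|e| <= 1 &
    K0 * (2 * `|e|) <= 1 / 2].
Proof.
move=> K00; have w0 : 0 <= `|w| by []; near=> e.
have [e0 e1] : 0 < `|e| /\ (1 + `|w|) * `|e| <= 1 / 2.
  by near: e; apply: near0_mul; lra.
have [_ e2] : 0 < `|e| /\ 4 * `|e| <= 1 by near: e; apply: near0_mul; lra.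
have [_ e3] : 0 < `|e| /\ (2 * K0) * `|e| <= 1 / 2 by near: e; apply: near0_mul; lra.
by split; [rewrite -normr_gt0|clear -e1 w0 e0; lra|exact: e2|clear -e3; lra].
Unshelve. all: by end_near. Qed.

Lemma close_arith (K0 K e k : R) : 1 <= K0 -> 4 * K0 <= K -> `|k| <= 2 * `|e| ->
  K0 * (2 * `|e|) <= 1 / 2 ->
  [/\ K0 * `|e| ^+ 2 <= K * `|e| ^+ 2, K0 * `|k| ^+ 2 <= K * `|e| ^+ 2,
     K0 * `|e| <= 1 / 2 & K0 * `|k| <= 1 / 2].
Proof.
move=> K01 K0K ke eK; have en : 0 <= `|e| := normr_ge0 e.
have kn : 0 <= `|k| := normr_ge0 k.
have ee : 0 <= `|e| ^+ 2 := sqr_ge0 _.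
have l2 : 4 * K0 * `|e| ^+ 2 <= K * `|e| ^+ 2 by rewrite ler_wpM2r.
have l3 : `|k| ^+ 2 <= 4 * `|e| ^+ 2 by rewrite !expr2; nra.
have l4 : K0 * `|k| <= K0 * (2 * `|e|) by rewrite ler_wpM2l//; lra.
have l5 : 0 <= K0 * `|e| by rewrite mulr_ge0//; lra.
have l6 : 0 <= K0 * `|e| ^+ 2 by rewrite mulr_ge0//; lra.
have l7 : K0 * `|k| ^+ 2 <= K0 * (4 * `|e| ^+ 2) by rewrite ler_wpM2l//; lra.
by split; lra.
Qed.

Section fixed_parameters.
Variables (i : family) (w D : R).
(** Angular speed, shift, height and rate of the normal form of the lower field (see
    [perturbed_normal_form]); those of the upper field are 1, 0, 1 and e. *)
Definition omf e := 1 + w * e.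
Definition dlf e := e ^+ 2 * D * omf e / (omf e ^+ 2 + sgf i * e ^+ 2).
Definition hf e := 1 + e - e * dlf e / omf e.
Definition kf e := e / omf e.
(** The arc above, of angle tau, ends where the arc below, of angle sigma, starts,
    and conversely. At e = 0 both equations read tau = sigma: this is the period
    annulus. *)
Definition closing e tau sigma :=
  Af i tau (- e) = hf e * Af i sigma (- kf e) + dlf e /\
  Af i tau e = hf e * Af i sigma (kf e) - dlf e.

Lemma AfE k y : k != 0 -> domy i y ->
  Af i (thf i y) k = Ec i k y + sgf i * k * Bc i k y /\
  Af i (thf i y) (- k) = Ec i k y - sgf i * k * Bc i k y.
Proof.
move=> k0 dy; have [_ SE CE] := thfP dy; have q0 := lt0r_neq0 (domy_q dy).
have y0 := lt0r_neq0 (domy_gt0 dy).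
rewrite /Af /Ec /Bc /Wf SE CE /ch /sh mulNr.
by move: q0; have [->|->] := sgf_pm i; rewrite ?mul1r ?mulN1r => q0;
  split; field; rewrite ?k0 ?q0 ?y0.
Qed.

(** Half the sum of the closing equations, and half their difference divided by
    sg * e. The division by e is what makes the limit system nondegenerate. *)
Lemma closing_balanced e y y' : e != 0 -> omf e != 0 -> domy i y -> domy i y' ->
  closing e (thf i y) (thf i y') <->
  balanced (Ec i) (fun e => Ec i (kf e)) (Bc i) (fun e => Bc i (kf e)) hf
    (fun e => (omf e)^-1) (fun e => sgf i * dlf e / e) e y y'.
Proof.
move=> e0 om0 dy dy'; have k0 : kf e != 0 by rewrite mulf_neq0// invr_neq0.
have [a1 a2] := AfE e0 dy; have [a3 a4] := AfE k0 dy'.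
rewrite /closing /balanced a1 a2 a3 a4.
have se0 : sgf i * e != 0 by rewrite mulf_neq0//; case: (i); rewrite /= ?oppr_eq0 oner_eq0.
split=> [[E1 E2]|[E1 E2]].
  split; first by apply: (mulfI (_ : 2 != 0 :> R)) => //; lra.
  apply: (mulfI se0); apply: (mulfI (_ : 2 != 0 :> R)) => //.
  transitivity (2 * (sgf i * kf e * hf e * Bc i (kf e) y') - 2 * dlf e); first lra.
  by rewrite /kf; have [->|->] := sgf_pm i; field; rewrite e0 om0.
rewrite E1 E2; split.
  by rewrite /kf; have [->|->] := sgf_pm i; field; rewrite e0 om0.
by rewrite /kf; have [->|->] := sgf_pm i; field; rewrite e0 om0.
Qed.

Lemma sgf_norm : `|sgf i : R| = 1.
Proof. by rewrite /sgf; case: (i); rewrite ?normrN normr1. Qed.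

Lemma om_bound e : `|w| * `|e| <= 1 / 2 -> 1 / 2 <= omf e <= 3 / 2.
Proof. by rewrite -normrM ler_norml /omf => /andP[? ?]; lra. Qed.

Lemma den_bound e : `|w| * `|e| <= 1 / 2 -> 4 * `|e| <= 1 ->
  1 / 8 <= omf e ^+ 2 + sgf i * e ^+ 2.
Proof.
move=> /om_bound /andP[om1 om2] e4.
have e2 : e ^+ 2 <= 1 / 16.
  rewrite -(real_normK (num_real e)) expr2; have := normr_ge0 e; nra.
have e0 := sqr_ge0 e.
have o4 : 1 / 4 <= omf e ^+ 2 by rewrite expr2; nra.
by rewrite /sgf; case: (i); lra.
Qed.

Lemma kf_bound e : `|w| * `|e| <= 1 / 2 -> `|kf e| <= 2 * `|e|.
Proof.
move=> /om_bound /andP[om1 om2]; have o0 : 0 < omf e by lra.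
rewrite /kf normrM normfV (gtr0_norm o0) ler_pdivrMr//.
have := normr_ge0 e; nra.
Qed.

Lemma expansion_bound : exists2 K, 1 <= K & forall e, e != 0 -> `|w| * `|e| <= 1 / 2 ->
  4 * `|e| <= 1 ->
  [/\ `|hf e - 1 - 1 * e| <= K * `|e| ^+ 2, `|(omf e)^-1 - 1 + w * e| <= K * `|e| ^+ 2 &
     `|sgf i * dlf e / e - sgf i * D * e| <= K * `|e| ^+ 2].
Proof.
exists (1 + 2 * w ^+ 2 + 8 * `|D| * (2 * `|w| + 1)).
  have := sqr_ge0 w; have : 0 <= `|D| * (2 * `|w| + 1).
    by rewrite mulr_ge0// addr_ge0// mulr_ge0.
  lra.
move=> e e0 we e4.
have /andP[om1 om2] := om_bound we; have dn := den_bound we e4.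
have o0 : 0 < omf e by lra.
set de := omf e ^+ 2 + sgf i * e ^+ 2 in dn *.
have d0 : 0 < de by lra.
have dV : `|de^-1| <= 8.
  rewrite gtr0_norm ?invr_gt0// -(ler_pM2l d0) mulfV ?lt0r_neq0//; lra.
have e2 : 0 <= `|e| ^+ 2 := sqr_ge0 _.
have D0 : 0 <= `|D| * `|w| by rewrite mulr_ge0.
have D1 : 0 <= `|D| by [].
have De : 0 <= `|D| * `|w| * `|e| ^+ 2 by rewrite mulr_ge0.
have De1 : 0 <= `|D| * `|e| ^+ 2 by rewrite mulr_ge0.
have we2 : 0 <= w ^+ 2 * `|e| ^+ 2 by rewrite mulr_ge0 ?sqr_ge0.
split.
- have -> : hf e - 1 - 1 * e = - (e ^+ 2 * e * D * de^-1).
    by rewrite /hf /dlf -/de; field; rewrite !lt0r_neq0.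
  rewrite normrN; apply: le_trans (normM_le (normM_le (normM_le (lexx _) (lexx _)) (lexx _)) dV) _.
  rewrite normrX -/de.
  have : `|e| ^+ 2 * `|D| * `|e| <= `|e| ^+ 2 * `|D| * 1.
    by rewrite ler_wpM2l ?mulr_ge0//; lra.
  lra.
- have -> : (omf e)^-1 - 1 + w * e = w ^+ 2 * e ^+ 2 / omf e.
    have := lt0r_neq0 o0; rewrite /omf => oo; by field.
  rewrite normrM normfV (gtr0_norm o0) ler_pdivrMr// normrM !normrX real_normK ?num_real//.
  have : 0 <= (1 + 8 * `|D| * (2 * `|w| + 1)) * `|e| ^+ 2 * omf e.
    rewrite mulr_ge0 ?(ltW o0)// mulr_ge0// addr_ge0// !mulr_ge0// addr_ge0// mulr_ge0//.
  have : w ^+ 2 * `|e| ^+ 2 * (1 / 2) <= w ^+ 2 * `|e| ^+ 2 * omf e by rewrite ler_wpM2l.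
  lra.
have -> : sgf i * dlf e / e - sgf i * D * e =
    sgf i * D * e * (- (w * e * omf e) - sgf i * e * e) * de^-1.
  have dn0 := lt0r_neq0 d0; rewrite /dlf -/de.
  apply: (mulIf dn0); rewrite mulfVK//.
  transitivity (sgf i * (e ^+ 2 * D * omf e) / e - sgf i * D * e * de); first by field; rewrite e0 dn0.
  by rewrite /de /omf; field.
have ob : `|omf e| <= 3 / 2 by rewrite gtr0_norm.
have t1 : `|- (w * e * omf e)| <= `|w| * `|e| * (3 / 2).
  by rewrite normrN; apply: normM_le => //; rewrite normrM.
have t2 : `|sgf i * e * e| <= 1 * `|e| * 1.
  apply: normM_le; last lra.
  by apply: normM_le => //; rewrite sgf_norm.
have t3 : `|sgf i * D * e| <= 1 * `|D| * `|e|.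
  by apply: normM_le => //; apply: normM_le => //; rewrite sgf_norm.
apply: le_trans (normM_le (normM_le t3 (normB_le t1 t2)) dV) _.
rewrite !mul1r !mulr1.
have -> : `|D| * `|e| * (`|w| * `|e| * (3 / 2) + `|e|) * 8 =
   12 * (`|D| * `|w| * `|e| ^+ 2) + 8 * (`|D| * `|e| ^+ 2) by field.
lra.
Qed.

Variable ys : R.
Hypothesis dys : domy i ys.
Hypothesis Mys : (ys * dB0 i ys - B0 i ys) + w * B0 i ys + sgf i * D = 0.
Hypothesis mys : ys * ddB0 i ys + w * dB0 i ys != 0.

Theorem closing_near : exists eta0, [/\ 0 < eta0, domy i (ys - eta0), domy i (ys + eta0),
  \forall e \near (0 : R)^', forall y y' u u', `|y - ys| <= eta0 -> `|u - ys| <= eta0 ->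
    `|y' - ys| <= eta0 -> `|u' - ys| <= eta0 ->
    closing e (thf i y) (thf i y') -> closing e (thf i u) (thf i u') -> y = u /\ y' = u'
  & forall eta, 0 < eta -> \forall e \near (0 : R)^', exists y y',
     [/\ `|y - ys| <= eta, `|y' - ys| <= eta & closing e (thf i y) (thf i y')]].
Proof.
have ys0 := domy_gt0 dys.
pose p := ys / 2.
have [q yq dq] : exists2 q, ys < q & domy i q.
  move: dys; rewrite /domy; case: (i) => /andP[? ?].
    by exists (ys + 1); rewrite ?andbT; lra.
  by exists ((1 + ys) / 2); [lra|apply/andP; split; lra].
have dp : domy i p.
  move: dys; rewrite /domy /p; case: (i) => /andP[? ?]; apply/andP; split=> //; lra.
have py : p < ys by rewrite /p; lra.
have pq : p <= q by lra.
have dI y : p <= y <= q -> domy i y := domy_itv dp dq.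
have [K0 K01 clE] := curves_close dp dq pq.
have [K1 K11 exE] := expansion_bound.
have [N1 N11 b1] := bounded_itv pq (fun y yy => der_cont (der_B0 (dI y yy))).
have [N2 N21 b2] := bounded_itv pq (fun y yy => der_cont (der_dB0 (dI y yy))).
have [N3 N31 b3] := bounded_itv pq (fun y yy => cont_ddB0 (dI y yy)).
pose K := 4 * K0 + K1 + N1 + N2 + N3 + `|w| + `|q|.
have w0 : 0 <= `|w| by []. have q0 : 0 <= `|q| by [].
have qn := ler_norm q.
have [c1 c2 c3 c4] : [/\ 4 * K0 <= K, K1 <= K, N1 <= K & N2 <= K] by clear -K01 K11 N11 N21 N31 w0 q0; rewrite /K; split; lra.
have [c5 c6 c7 c8] : [/\ N3 <= K, `|w| <= K, q <= K & 1 <= K] by clear -K01 K11 N11 N21 N31 w0 q0 qn; rewrite /K; split; lra.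
move: K c1 c2 c3 c4 c5 c6 c7 c8 => K c1 c2 c3 c4 c5 c6 c7 c8.
have small := near0_params w (lt_le_trans ltr01 K01).
have closeP : \forall e \near (0 : R)^',
  [/\ C1close p q (Ec i e) id (K * `|e| ^+ 2),
      C1close p q (Ec i (kf e)) id (K * `|e| ^+ 2),
      C1close p q (Bc i e) (B0 i) (K * `|e| ^+ 2)
    & C1close p q (Bc i (kf e)) (B0 i) (K * `|e| ^+ 2)] /\
  [/\ `|hf e - 1 - 1 * e| <= K * `|e| ^+ 2,
     `|(omf e)^-1 - 1 + w * e| <= K * `|e| ^+ 2
   & `|sgf i * dlf e / e - sgf i * D * e| <= K * `|e| ^+ 2].
  near=> e.
  have [e0 e1 e2 e3] : [/\ e != 0, `|w| * `|e| <= 1 / 2, 4 * `|e| <= 1 &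
      K0 * (2 * `|e|) <= 1 / 2] by near: e.
  have kb := kf_bound e1; have /andP[om1 om2] := om_bound e1.
  have om0 : 0 < omf e by rewrite (lt_le_trans _ om1).
  have k0 : kf e != 0 by rewrite mulf_neq0// invr_neq0// lt0r_neq0.
  have [l1 l2 s1 s2] := close_arith K01 c1 kb e3.
  have l3 : K1 * `|e| ^+ 2 <= K * `|e| ^+ 2 by rewrite ler_wpM2r// sqr_ge0.
  have [x1 x2] := clE e e0 s1; have [x3 x4] := clE (kf e) k0 s2.
  have [x5 x6 x7] := exE e e0 e1 e2.
  split; split; try exact: C1close_le l1 _; try exact: C1close_le l2 _.
  - exact: le_trans x5 l3.
  - exact: le_trans x6 l3.
  - exact: le_trans x7 l3.
have M' : 1 * (ys * dB0 i ys - B0 i ys) + w * B0 i ys + sgf i * D = 0 by rewrite mul1r.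
have m' : 1 * ys * ddB0 i ys + w * dB0 i ys != 0 by rewrite mul1r.
have n1 : `|1 : R| <= K by rewrite normr1.
have bb (N : R) (f : R -> R) : N <= K -> (forall y, p <= y <= q -> `|f y| <= N) ->
  forall y, p <= y <= q -> `|f y| <= K by move=> NK H y yy; exact: le_trans (H y yy) NK.
have p0 := domy_gt0 dp.
have [eta0 [e0 pe qe uni exi]] := balanced_near p0 c7 c8 n1 c6 py yq
  (fun y yy => der_B0 (dI y yy)) (fun y yy => der_dB0 (dI y yy)) (bb _ _ c3 b1)
  (bb _ _ c4 b2) (bb _ _ c5 b3) (cont_ddB0 dys) M' m' closeP.
have dn y : `|y - ys| <= eta0 -> domy i y by move=> yy; apply/dI/(itv_ball yy).
exists eta0; split => //.
- by apply: dn; rewrite addrAC subrr add0r normrN gtr0_norm.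
- by apply: dn; rewrite addrAC subrr add0r gtr0_norm.
- near=> e => y y' u u' h1 h2 h3 h4.
  have [z0 e1 e2 e3] : [/\ e != 0, `|w| * `|e| <= 1 / 2, 4 * `|e| <= 1 &
      K0 * (2 * `|e|) <= 1 / 2] by near: e.
  have /andP[om1 om2] := om_bound e1.
  have o0 : omf e != 0 by rewrite lt0r_neq0// (lt_le_trans _ om1).
  move=> /(closing_balanced z0 o0 (dn _ h1) (dn _ h3)) g1.
  move=> /(closing_balanced z0 o0 (dn _ h2) (dn _ h4)) g2.
  by move: y y' u u' h1 h2 h3 h4 g1 g2; near: e.
- move=> eta eta_gt0; pose eta' := Num.min eta eta0.
  have et0 : 0 < eta' by rewrite lt_min eta_gt0.
  have E := exi _ et0.
  near=> e.
  have [y [y' [h1 h2 g]]] : exists y y', [/\ `|y - ys| <= eta', `|y' - ys| <= eta' & balanced (Ec i) (fun e => Ec i (kf e)) (Bc i) (fun e => Bc i (kf e)) hf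
    (fun e => (omf e)^-1) (fun e => sgf i * dlf e / e) e y y'] by near: e.
  move: h1 h2; rewrite !le_min => /andP[h1 h1'] /andP[h2 h2'].
  exists y, y'; split => //.
  have [z0 e1 e2 e3] : [/\ e != 0, `|w| * `|e| <= 1 / 2, 4 * `|e| <= 1 &
      K0 * (2 * `|e|) <= 1 / 2] by near: e.
  have /andP[om1 om2] := om_bound e1.
  have o0 : omf e != 0 by rewrite lt0r_neq0// (lt_le_trans _ om1).
  by apply/(closing_balanced z0 o0 (dn _ h1') (dn _ h2')).
Unshelve. all: by end_near. Qed.

End fixed_parameters.

(** In terms of the angle t, M vanishes when w = 1 - Rf E t with D = sg * (E - 1);
    gf is t^2 times the derivative of Rf. *)
Definition Rf i (E t : R) := E * Sf i t / t - Cf i t.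
Definition gf i (E t : R) := E * (t * Cf i t - Sf i t) + sgf i * t ^+ 2 * Sf i t.

Lemma simple_zero i (E t w y : R) : domy i y -> t = thf i y -> w = 1 - Rf i E t ->
  gf i E t != 0 ->
  (y * dB0 i y - B0 i y) + w * B0 i y + sgf i * (sgf i * (E - 1)) = 0 /\
  y * ddB0 i y + w * dB0 i y != 0.
Proof.
move=> dy tE wE g0; have [dt SE CE] := thfP dy.
have q0 := lt0r_neq0 (domy_q dy); have y0 := lt0r_neq0 (domy_gt0 dy).
have t0 : t != 0 by rewrite tE lt0r_neq0// (domt_gt0 dt).
rewrite -tE in SE CE; rewrite mulrA sgsg mul1r.
have X : (y * dB0 i y - B0 i y) + w * B0 i y + (E - 1) = 0 /\
   (y * ddB0 i y + w * dB0 i y) * (t * y) = gf i E t.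
  rewrite wE /dB0 /ddB0 /B0 /Wf /Rf /gf -tE SE CE; move: q0.
  have [->|->] := sgf_pm i; rewrite ?mul1r ?mulN1r => q0;
    by split; field; rewrite ?q0 ?y0 ?t0.
have [-> X2] := X; split => //; apply: contra_neq g0 => m0.
by rewrite -X2 m0 mul0r.
Qed.

End parameters.

(** * Parameters with two simple zeros *)

Section choice_of_parameters.
Context {R : realType}.

Lemma cos_pi3 : cos (pi / 3) = 1 / 2 :> R.
Proof.
have p0 := @pi_gt0 R; set c := cos _.
have E : cos (pi / 3 *+ 2 + pi / 3) = -1 :> R.
  by rewrite -cospi; congr cos; rewrite mulr2n; field.
move: E; rewrite cosD cos_mulr2n sin_mulr2n -/c.
have s2 := sin2cos2 (pi / 3 : R); rewrite -/c in s2.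
have -> : (c * sin (pi / 3)) *+ 2 * sin (pi / 3) = 2 * c * (1 - c ^+ 2) by rewrite -s2; ring.
move=> E; have F : (c + 1) * (2 * c - 1) ^+ 2 = 0.
  transitivity ((c ^+ 2 *+ 2 - 1) * c - 2 * c * (1 - c ^+ 2) + 1); first by ring.
  by rewrite E; ring.
have c0 : 0 < c by apply: cos_gt0_pihalf; lra.
move/eqP: F; rewrite mulf_eq0 expf_eq0 /= => /orP[/eqP|/eqP]; lra.
Qed.

Lemma sin_pi3 : 0 < sin (pi / 3) :> R /\ sin (pi / 3) ^+ 2 = 3 / 4 :> R.
Proof.
have p0 := @pi_gt0 R; split; first by apply: sin_gt0_pi; lra.
by rewrite sin2cos2 cos_pi3; field.
Qed.

(** The mean value theorem for sin on [0, pi / 6], where sin (pi / 6) = 1 / 2. *)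
Lemma pi_ge3 : 3 <= pi :> R.
Proof.
have p0 := @pi_gt0 R.
have s6 : sin (pi / 6) ^+ 2 = 1 / 4 :> R.
  have := cos_mulr2n (pi / 6 : R); have -> : pi / 6 *+ 2 = pi / 3 :> R by rewrite mulr2n; field.
  by rewrite cos_pi3 cos2sin2 => E; lra.
have s60 : 0 < sin (pi / 6) :> R by apply: sin_gt0_pi; lra.
have s6' : 1 / 2 <= sin (pi / 6) :> R.
  rewrite leNgt; apply/negP => H.
  have : sin (pi / 6) ^+ 2 < (1 / 2) ^+ 2 :> R by rewrite ltr_pXn2r ?nnegrE//; lra.
  by rewrite s6; lra.
have pp : 0 < pi / 6 :> R by lra.
have [c _] := mvt pp (fun x _ => is_derive_sin x).
by rewrite sin0 !subr0 => E; have := cos_le1 c; nra.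
Qed.

Lemma sqr_lb (a b x : R) : 0 <= a -> b <= a * a -> a <= x -> b <= x ^+ 2.
Proof.
by move=> a0 ba ax; apply: le_trans ba _; rewrite expr2 ler_pM.
Qed.

(** Both bounds come from 1 + x <= exp x and repeated squaring; they are just
    sharp enough for the signs of [gf] in [two_zeros]. *)
Lemma ln3_bounds : 51 / 50 < ln 3 :> R /\ ln 3 < 41 / 25 :> R.
Proof.
split.
  rewrite -ltr_expR lnK ?posrE//.
  (* 16 = 2^4: the exponential is squared four times *)
  have -> : 51 / 50 = - (16%:R * (- (51 / 800))) :> R by field.
  rewrite expRN expRM_natl.
  have h1 : 936 / 1000 <= expR (- (51 / 800)) :> R.
    by have := expR_ge1Dx (- (51 / 800) : R); lra.
  set x := expR _ in h1 *.
  have h2 : 876 / 1000 <= x ^+ 2 by apply: sqr_lb h1; lra.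
  have h4 : 767 / 1000 <= x ^+ 4 by rewrite (exprM x 2 2); apply: sqr_lb h2; lra.
  have h8 : 588 / 1000 <= x ^+ 8 by rewrite (exprM x 4 2); apply: sqr_lb h4; lra.
  have h16 : 345 / 1000 <= x ^+ 16 by rewrite (exprM x 8 2); apply: sqr_lb h8; lra.
  have x0 : 0 < x ^+ 16 by apply: lt_le_trans h16; lra.
  rewrite -(ltr_pM2l x0) mulfV ?lt0r_neq0//; move: h16; clear; lra.
rewrite -ltr_expR lnK ?posrE//.
have -> : 41 / 25 = 2%:R * (41 / 50) :> R by field.
rewrite expRM_natl.
have h1 : 91 / 50 <= expR (41 / 50) :> R.
  by have := expR_ge1Dx (41 / 50 : R); lra.
set x := expR _ in h1 *.
have h2 : 33 / 10 <= x ^+ 2 by apply: sqr_lb h1; lra.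
by rewrite (lt_le_trans _ h2)//; lra.
Qed.

(** E is the value for which Rf E takes equal values at pi / 3 and 2 pi / 3, resp.
    at ln 3 and 3 ln 3; between these points Rf E goes up and down, so its slopes
    there have opposite signs. *)
Lemma two_zeros (i : family) : exists E t1 t2 : R,
  [/\ domt i t1, domt i t2, t1 < t2, Rf i E t1 = Rf i E t2 &
      gf i E t1 != 0 /\ gf i E t2 != 0].
Proof.
case: i.
  have p3 := @pi_ge3; have p0 := @pi_gt0 R; have [s0 s2] := sin_pi3.
  have cE := cos_pi3; set s := sin (pi / 3) in s0 s2.
  have s1 : 86 / 100 < s.
    rewrite ltNge; apply/negP => H; have : s ^+ 2 <= (86 / 100) ^+ 2 by rewrite ler_pXn2r ?nnegrE//; lra.
    by rewrite s2; lra.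
  have s1' : s < 87 / 100.
    rewrite ltNge; apply/negP => H; have : (87 / 100) ^+ 2 <= s ^+ 2 by rewrite ler_pXn2r ?nnegrE//; lra.
    by rewrite s2; lra.
  have c2 : cos (2 * (pi / 3)) = - (1 / 2) :> R.
    by rewrite mulrC mulr_natr cos_mulr2n cE; field.
  have sin2 : sin (2 * (pi / 3)) = s :> R.
    by rewrite mulrC mulr_natr sin_mulr2n cE mulr2n -/s; field.
  have sn0 := lt0r_neq0 s0; have pn0 := lt0r_neq0 p0.
  have p4 : pi <= 4 :> R by have [/andP[_]] := @pihalf_02_cos_pihalf R; lra.
  exists (2 * pi / (3 * s)), (pi / 3), (2 * (pi / 3)).
  rewrite /domt /Rf /gf /= c2 sin2 cE -/s.
  clear c2 sin2 cE; move: s s0 s2 s1 s1' sn0 => s s0 s2 s1 s1' sn0.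
  (* field would unfold pi, so it is generalized first *)
  move: (pi : R) p0 p3 p4 pn0 => p p0 p3 p4 pn0; split.
  - by apply/andP; split; lra.
  - by apply/andP; split; lra.
  - by lra.
  - by field; rewrite sn0 pn0.
  split.
    apply: lt0r_neq0.
    have -> : 2 * p / (3 * s) * (p / 3 * (1 / 2) - s) + 1 * (p / 3) ^+ 2 * s =
       p * (p * (1 + s ^+ 2) - 6 * s) / (9 * s) by field.
    by rewrite divr_gt0 ?mulr_gt0// s2; lra.
  apply: ltr0_neq0.
  have -> : 2 * p / (3 * s) * (2 * (p / 3) * - (1 / 2) - s) + 1 * (2 * (p / 3)) ^+ 2 * s =
     - (p * (2 * p * (1 - 2 * s ^+ 2) + 6 * s) / (9 * s)) by field.
  by rewrite oppr_lt0 divr_gt0 ?mulr_gt0// s2; lra.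
have [l1 l2] := ln3_bounds; set L := ln 3 in l1 l2.
have L0 : 0 < L by lra.
have e1 : expR L = 3 by rewrite lnK ?posrE.
have e3 : expR (3 * L) = 27 by rewrite expRM_natl e1; ring.
exists (15 / 4 * L), L, (3 * L).
have C1 : ch L = 5 / 3 by rewrite /ch expRN e1; field.
have S1 : sh L = 4 / 3 by rewrite /sh expRN e1; field.
have C3 : ch (3 * L) = 365 / 27 by rewrite /ch expRN e3; field.
have S3 : sh (3 * L) = 364 / 27 by rewrite /sh expRN e3; field.
have Ln := lt0r_neq0 L0.
rewrite /domt /Rf /gf /= C1 S1 C3 S3; split.
- by rewrite L0.
- by rewrite andbT; lra.
- lra.
- by field.
split.
  apply: lt0r_neq0.
  have -> : 15 / 4 * L * (L * (5 / 3) - 4 / 3) + -1 * L ^+ 2 * (4 / 3) =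
    L * (59 / 12 * L - 5) by field.
  by apply: mulr_gt0; [exact: L0|lra].
apply: ltr0_neq0.
have -> : 15 / 4 * L * (3 * L * (365 / 27) - 364 / 27) + -1 * (3 * L) ^+ 2 * (364 / 27) =
   L * (123 / 4 * L - 455 / 9) by field.
by rewrite -oppr_gt0 -mulrN; apply: mulr_gt0; [exact: L0|lra].
Qed.

End choice_of_parameters.

(** * Primitives of locally integrable functions *)

Section primitives.
Context {R : realType}.
Notation mu := (@lebesgue_measure R).
Implicit Types (f v F : R -> R) (a b : R).

Lemma aeS (P Q : R -> Prop) : (forall t, P t -> Q t) ->
  {ae mu, forall t, P t} -> {ae mu, forall t, Q t}.
Proof. by move=> PQ; apply: (@filterS _ _ (ae_filter_ringOfSetsType mu)). Qed.

(** One coordinate f of a solution with velocity v. *)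
Definition primitive f v := locally_integrable setT v /\
  forall a b, a <= b -> f b - f a = Rintegral mu `[a, b] v.

Lemma locint_itv v a b : locally_integrable setT v ->
  mu.-integrable `[a, b] (EFin \o v).
Proof.
move=> [mv _ fv]; apply/integrableP; split.
  apply/measurable_realfun.measurable_EFinP; exact: measurable_funTS.
by apply: (fv `[a, b]%classic) => //; exact: segment_compact.
Qed.

Lemma Rint_open v a b : mu.-integrable `[a, b] (EFin \o v) ->
  Rintegral mu `[a, b] v = Rintegral mu `]a, b[ v.
Proof.
move=> iv.
have sub : `]a, b[%classic `<=` `[a, b]%classic by exact: subset_itv_oo_cc.
have sub2 : `]a, b]%classic `<=` `[a, b]%classic by exact: subset_itv_oc_cc.
have i1 : mu.-integrable `]a, b[ (EFin \o v) by exact: integrableS iv.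
have i2 : mu.-integrable `]a, b] (EFin \o v) by exact: integrableS iv.
by rewrite (Rintegral_itv_bndo_bndc i1) (Rintegral_itv_obnd_cbnd i2).
Qed.

Lemma ae_eq_Rint v F a b : mu.-integrable `[a, b] (EFin \o v) ->
  mu.-integrable `[a, b] (EFin \o F) ->
  {ae mu, forall t, a < t < b -> v t = F t} ->
  Rintegral mu `[a, b] v = Rintegral mu `[a, b] F.
Proof.
move=> iv iF vF; rewrite !Rint_open//; rewrite /Rintegral; congr fine.
have sub : `]a, b[%classic `<=` `[a, b]%classic by exact: subset_itv_oo_cc.
apply: ae_eq_integral => //.
- by have /integrableP[] : mu.-integrable `]a, b[ (EFin \o v) by exact: integrableS iv.
- by have /integrableP[] : mu.-integrable `]a, b[ (EFin \o F) by exact: integrableS iF.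
- by apply: aeS vF => t H; rewrite /= in_itv /= => tab; rewrite H.
Qed.

Lemma primitive_cont f v : primitive f v -> forall x, {for x, continuous f}.
Proof.
move=> [lv fv] x.
have x1 : x - 1 < x + 1 by lra.
have := parameterized_integral_continuous (ltW x1) (locint_itv (x - 1) (x + 1) lv).
move=> cp; apply: (@within_continuous_continuous _ _ _ (x - 1) (x + 1)) => //; last first.
  by rewrite in_itv /=; lra.
apply: (@subspace_eq_continuous _ _ _
  (fun t => f (x - 1) + parameterized_integral mu (x - 1) t v)).
  move=> t; rewrite /from_subspace inE /= in_itv /= => /andP[t1 _].
  by rewrite /parameterized_integral -fv// addrC subrK.
by move=> t; apply: cvgD; [exact: cvg_cst|exact: cp].
Qed.

(** Where the velocity agrees almost everywhere with a continuous function, the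
    solution is differentiable in the classical sense. *)
Lemma primitive_der f v F a b : primitive f v -> (forall x, {for x, continuous F}) ->
  {ae mu, forall t, a < t < b -> v t = F t} ->
  forall x, a < x < b -> is_derive x 1 f (F x).
Proof.
move=> [lv fv] cF vF x /andP[ax xb].
have iF u : mu.-integrable `[a, u] (EFin \o F).
  apply: continuous_compact_integrable; first exact: segment_compact.
  by apply: continuous_subspaceT => y; exact: cF.
have [dG GE] := continuous_FTC1_closed xb (iF b) ax (cF x).
set G := fun x0 : R => Rintegral mu `[a, x0] F in dG GE.
have dG' : is_derive x 1 G (F x).
  by apply: DeriveDef; [exact: dG|rewrite -derive1E; exact: GE].
have dH : is_derive x 1 (fun t => f a + G t) (F x).
  by apply: (der_eq (der_add (der_cst (f a) x) dG')); rewrite add0r.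
apply: near_eq_is_derive dH; near=> t.
have [at0 tb] : a <= t /\ t <= b.
  have : t \in `]a, b[ by near: t; apply: near_in_itvoo; rewrite in_itv /= ax.
  by rewrite in_itv /= => /andP[/ltW ? /ltW ?].
rewrite /G -(@ae_eq_Rint v)//; last 1 first.
- apply: aeS vF => s H /andP[sa st]; apply: H; rewrite sa/=.
  exact: lt_le_trans st tb.
- by rewrite -fv// addrC subrK.
- exact: locint_itv.
Unshelve. all: by end_near. Qed.

(** A lower bound on the velocities of a differential inclusion forces the solution
    to move; this is how crossings of z = 0 are detected. *)
Lemma primitive_ge f v m a b : primitive f v -> a <= b ->
  {ae mu, forall t, a < t < b -> m <= v t} -> m * (b - a) <= f b - f a.
Proof.
move=> [lv fv] ab mv.
have iv := locint_itv a b lv.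
have icst : mu.-integrable `[a, b] (EFin \o (fun _ : R => m)).
  apply: continuous_compact_integrable; first exact: segment_compact.
  by apply: continuous_subspaceT => y; exact: cvg_cst.
(* v is replaced by max v m, which is at least m everywhere *)
pose u := fun t => Num.max (v t) m.
have iu : mu.-integrable `[a, b] (EFin \o u).
  have ig : mu.-integrable `[a, b]
      ((abse \o (EFin \o v)) \+ (abse \o (EFin \o (fun=> m)))).
    by apply: integrableD => //; exact: integrable_abse.
  apply: le_integrable ig => //.
    apply/measurable_realfun.measurable_EFinP; apply: measurable_realfun.measurable_maxr.
      by have /integrableP[/measurable_realfun.measurable_EFinP] := iv.
    exact: measurable_cst.
  move=> t _; change (`|u t|%:E <= `|(`|v t| + `|m|)%R|%:E)%E.
  rewrite lee_fin /u.
  rewrite (ger0_norm (addr_ge0 _ _))//; have [_|_] := leP (v t) m.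
    by rewrite lerDr.
  by rewrite lerDl.
rewrite fv// (@ae_eq_Rint v u)//; last first.
  by apply: aeS mv => t H /H mt; rewrite /u; apply/esym/max_idPl.
have -> : m * (b - a) = Rintegral mu `[a, b] (fun=> m).
  rewrite Rintegral_cst//; congr (_ * _).
  have E := lebesgue_measure_itv `[a, b]; rewrite /= lte_fin in E.
  apply: (etrans _ (esym (congr1 fine E))).
  by move: ab; rewrite le_eqVlt => /predU1P[->|->]; rewrite ?ltxx ?subrr.
by apply: le_Rintegral => // t _; rewrite /u le_max lexx orbT.
Qed.

End primitives.

(** * Half turns of a planar linear flow *)

Section half_turn.
Context {R : realType}.
Variable i : family.
Implicit Types (t u k : R).
Let sg : R := sgf i.
Let dC := @der_Cf R i.
Let dS := @der_Sf R i.

(** The quantity, which is Sf^2 times the derivative of A, vanishes at t = 0 and has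
    derivative expR (k * t) * Sf t * (1 + sg * k^2) > 0. *)
Lemma half_turn_aux k t : `|k| < 1 -> domt i t ->
  0 < sg * (1 - expR (k * t) * (Cf i t - k * Sf i t)).
Proof.
move=> k1 dt; have t0 := domt_gt0 dt.
pose W u := sg * (1 - expR (k * u) * (Cf i u - k * Sf i u)).
have W0 : W 0 = 0 by rewrite /W mulr0 expR0 Cf0 Sf0 mulr0 subr0 mul1r subrr mulr0.
have dW u : is_derive u 1 W (expR (k * u) * Sf i u * (1 + sg * k ^+ 2)).
  have H1 := dC u; have H2 := dS u.
  rewrite /W; deriv; rewrite /sg.
  by have [->|->] := @sgf_pm R i; ring.
have k2 : k ^+ 2 < 1.
  by rewrite -(real_normK (num_real k)) expr_lt1.
have cW : {within `[0, t], continuous W}.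
  by apply: within_cont => u; exact: der_cont (dW u).
have dW' u : 0 < u < t -> is_derive u 1 W (expR (k * u) * Sf i u * (1 + sg * k ^+ 2)).
  by move=> _; exact: dW.
have H := lt_of_der t0 cW dW'; rewrite W0 in H; apply: H.
move=> u /andP[u0 ut]; rewrite !mulr_gt0 ?expR_gt0//.
  by apply/Sf_gt0/(domt_le dt); rewrite u0 ltW.
rewrite /sg; have k0 := sqr_ge0 k; have [->|->] := @sgf_pm R i; lra.
Qed.

Lemma Af_mono k t1 t2 : `|k| < 1 -> domt i t2 -> 0 < t1 < t2 ->
  Af i t1 k < Af i t2 k.
Proof.
move=> k1 d2 /andP[t10 t12].
pose dA u := sg * (1 - expR (k * u) * (Cf i u - k * Sf i u)) / Sf i u ^+ 2.
have dom u : t1 <= u <= t2 -> domt i u.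
  by move=> /andP[t1u ut2]; apply: (domt_le d2); rewrite ut2 (lt_le_trans t10).
have dAP u : t1 <= u <= t2 -> is_derive u 1 (fun u => Af i u k) (dA u).
  move=> uu; have s0 := lt0r_neq0 (Sf_gt0 (dom u uu)).
  have H1 := dC u; have H2 := dS u; have cs := CfSf i u.
  rewrite /Af; deriv => //; rewrite /dA.
  apply: (mulIf (expf_neq0 2 s0)); rewrite mulfVK ?expf_neq0//.
  have c2 : Cf i u ^+ 2 = 1 - sgf i * Sf i u ^+ 2 by rewrite -cs addrK.
  transitivity (sgf i * (k * expR (k * u) * Sf i u - expR (k * u) * Cf i u +
    (sgf i * Sf i u ^+ 2 + Cf i u ^+ 2))); first by field.
  by rewrite c2 /sg; ring.
have dA' u : t1 < u < t2 -> is_derive u 1 (fun u => Af i u k) (dA u).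
  by move=> /andP[u1 u2]; apply: dAP; rewrite !ltW.
apply: (lt_of_der t12 _ dA').
  by apply: within_cont_in => u uu; exact: der_cont (dAP u uu).
move=> u /andP[u1 u2]; rewrite divr_gt0//; first by apply: half_turn_aux => //; apply: dom; rewrite !ltW.
  by rewrite exprn_gt0//; apply/Sf_gt0/dom; rewrite !ltW.
Qed.

Lemma Af_le k t1 t2 : `|k| < 1 -> domt i t1 -> domt i t2 ->
  (Af i t1 k <= Af i t2 k) = (t1 <= t2).
Proof.
move=> k1 d1 d2; have [t12|t21|->] := ltgtP t1 t2; last by rewrite lexx.
  by apply/ltW/Af_mono => //; rewrite t12 (domt_gt0 d1).
by apply/negbTE; rewrite -ltNge; apply: Af_mono => //; rewrite t21 (domt_gt0 d2).
Qed.

(** This says that the flow is transversal to the line Q = sg * h at the ends of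
    an arc: there Q' is h * (A - sg * k), up to sign. *)
Lemma Af_transversal k t : `|k| < 1 -> domt i t -> sg * k < Af i t k.
Proof.
move=> k1 dt; have s0 := Sf_gt0 dt.
have nk : `|- k| < 1 by rewrite normrN.
have := half_turn_aux nk dt; rewrite mulNr expRN => H.
have e0 := expR_gt0 (k * t); have en := lt0r_neq0 e0.
rewrite -subr_gt0.
have -> : Af i t k - sg * k = expR (k * t) * (sg * (1 - (expR (k * t))^-1 * (Cf i t - - k * Sf i t))) / Sf i t.
  by rewrite /Af /sg; field; rewrite en lt0r_neq0.
by rewrite divr_gt0// mulr_gt0.
Qed.

(** The flow of P' = k P - sg Q, Q' = P + k Q at time u. *)
Definition arcP k (P Q u : R) := expR (k * u) * (P * Cf i u - sg * Q * Sf i u).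
Definition arcQ k (P Q u : R) := expR (k * u) * (Q * Cf i u + P * Sf i u).

Lemma arcP0 k P Q : arcP k P Q 0 = P.
Proof. by rewrite /arcP mulr0 expR0 Cf0 Sf0 mulr0 subr0 mulr1 mul1r. Qed.
Lemma arcQ0 k P Q : arcQ k P Q 0 = Q.
Proof. by rewrite /arcQ mulr0 expR0 Cf0 Sf0 mulr0 addr0 mulr1 mul1r. Qed.

Lemma der_arcP k (P Q om x : R) : is_derive x 1 (fun t => arcP k P Q (om * t))
  (om * (k * arcP k P Q (om * x) - sg * arcQ k P Q (om * x))).
Proof.
have H1 := dC (om * x); have H2 := dS (om * x).
by rewrite /arcP /arcQ; deriv; rewrite /sg; have [->|->] := @sgf_pm R i; ring.
Qed.
Lemma der_arcQ k (P Q om x : R) : is_derive x 1 (fun t => arcQ k P Q (om * t))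
  (om * (arcP k P Q (om * x) + k * arcQ k P Q (om * x))).
Proof.
have H1 := dC (om * x); have H2 := dS (om * x).
by rewrite /arcP /arcQ; deriv; rewrite /sg; have [->|->] := @sgf_pm R i; ring.
Qed.

(** The solution rotated back by the inverse flow, (U, V) below, is constant. *)
Lemma linear_flow (P Q : R -> R) (k om a b : R) :
  (forall x, {for x, continuous P}) -> (forall x, {for x, continuous Q}) ->
  (forall x, a < x < b -> is_derive x 1 P (om * (k * P x - sg * Q x))) ->
  (forall x, a < x < b -> is_derive x 1 Q (om * (P x + k * Q x))) ->
  forall t, a <= t <= b -> P t = arcP k (P a) (Q a) (om * (t - a)) /\
                           Q t = arcQ k (P a) (Q a) (om * (t - a)).
Proof.
move=> cP cQ dP dQ t /andP[at0 tb].
pose U x := expR (- k * (om * (x - a))) *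
  (P x * Cf i (om * (x - a)) + sg * Q x * Sf i (om * (x - a))).
pose V x := expR (- k * (om * (x - a))) *
  (Q x * Cf i (om * (x - a)) - P x * Sf i (om * (x - a))).
have cE x : {for x, continuous (fun x => expR (- k * (om * (x - a))))}.
  have [d dE] : exists d, is_derive x 1 (fun x => expR (- k * (om * (x - a)))) d.
    by eexists; der.
  exact: der_cont dE.
have cC x : {for x, continuous (fun x => Cf i (om * (x - a)))}.
  have H1 := dC (om * (x - a)).
  have [d dE] : exists d, is_derive x 1 (fun x => Cf i (om * (x - a))) d by eexists; der.
  exact: der_cont dE.
have cS x : {for x, continuous (fun x => Sf i (om * (x - a)))}.
  have H1 := dS (om * (x - a)).
  have [d dE] : exists d, is_derive x 1 (fun x => Sf i (om * (x - a))) d by eexists; der.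
  exact: der_cont dE.
have cU x : {for x, continuous U}.
  apply: cvgM; first exact: cE.
  apply: cvgD; first by apply: cvgM; [exact: cP|exact: cC].
  by apply: cvgM; [apply: cvgM; [exact: cvg_cst|exact: cQ]|exact: cS].
have cV x : {for x, continuous V}.
  apply: cvgM; first exact: cE.
  apply: cvgB; first by apply: cvgM; [exact: cQ|exact: cC].
  by apply: cvgM; [exact: cP|exact: cS].
have dU x : a < x < t -> is_derive x 1 U 0.
  move=> /andP[ax xt]; have xb : a < x < b by rewrite ax (lt_le_trans xt).
  have h1 := dP x xb; have h2 := dQ x xb.
  have H1 := dC (om * (x - a)); have H2 := dS (om * (x - a)).
  rewrite /U; deriv; rewrite /sg; have [->|->] := @sgf_pm R i; ring.
have dV x : a < x < t -> is_derive x 1 V 0.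
  move=> /andP[ax xt]; have xb : a < x < b by rewrite ax (lt_le_trans xt).
  have h1 := dP x xb; have h2 := dQ x xb.
  have H1 := dC (om * (x - a)); have H2 := dS (om * (x - a)).
  rewrite /V; deriv; rewrite /sg; have [->|->] := @sgf_pm R i; ring.
have UE := eq_of_der0 at0 (within_cont cU) dU.
have VE := eq_of_der0 at0 (within_cont cV) dV.
have Ua : U a = P a.
  by rewrite /U subrr mulr0 mulr0 expR0 Cf0 Sf0 mulr0 addr0 mulr1 mul1r.
have Va : V a = Q a.
  by rewrite /V subrr mulr0 mulr0 expR0 Cf0 Sf0 mulr0 subr0 mulr1 mul1r.
rewrite -Ua -Va UE VE /arcP /arcQ /U /V.
have cs := CfSf i (om * (t - a)); set u := om * (t - a) in cs *.
have en := lt0r_neq0 (expR_gt0 (k * u)).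
have -> : - k * u = - (k * u) by rewrite mulNr.
rewrite expRN; split.
  transitivity (P t * (Cf i u ^+ 2 + sgf i * Sf i u ^+ 2)); first by rewrite cs mulr1.
  by rewrite /sg; have [->|->] := @sgf_pm R i; field.
transitivity (Q t * (Cf i u ^+ 2 + sgf i * Sf i u ^+ 2)); first by rewrite cs mulr1.
by rewrite /sg; have [->|->] := @sgf_pm R i; field.
Qed.

(** The two equations Q(0) = Q(u) = sg * h are solved for the P-coordinates of the
    ends. The angle cannot exceed pi in the circular case, since at angle pi the
    point would be on the other side of the line. *)
Lemma arc_return k (p h u : R) : 0 < h -> 0 < u ->
  arcQ k p (sg * h) u = sg * h ->
  (forall t, 0 < t < u -> sg * h < arcQ k p (sg * h) t) ->
  [/\ domt i u, p = h * Af i u (- k) & arcP k p (sg * h) u = - (h * Af i u k)].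
Proof.
move=> h0 u0 E pos.
have du : domt i u.
  apply/negPn/negP => /(not_domt u0) [s1 [w /andP[w0 wu] [Sw Cw]]].
  have Hw : sg * h <= arcQ k p (sg * h) w.
    move: wu; rewrite le_eqVlt => /predU1P[->|wu]; first by rewrite E.
    by apply/ltW/pos; rewrite w0.
  move: Hw; rewrite /arcQ Sw mulr0 addr0 /sg s1 mul1r => Hw.
  have : expR (k * w) * (h * Cf i w) < 0.
    by rewrite pmulr_rlt0 ?expR_gt0// pmulr_rlt0.
  lra.
have Sn := lt0r_neq0 (Sf_gt0 du); have en := lt0r_neq0 (expR_gt0 (k * u)).
have cs := CfSf i u.
have pE : p = h * Af i u (- k).
  apply: (mulIf Sn); apply: (mulfI en).
  transitivity (arcQ k p (sg * h) u - expR (k * u) * (sg * h * Cf i u)).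
    by rewrite /arcQ; ring.
  rewrite E /Af mulNr expRN /sg; by field; rewrite en Sn.
split => //; rewrite pE /arcP /Af mulNr expRN /sg.
apply: (mulIf Sn).
have c2 : Cf i u ^+ 2 = 1 - sgf i * Sf i u ^+ 2 by rewrite -cs addrK.
transitivity (sgf i * h * Cf i u - sgf i * h * expR (k * u) * (Cf i u ^+ 2 + sgf i * (sgf i * sgf i) * Sf i u ^+ 2)).
  by rewrite sgsg mulr1; have [->|->] := @sgf_pm R i; field; rewrite ?en ?Sn.
by rewrite sgsg mulr1 c2 subrK mulr1; field.
Qed.

Lemma arc_at_return k (h u : R) : domt i u ->
  let p := h * Af i u (- k) in
  arcQ k p (sg * h) u = sg * h /\ arcP k p (sg * h) u = - (h * Af i u k).
Proof.
move=> du p; have Sn := lt0r_neq0 (Sf_gt0 du); have en := lt0r_neq0 (expR_gt0 (k * u)).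
have cs := CfSf i u.
split; first by rewrite /arcQ /p /Af mulNr expRN /sg; field; rewrite en Sn.
rewrite /p /arcP /Af mulNr expRN /sg; apply: (mulIf Sn).
have c2 : Cf i u ^+ 2 = 1 - sgf i * Sf i u ^+ 2 by rewrite -cs addrK.
transitivity (sgf i * h * Cf i u - sgf i * h * expR (k * u) * (Cf i u ^+ 2 + sgf i * (sgf i * sgf i) * Sf i u ^+ 2)).
  by rewrite sgsg mulr1; have [->|->] := @sgf_pm R i; field; rewrite ?en ?Sn.
by rewrite sgsg mulr1 c2 subrK mulr1; field.
Qed.

(** The height above the line at angle t is a positive multiple of
    A(u, -k) - A(t, -k). *)
Lemma arc_above k (h u t : R) : `|k| < 1 -> 0 < h -> domt i u -> 0 < t < u ->
  sg * h < arcQ k (h * Af i u (- k)) (sg * h) t.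
Proof.
move=> k1 h0 du tu; have /andP[t0 ut] := tu.
have nk : `|- k| < 1 by rewrite normrN.
have dt : domt i t by apply: (domt_le du); rewrite t0 ltW.
have St := Sf_gt0 dt; have e0 := expR_gt0 (k * t).
rewrite -subr_gt0.
have -> : arcQ k (h * Af i u (- k)) (sg * h) t - sg * h =
   expR (k * t) * Sf i t * h * (Af i u (- k) - Af i t (- k)).
  have Sn := lt0r_neq0 St; have en := lt0r_neq0 e0.
  rewrite /arcQ; set A := Af i u _; rewrite /Af mulNr expRN /sg; field.
  by rewrite en Sn.
by rewrite !mulr_gt0// subr_gt0; apply: Af_mono.
Qed.

End half_turn.

(** * Closed trajectories of the linear flow and first zeros *)

Definition ns s := if s is above then below else above.

Lemma nsK s : ns (ns s) = s. Proof. by case: s. Qed.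

Section flow_extra.
Context {R : realType}.
Implicit Types (f : R -> R).

Lemma expR_fixed (x u : R) : u != 0 -> x * expR u = x -> x = 0.
Proof.
move=> u0 E; have : x * (expR u - 1) = 0 by rewrite mulrBr mulr1 E subrr.
move=> /eqP; rewrite mulf_eq0 => /orP[/eqP//|].
rewrite subr_eq0 => /eqP eu.
by move: u0; rewrite (_ : u = 0) ?eqxx// -(expRK u) eu ln1.
Qed.

(** The quadratic form P^2 + sg * Q^2 is multiplied by exp (2 k u), hence vanishes
    at a fixed point. In the hyperbolic case this leaves the lines P = Q and
    P = - Q, which are scaled by exp ((k + 1) u) and exp ((k - 1) u). *)
Lemma flow_fixed i (k P Q u : R) : `|k| < 1 -> k != 0 -> 0 < u ->
  arcP i k P Q u = P -> arcQ i k P Q u = Q -> P = 0 /\ Q = 0.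
Proof.
move=> k1 k0 u0 EP EQ.
have H : P ^+ 2 + sgf i * Q ^+ 2 = 0.
  apply: (@expR_fixed _ (k * u + k * u)).
    by rewrite -mulrDl -mulr2n -mulr_natr !mulf_neq0// ?pnatr_eq0// lt0r_neq0.
  transitivity (arcP i k P Q u ^+ 2 + sgf i * arcQ i k P Q u ^+ 2); last by rewrite EP EQ.
  rewrite /arcP /arcQ expRD; have cs := CfSf i u.
  set E := expR _; rewrite -[in LHS](mulr1 (_ + _)) -cs.
  by have [->|->] := @sgf_pm R i; ring.
move: H EP EQ; case: i => /= H EP EQ.
  move: H; rewrite mul1r => /eqP; rewrite paddr_eq0 ?sqr_ge0//.
  by rewrite !sqrf_eq0 => /andP[/eqP -> /eqP ->].
have [kl kr] : -1 < k /\ k < 1 by move: k1; rewrite ltr_norml => /andP[].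
have /eqP : (P - Q) * (P + Q) = 0 by rewrite -[RHS]H; ring.
rewrite mulf_eq0 subr_eq0 addr_eq0 => /orP[/eqP PQ|/eqP PQ].
  suff P0 : P = 0 by rewrite -PQ P0.
  apply: (@expR_fixed _ ((k + 1) * u)); first by rewrite mulf_neq0 ?lt0r_neq0//; lra.
  by rewrite -[RHS]EP -PQ /arcP /= mulrDl mul1r expRD /ch /sh; field.
suff P0 : P = 0 by split => //; apply: oppr_inj; rewrite -PQ P0 oppr0.
apply: (@expR_fixed _ ((k - 1) * u)).
  by apply: mulf_neq0; [apply: ltr0_neq0; lra|exact: lt0r_neq0].
have QP : Q = - P by rewrite PQ opprK.
by rewrite -[RHS]EP QP /arcP /= mulrBl mul1r expRD /ch /sh; field.
Qed.

Lemma first_zero f a b : (forall x, {for x, continuous f}) -> a <= b ->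
  0 < f a -> f b <= 0 ->
  exists c, [/\ a < c <= b, f c = 0 & forall t, a <= t < c -> 0 < f t].
Proof.
move=> cf ab fa fb.
pose S := `[a, b]%classic `&` [set t | f t <= 0].
have cS : compact S.
  apply: compact_closedI; first exact: segment_compact.
  have -> : [set t | f t <= 0] = f @^-1` [set x | x <= 0] by [].
  by apply: closed_comp; [move=> x _; exact: cf|exact: closed_le].
have bS : S b by split => //=; rewrite in_itv /= ab lexx.
have [c cS' cmin] : exists2 c, c \in S & forall t, t \in S -> c <= t.
  have S0 : S !=set0 by exists b.
  have ci : {within S, continuous (fun x : R => x)}.
    by apply: continuous_subspaceT => x; exact: cvg_id.
  by have [c cin H] := compact_EVT_min S0 cS ci; exists c.
have [] : S c by rewrite inE in cS'.
rewrite /= in_itv /= => /andP[ac cb] fc.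
have pos t : a <= t < c -> 0 < f t.
  move=> /andP[at0 tc]; rewrite ltNge; apply/negP => ft.
  have : c <= t by apply: cmin; rewrite inE; split => //=; rewrite in_itv /= at0 ltW// (lt_le_trans tc).
  by rewrite leNgt tc.
have ac' : a < c.
  by rewrite lt_neqAle ac andbT; apply/eqP => E; move: fa; rewrite E ltNge fc.
exists c; split => //; first by rewrite ac' cb.
apply/eqP; rewrite eq_le fc/= leNgt; apply/negP => fc0.
have cw : {within `[a, c], continuous f} by exact: within_cont.
have [|d] := @IVT _ f a c 0 ac cw.
  by rewrite minC; have [_|H] := leP (f c) (f a); lra.
rewrite in_itv /= => /andP[ad dc] fd.
have dc' : d < c by rewrite lt_neqAle dc andbT; apply/eqP => E; move: fc0; rewrite -E fd ltxx.
by have := pos d; rewrite ad dc' fd ltxx; lra.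
Qed.

Lemma last_zero f a b : (forall x, {for x, continuous f}) -> a <= b ->
  f a <= 0 -> 0 < f b ->
  exists c, [/\ a <= c < b, f c = 0 & forall t, c < t <= b -> 0 < f t].
Proof.
move=> cf ab fa fb.
have [||||c [/andP[bc ca] fc H]] := @first_zero (fun t => f (- t)) (- b) (- a).
- by move=> x; apply: continuous_comp; [exact: opp_continuous|exact: cf].
- by rewrite lerN2.
- by rewrite opprK.
- by rewrite opprK.
exists (- c); split => //; first by rewrite lerNr ca ltrNl.
by move=> t /andP[ct tb]; rewrite -(opprK t); apply: H; rewrite lerN2 tb ltrNl.
Qed.

End flow_extra.

(** * Periodic orbits in a neighbourhood of the cycle *)

Lemma primitiveN (R : realType) (f v : R -> R) : primitive f v ->
  primitive (fun t => - f t) (fun t => - v t).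
Proof.
move=> [lv fv]; split; first exact: locally_integrableN lv.
move=> a b ab; have -> : - f b - - f a = - (f b - f a) by rewrite opprK opprB addrC.
rewrite fv//.
have iv := locint_itv a b lv.
rewrite -mulN1r -RintegralZl//.
by apply: eq_Rintegral => t _; rewrite mulN1r.
Qed.

Lemma primitive_sgs (R : realType) (f v : R -> R) s : primitive f v ->
  primitive (fun t => sgs s * f t) (fun t => sgs s * v t).
Proof.
case: s => /= fv.
  rewrite (_ : (fun t => 1 * f t) = f); last by apply/funext => t; rewrite mul1r.
  by rewrite (_ : (fun t => 1 * v t) = v)//; apply/funext => t; rewrite mul1r.
rewrite (_ : (fun t => -1 * f t) = fun t => - f t); last first.
  by apply/funext => t; rewrite mulN1r.
rewrite (_ : (fun t => -1 * v t) = fun t => - v t); last first.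
  by apply/funext => t; rewrite mulN1r.
exact: primitiveN.
Qed.

Lemma side_cases s s' : s' = s \/ s' = ns s.
Proof. by case: s; case: s'; [left|right|right|left]. Qed.

Lemma convex_ge (R : realFieldType) (m l a b : R) : 0 <= l -> l <= 1 -> m <= a -> m <= b ->
  m <= l * a + (1 - l) * b.
Proof. by nra. Qed.

Lemma between (R : realFieldType) (a b : R) : a < b -> exists t, a < t < b.
Proof. by move=> ab; exists ((a + b) / 2); rewrite !midf_lt. Qed.

Section normal_forms.
Context {R : realType}.
Implicit Types (s : side) (p : 'rV[R]_3) (Z : side -> 'rV[R]_3 -> 'rV[R]_3).

Lemma sgs2 s : sgs s * sgs s = 1 :> R.
Proof. by case: s; rewrite /= ?mulrNN mulr1. Qed.

Lemma sgs_ns s : sgs (ns s) = - sgs s :> R.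
Proof. by case: s; rewrite /= ?opprK. Qed.

Lemma sgsK s (x : R) : sgs s * (sgs s * x) = x.
Proof. by rewrite mulrA sgs2 mul1r. Qed.

Variables (i : family) (e : R) (om h dl k : side -> R).
Local Notation sg := (sgf i).

Definition ord_p s p := sgs s * (xc p + yc p) + dl s.
Definition ord_q s p := sgs s * zc p + sg * h s.

(** All fields here satisfy x' = x - e, so that the plane x = e carries the
    dynamics; in that plane [ord_p] and [ord_q], which are affine in x + y and in z,
    follow the linear flow of rate k s with angular speed om s. The plane z = 0 is
    the line ord_q = sg * h s. *)
Definition normal_form Z := forall s p, xc (Z s p) = xc p - e /\
  (xc p = e ->
   yc (Z s p) = sgs s * (om s * (k s * ord_p s p - sg * ord_q s p)) /\
   zc (Z s p) = sgs s * (om s * (ord_p s p + k s * ord_q s p))).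

(** v0 and v1 are the values of x + y, up to sign, at the two ends of an arc on
    side s; the signs are such that v1 is the first argument for the next arc. *)
Definition half_return s (v0 v1 : R) := exists u, [/\ domt i u,
  v0 + dl s = h s * Af i u (- k s) & v1 = h s * Af i u (k s) + dl s].

(** The point at angle u on the arc of side s issued from the point of z = 0 with
    sgs s * (x + y) = v. *)
Definition arc_point s (v u : R) : 'rV[R]_3 :=
  let P := arcP i (k s) (v + dl s) (sg * h s) u in
  let Q := arcQ i (k s) (v + dl s) (sg * h s) u in
  vec3 e (sgs s * (P - dl s) - e) (sgs s * (Q - sg * h s)).

Definition cycle_set (yv th : side -> R) : set 'rV[R]_3 :=
  [set p | exists s u, 0 <= u <= th s /\ p = arc_point s (yv s) u].

Lemma vec3P p : p = vec3 (xc p) (yc p) (zc p).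
Proof.
apply/rowP => j; rewrite mxE; case: j => -[|[|[|//]]] j3 /=.
- by congr (p 0 _); apply: val_inj.
- by congr (p 0 _); apply: val_inj.
- by congr (p 0 _); apply: val_inj.
Qed.
Lemma xc_vec3 (a b c : R) : xc (vec3 a b c) = a. Proof. by rewrite /xc mxE. Qed.
Lemma yc_vec3 (a b c : R) : yc (vec3 a b c) = b. Proof. by rewrite /yc mxE. Qed.
Lemma zc_vec3 (a b c : R) : zc (vec3 a b c) = c. Proof. by rewrite /zc mxE. Qed.

Lemma arc_pointE s p v u : xc p = e ->
  ord_p s p = arcP i (k s) (v + dl s) (sg * h s) u ->
  ord_q s p = arcQ i (k s) (v + dl s) (sg * h s) u -> p = arc_point s v u.
Proof.
move=> px pP pQ; rewrite (vec3P p) /arc_point -pP -pQ /ord_p /ord_q px.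
by rewrite !addrK !sgsK addrAC subrr add0r.
Qed.

Section orbits.
Variable Z : side -> 'rV[R]_3 -> 'rV[R]_3.
Hypothesis nfZ : normal_form Z.
Hypothesis om0 : forall s, 0 < om s.
Hypothesis h0 : forall s, 0 < h s.
Hypothesis k1 : forall s, `|k s| < 1.

Variables (g v : R -> 'rV[R]_3) (T : R).
Hypothesis gx : primitive (fun t => xc (g t)) (fun t => xc (v t)).
Hypothesis gy : primitive (fun t => yc (g t)) (fun t => yc (v t)).
Hypothesis gz : primitive (fun t => zc (g t)) (fun t => zc (v t)).
Hypothesis gv : {ae lebesgue_measure, forall t, filippov Z (g t) (v t)}.
Hypothesis T0 : 0 < T.
Hypothesis gT : forall t, g (t + T) = g t.

Let cx := primitive_cont gx.
Let cy := primitive_cont gy.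
Let cz := primitive_cont gz.

(** x - e is multiplied by exp T in one period. *)
Lemma orbit_x t : xc (g t) = e.
Proof.
have dx (a b x : R) : a < x < b -> is_derive x 1 (fun t => xc (g t)) (xc (g x) - e).
  apply: (@primitive_der _ _ _ (fun t => xc (g t) - e) a b gx).
    by move=> y; apply: cvgB; [exact: cx|exact: cvg_cst].
  apply: aeS gv => y [f1 f2 f3] _.
  have [z0|z0|z0] := ltgtP (zc (g y)) 0.
  - by rewrite f2// (nfZ _ _).1.
  - by rewrite f1// (nfZ _ _).1.
  have [l _ ->] := f3 z0; rewrite /xc !mxE -!/(xc _) !(nfZ _ _).1; ring.
pose W t := (xc (g t) - e) * expR (- t).
have dW (x : R) : is_derive x 1 W 0.
  have xx : x - 1 < x < x + 1 by lra.
  by have H := dx _ _ _ xx; rewrite /W; deriv; ring.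
have cW a b : {within `[a, b], continuous W}.
  by apply: within_cont => x; exact: der_cont (dW x).
have tT : t <= t + T by have ? := T0; lra.
have := eq_of_der0 tT (cW _ _) (fun x _ => dW x); rewrite /W gT => E.
have E2 : (xc (g t) - e) * expR (- T) = xc (g t) - e.
  have e0 := lt0r_neq0 (expR_gt0 (- t)); apply: (mulIf e0).
  by rewrite E opprD expRD; ring.
have nT : - T != 0 by rewrite oppr_eq0 lt0r_neq0.
by apply/eqP; rewrite -subr_eq0; apply/eqP; exact: expR_fixed nT E2.
Qed.

Let P s t := ord_p s (g t).
Let Q s t := ord_q s (g t).

Let cP s x : {for x, continuous (P s)}.
Proof.
apply: cvgD; last exact: cvg_cst.
by apply: cvgM; [exact: cvg_cst|apply: cvgD; [exact: cx|exact: cy]].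
Qed.

Let cQ s x : {for x, continuous (Q s)}.
Proof.
apply: cvgD; last exact: cvg_cst.
by apply: cvgM; [exact: cvg_cst|exact: cz].
Qed.

Lemma side_flow s a b : (forall t, a < t < b -> 0 < sgs s * zc (g t)) ->
  forall t, a <= t <= b -> P s t = arcP i (k s) (P s a) (Q s a) (om s * (t - a)) /\
                           Q s t = arcQ i (k s) (P s a) (Q s a) (om s * (t - a)).
Proof.
move=> pos.
have vE t : a < t < b -> filippov Z (g t) (v t) -> v t = Z s (g t).
  move=> /pos; case: (s) => /= [|] zt [f1 f2 f3]; first by apply: f1; rewrite mul1r in zt.
  by apply: f2; rewrite mulN1r oppr_gt0 in zt.
have dx (x : R) : is_derive x 1 (fun t => xc (g t)) 0.
  have -> : (fun t => xc (g t)) = (fun=> e) by apply/funext => y; exact: orbit_x.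
  exact: der_cst.
have dy (x : R) : a < x < b -> is_derive x 1 (fun t => yc (g t))
    (sgs s * (om s * (k s * P s x - sg * Q s x))).
  apply: (@primitive_der _ _ _ (fun t => sgs s * (om s * (k s * P s t - sg * Q s t))) a b gy).
    move=> y; apply: cvgM; first exact: cvg_cst.
    apply: cvgM; first exact: cvg_cst.
    apply: cvgB; (apply: cvgM; [exact: cvg_cst|]); [exact: cP|exact: cQ].
  by apply: aeS gv => t H tab; rewrite (vE t)// ((nfZ _ _).2 (orbit_x t)).1.
have dz (x : R) : a < x < b -> is_derive x 1 (fun t => zc (g t))
    (sgs s * (om s * (P s x + k s * Q s x))).
  apply: (@primitive_der _ _ _ (fun t => sgs s * (om s * (P s t + k s * Q s t))) a b gz).
    move=> y; apply: cvgM; first exact: cvg_cst.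
    apply: cvgM; first exact: cvg_cst.
    by apply: cvgD; [exact: cP|apply: cvgM; [exact: cvg_cst|exact: cQ]].
  by apply: aeS gv => t H tab; rewrite (vE t)// ((nfZ _ _).2 (orbit_x t)).2.
have dP (x : R) : a < x < b -> is_derive x 1 (P s) (om s * (k s * P s x - sg * Q s x)).
  move=> xab; have H1 := dx x; have H2 := dy x xab.
  by rewrite {1}/P /ord_p; deriv; rewrite mul0r !add0r addr0 sgsK.
have dQ (x : R) : a < x < b -> is_derive x 1 (Q s) (om s * (P s x + k s * Q s x)).
  move=> xab; have H2 := dz x xab.
  by rewrite {1}/Q /ord_q; deriv; rewrite mul0r !add0r addr0 sgsK.
exact: (linear_flow (@cP s) (@cQ s) dP dQ).
Qed.

Lemma shift_int (m : int) t : g (t + m%:~R * T) = g t.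
Proof.
have gn n u : g (u + n%:R * T) = g u.
  elim: n u => [|n IH] u; first by rewrite mul0r addr0.
  by rewrite -natr1 mulrDl mul1r addrA gT IH.
case: m => n; first exact: gn.
by rewrite NegzE mulrNz mulNr -[t in RHS](subrK (n.+1%:R * T)) gn.
Qed.

Lemma shift_into a t : exists2 u, a <= u <= a + T & g u = g t.
Proof.
pose m := Num.floor ((t - a) / T); exists (t + (- m)%:~R * T); last exact: shift_int.
have /andP[] := floor_itv ((t - a) / T); rewrite -/m intrD ler_pdivlMr// ltr_pdivrMr//.
rewrite mulrDl mul1r mulrNz mulNr => m1 m2; apply/andP; split; lra.
Qed.

Hypothesis kn0 : forall s, k s != 0.
Hypothesis g_moves : exists t, g t <> g 0.

(** On one side the flow is linear with rate k s != 0, and has no closed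
    trajectory. *)
Lemma side_left s : exists t, sgs s * zc (g t) <= 0.
Proof.
apply: contrapT => /forallNP H.
have pos t : 0 < sgs s * zc (g t) by rewrite ltNge; apply/negP; exact: H.
have PQ0 a : P s a = 0 /\ Q s a = 0.
  have aT : a <= a + T <= a + T by rewrite lexx andbT; have ? := T0; lra.
  have [] := side_flow (fun t _ => pos t) aT.
  have -> : P s (a + T) = P s a by rewrite /P gT.
  have -> : Q s (a + T) = Q s a by rewrite /Q gT.
  move=> /esym EP /esym EQ; apply: flow_fixed EP EQ => //.
  by rewrite addrAC subrr add0r mulr_gt0.
have gc t : g t = vec3 e (- (sgs s * dl s) - e) (- (sgs s * (sg * h s))).
  have [p0 q0] := PQ0 t; rewrite [LHS]vec3P orbit_x.
  congr (vec3 _ _ _).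
    have : sgs s * P s t = 0 by rewrite p0 mulr0.
    rewrite /P /ord_p mulrDr sgsK orbit_x; lra.
  have : sgs s * Q s t = 0 by rewrite q0 mulr0.
  rewrite /Q /ord_q mulrDr sgsK; lra.
by have [t] := g_moves; rewrite !gc.
Qed.

Variables (yv th : side -> R) (r : R).

(** A point of z = 0 where the arcs of side s are expected to start. *)
Definition gate s p := zc p = 0 /\ `|sgs s * (xc p + yc p) - yv s| < r.

Hypothesis transv : forall s s' (y : R), `|sgs s * y - yv s| < r ->
  0 < sgs s * (y + sgs s' * (dl s' + k s' * (sg * h s'))).
Hypothesis gates : forall t, zc (g t) = 0 -> exists s, gate s (g t).

(** At a gate both one-sided fields point strictly into side s, and so do all their
    convex combinations: whatever velocity is chosen on z = 0, the orbit crosses. *)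
Lemma gate_cross s t0 : gate s (g t0) -> exists2 d : R, 0 < d & forall t,
  (t0 < t < t0 + d -> 0 < sgs s * zc (g t)) /\
  (t0 - d < t < t0 -> sgs s * zc (g t) < 0).
Proof.
move=> [z0 yr].
pose F s' t := sgs s * (sgs s' * (om s' * (P s' t + k s' * Q s' t))).
have cF s' x : {for x, continuous (F s')}.
  do 3 (apply: cvgM; first exact: cvg_cst).
  by apply: cvgD; [exact: cP|apply: cvgM; [exact: cvg_cst|exact: cQ]].
have F0 s' : 0 < F s' t0.
  have -> : F s' t0 = om s' * (sgs s * ((xc (g t0) + yc (g t0)) +
      sgs s' * (dl s' + k s' * (sg * h s')))).
    rewrite /F /P /Q /ord_p /ord_q z0 mulr0 add0r.
    have S2 := sgs2 s'; move: S2; set S' := sgs s' => S2; set y := xc (g t0) + yc (g t0).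
    transitivity (om s' * (sgs s * ((S' * S') * y + S' * (dl s' + k s' * (sg * h s'))))).
      by ring.
    by rewrite S2 mul1r.
  by rewrite mulr_gt0//; exact: transv.
have [m m0 mF] : exists2 m : R, 0 < m & forall s', m < F s' t0.
  exists (Num.min (F above t0) (F below t0) / 2).
    by rewrite divr_gt0// lt_min !F0.
  have a0 := F0 above; have b0 := F0 below.
  by case; have [ab|ab] := leP (F above t0) (F below t0); lra.
have nF s' : \forall t \near t0, m < F s' t.
  by have cF0 : F s' @ t0 --> F s' t0 := cF s' t0; exact: cvgr_gt cF0 _ (mF s').
have [d /= d0 dF] : exists2 d : R, 0 < d & forall t, `|t0 - t| < d -> forall s', m < F s' t.
  have [d /= d0 H] := (nbhs_ballP _ _).1 (filterI (nF above) (nF below)); exists d => // t td.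
  by have [Ha Hb] := H t td; case.
have vm : {ae lebesgue_measure, forall t, t0 - d < t < t0 + d -> m <= sgs s * zc (v t)}.
  apply: aeS gv => t [f1 f2 f3] /andP[t1 t2].
  have {}dF : forall s', m < F s' t by apply: dF; rewrite ltr_norml; apply/andP; split; lra.
  have FZ s' : F s' t = sgs s * zc (Z s' (g t)) by rewrite ((nfZ _ _).2 (orbit_x t)).2.
  have [zt|zt|zt] := ltgtP (zc (g t)) 0.
  - by rewrite f2// -FZ ltW.
  - by rewrite f1// -FZ ltW.
  have [l /andP[l0 l1] ->] := f3 zt.
  rewrite /zc !mxE -!/(zc _).
  have := dF above; have := dF below; rewrite !FZ.
  set A := zc _; set B := zc _ => mA mB.
  have -> : sgs s * (l * B + (1 - l) * A) = l * (sgs s * B) + (1 - l) * (sgs s * A) by ring.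
  exact: convex_ge l0 l1 (ltW mB) (ltW mA).
exists d => // t; have gs := primitive_sgs s gz.
have Z0 : sgs s * zc (g t0) = 0 by rewrite z0 mulr0.
split => /andP[t1 t2].
  have := primitive_ge gs (ltW t1) (m := m); rewrite Z0 subr0.
  suff H : {ae lebesgue_measure, forall u, t0 < u < t -> m <= sgs s * zc (v u)}.
    move=> /(_ H); apply: lt_le_trans; rewrite mulr_gt0// subr_gt0//.
  by apply: aeS vm => u H /andP[u1 u2]; apply: H; apply/andP; split; lra.
have := primitive_ge gs (ltW t2) (m := m); rewrite Z0 sub0r.
suff H : {ae lebesgue_measure, forall u, t < u < t0 -> m <= sgs s * zc (v u)}.
  by move=> /(_ H); rewrite -oppr_gt0; apply: lt_le_trans; rewrite mulr_gt0// subr_gt0.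
by apply: aeS vm => u H /andP[u1 u2]; apply: H; apply/andP; split; lra.
Qed.

Definition arc s a b := [/\ a < b, gate s (g a), gate (ns s) (g b) &
  forall t, a < t < b -> 0 < sgs s * zc (g t)].

Lemma gate_left s b a : a < b -> gate s (g b) ->
  exists2 t, a < t < b & sgs s * zc (g t) < 0.
Proof.
move=> ab /gate_cross[d d0 H].
have [t /andP[t1 t2]] : exists t, Num.max a (b - d) < t < b.
  by apply: between; rewrite gt_max ab ltrBlDr ltrDl.
by move: t1; rewrite gt_max => /andP[at1 dt]; exists t; rewrite ?at1//; apply: (H t).2; rewrite dt.
Qed.

Lemma gate_right s b a : b < a -> gate s (g b) ->
  exists2 t, b < t < a & 0 < sgs s * zc (g t).
Proof.
move=> ab /gate_cross[d d0 H].
have [t /andP[t1 t2]] : exists t, b < t < Num.min a (b + d).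
  by apply: between; rewrite lt_min ab ltrDl.
by move: t2; rewrite lt_min => /andP[at1 dt]; exists t; rewrite ?t1//; apply: (H t).1; rewrite t1.
Qed.

(** The arc is bounded by the zeros of z which precede and follow t; they exist by
    [side_left] and periodicity, and their types are forced by [gate_cross]. *)
Lemma arc_through s t : 0 < sgs s * zc (g t) -> exists a b, arc s a b /\ a < t < b.
Proof.
move=> zt; have [t' t'0] := side_left s.
pose f u := sgs s * zc (g u).
have cf x : {for x, continuous f} by apply: cvgM; [exact: cvg_cst|exact: cz].
have [t2 /andP[t2a _] E2] := shift_into t t'.
have [t1 /andP[_ t1b] E1] := shift_into (t - T) t'.
have f2 : f t2 <= 0 by rewrite /f E2.
have f1 : f t1 <= 0 by rewrite /f E1.
have t1b' : t1 <= t by move: t1b; rewrite subrK.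
have [b [/andP[tb bt2] fb Hb]] := first_zero cf t2a zt f2.
have [a [/andP[t1a at_] fa Ha]] := last_zero cf t1b' f1 zt.
have pos u : a < u < b -> 0 < sgs s * zc (g u).
  move=> /andP[au ub]; have [ut|tu] := leP u t; first by apply: Ha; rewrite au.
  by apply: Hb; rewrite ub ltW.
have z0 u : f u = 0 -> zc (g u) = 0.
  by move=> fu; rewrite -[LHS](sgsK s) -/(f u) fu mulr0.
have ab : a < b := lt_trans at_ tb.
exists a, b; split; last by rewrite at_.
split => //.
- have [s' ga] := gates (z0 _ fa); have [<-//|sE] := side_cases s s'.
  have [u uab] := gate_right ab ga; rewrite sE sgs_ns mulNr oppr_gt0.
  by move=> H; have := pos u uab; rewrite ltNge ltW.
have [s' ga] := gates (z0 _ fb); have [sE|<-//] := side_cases s s'.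
have [u uab] := gate_left ab ga; rewrite sE.
by move=> H; have := pos u uab; rewrite ltNge ltW.
Qed.

Lemma next_arc s a : gate s (g a) -> exists b, arc s a b.
Proof.
move=> ga; have aa1 : a < a + 1 by rewrite ltrDl.
have [d d0 H] := gate_cross ga.
have [t /andP[at_ tad]] : exists t, a < t < a + d.
  by apply: between; rewrite ltrDl.
have zt : 0 < sgs s * zc (g t) by apply: (H t).1; rewrite at_.
have [a' [b [[a'b ga' gb pos] /andP[a't tb]]]] := arc_through zt.
suff aE : a' = a by exists b; rewrite -{1}aE.
apply/eqP; rewrite eq_le !leNgt; apply/andP; split; apply/negP => lt_a.
  have := (H a').1; rewrite lt_a (lt_trans a't tad) ga'.1 mulr0 ltxx.
  by move=> /(_ erefl).
have := pos a; rewrite lt_a (lt_trans at_ tb) ga.1 mulr0 ltxx.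
by move=> /(_ erefl).
Qed.

Lemma prev_arc s b : gate (ns s) (g b) -> exists a, arc s a b.
Proof.
move=> gb; have [d d0 H] := gate_cross gb.
have [t /andP[td tb]] : exists t, b - d < t < b.
  by apply: between; rewrite ltrBlDr ltrDl.
have zt : 0 < sgs s * zc (g t).
  by have := (H t).2; rewrite td tb sgs_ns mulNr oppr_lt0; exact.
have [a [b' [[ab' ga gb' pos] /andP[at_ tb']]]] := arc_through zt.
suff bE : b' = b by exists a; rewrite -{1}bE.
apply/eqP; rewrite eq_le !leNgt; apply/andP; split; apply/negP => lt_b.
  have := pos b; rewrite lt_b (lt_trans at_ tb) gb.1 mulr0 ltxx.
  by move=> /(_ erefl).
have := (H b').2; rewrite lt_b (lt_trans td tb') gb'.1 mulr0 ltxx.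
by move=> /(_ erefl).
Qed.

Let V s t := sgs s * (xc (g t) + yc (g t)).

Lemma arc_value s a b : arc s a b ->
  [/\ domt i (om s * (b - a)),
    V s a + dl s = h s * Af i (om s * (b - a)) (- k s),
    V (ns s) b = h s * Af i (om s * (b - a)) (k s) + dl s &
    forall t, a <= t <= b -> g t = arc_point s (V s a) (om s * (t - a))].
Proof.
move=> [ab ga gb pos]; have fl := side_flow pos.
have Qa : Q s a = sg * h s by rewrite /Q /ord_q ga.1 mulr0 add0r.
have Qb : Q s b = sg * h s by rewrite /Q /ord_q gb.1 mulr0 add0r.
have bb : a <= b <= b by rewrite lexx (ltW ab).
have [Pb' Qb'] := fl _ bb; rewrite Qa in Pb' Qb'.
have u0 : 0 < om s * (b - a) by rewrite mulr_gt0// subr_gt0.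
have [|du pE pE'] := arc_return (h0 s) u0 (etrans (esym Qb') Qb).
  move=> t /andP[t0 tu]; have o0 := om0 s.
  have tab : a < a + t / om s < b.
    by rewrite ltrDl divr_gt0//= -ltrBrDl ltr_pdivrMr// mulrC.
  have tab' : a <= a + t / om s <= b by move/andP: tab => [? ?]; rewrite !ltW.
  have tE : om s * (a + t / om s - a) = t.
    by rewrite addrAC subrr add0r mulrC divfK// lt0r_neq0.
  have [_] := fl _ tab'; rewrite Qa tE => <-.
  by rewrite /Q /ord_q ltrDr; exact: pos.
split => //.
  by rewrite -Pb' in pE'; rewrite /V sgs_ns mulNr; move: pE'; rewrite /P /ord_p; lra.
move=> t tab; have [Pt Qt] := fl t tab; rewrite Qa in Pt Qt.
by apply: arc_pointE; [exact: orbit_x|exact: Pt|exact: Qt].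
Qed.

Lemma gate_inv s t t' : g t' = g t -> gate s (g t) -> gate s (g t').
Proof. by move=> ->. Qed.

Lemma some_gate s : exists t, gate s (g t).
Proof.
have [t g0] : exists t, exists s', gate s' (g t).
  have [t zt] := side_left above; have [t' zt'] := side_left below.
  have [z0|z0|z0] := ltgtP (zc (g t)) 0; last by exists t; exact: gates.
    have zt0 : 0 < sgs below * zc (g t) by rewrite mulN1r oppr_gt0.
    have [a [b [[_ ga _ _] _]]] := arc_through zt0; by exists a, below.
  by move: zt; rewrite mul1r leNgt z0.
move: g0 => [s' gs']; have [sE|sE] := side_cases s s'.
  by exists t; rewrite -sE.
have [b [_ _ gb _]] := next_arc gs'.
by exists b; rewrite sE nsK in gb.
Qed.

(** Gates of one type form, in one period, a compact set: the strict inequality in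
    their definition may be replaced by a non-strict one, as transversality separates
    both types. *)
Lemma extremal_gate (nu : R) s : exists2 t0, gate s (g t0) &
  forall t, gate s (g t) -> nu * V s t <= nu * V s t0.
Proof.
pose m := - (sgs above * (dl above + k above * (sg * h above))).
have gE t : gate s (g t) <-> zc (g t) = 0 /\ 0 <= V s t - sgs s * m.
  have tr s' : gate s' (g t) -> 0 < V s' t - sgs s' * m.
    move=> [_ yr]; have := transv above yr; rewrite mulrDr /m /V.
    by rewrite mulrN opprK.
  split=> [gt|[zt Vt]]; first by split; [exact: gt.1|exact/ltW/tr].
  have [s' gs'] := gates zt; have [<-//|sE] := side_cases s s'.
  have := tr _ gs'; rewrite sE /V sgs_ns !mulNr opprK; rewrite /V in Vt; lra.
have cV s' x : {for x, continuous (V s')}.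
  by apply: cvgM; [exact: cvg_cst|apply: cvgD; [exact: cx|exact: cy]].
pose K := `[0, T]%classic `&` ([set t | zc (g t) = 0] `&` [set t | 0 <= V s t - sgs s * m]).
have cK : compact K.
  apply: compact_closedI; first exact: segment_compact.
  apply: closedI.
    have -> : [set t | zc (g t) = 0] = (fun t => zc (g t)) @^-1` [set 0] by [].
    by apply: closed_comp; [move=> x _; exact: cz|exact: closed_eq].
  have -> : [set t | 0 <= V s t - sgs s * m] = (fun t => V s t - sgs s * m) @^-1` [set x | 0 <= x] by [].
  apply: closed_comp; [move=> x _|exact: closed_ge].
  by apply: cvgB; [exact: cV|exact: cvg_cst].
have inK t : gate s (g t) -> exists2 t', K t' & g t' = g t.
  move=> gt; have [t' t'T E] := shift_into 0 t; exists t' => //.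
  split; first by rewrite add0r in t'T; rewrite /= in_itv.
  by have := (gE t').1 (gate_inv E gt).
have K0 : K !=set0 by have [t /inK[t' Kt' _]] := some_gate s; exists t'.
have cf : {within K, continuous (fun t => nu * V s t)}.
  by apply: continuous_subspaceT => x; apply: cvgM; [exact: cvg_cst|exact: cV].
have [t0 Kt0 H] := compact_EVT_max K0 cK cf.
exists t0; first by apply/gE; rewrite inE in Kt0; exact: Kt0.2.
move=> t /inK[t' Kt' E]; have := H t'; rewrite inE => /(_ Kt').
by rewrite /V E.
Qed.

(** The return maps of the half-spaces are increasing, because A(t, k) and A(t, -k)
    both increase with t. *)
Lemma half_return_mono s a0 a1 b0 b1 (nu : R) : nu = 1 \/ nu = -1 ->
  half_return s a0 a1 -> half_return s b0 b1 ->
  (nu * a0 <= nu * b0) = (nu * a1 <= nu * b1).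
Proof.
move=> nu1 [u [du E0 E1]] [w [dw F0 F1]].
have nk : `|- k s| < 1 by rewrite normrN.
have A0 : (a0 <= b0) = (u <= w).
  by rewrite -(lerD2r (dl s)) E0 F0 ler_pM2l// (Af_le nk).
have A1 : (a1 <= b1) = (u <= w).
  by rewrite E1 F1 lerD2r ler_pM2l// (Af_le (k1 s)).
have B0 : (b0 <= a0) = (w <= u).
  by rewrite -(lerD2r (dl s)) E0 F0 ler_pM2l// (Af_le nk).
have B1 : (b1 <= a1) = (w <= u).
  by rewrite E1 F1 lerD2r ler_pM2l// (Af_le (k1 s)).
by case: nu1 => ->; rewrite ?mul1r ?mulN1r ?lerN2 ?A0 ?A1 ?B0 ?B1.
Qed.

Lemma arc_half_return s a b : arc s a b -> half_return s (V s a) (V (ns s) b).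
Proof. by move=> /arc_value[d E0 E1 _]; exists (om s * (b - a)). Qed.

(** The arc issued from the extremal gate of side s ends at some gate, and the arc
    which ends at the extremal gate of the other side starts at some gate; by
    monotony of the return map both end points agree. The sign nu selects maxima or
    minima. *)
Lemma extremal_return (nu : R) s t0 t1 : nu = 1 \/ nu = -1 ->
  gate s (g t0) -> (forall t, gate s (g t) -> nu * V s t <= nu * V s t0) ->
  gate (ns s) (g t1) -> (forall t, gate (ns s) (g t) -> nu * V (ns s) t <= nu * V (ns s) t1) ->
  half_return s (V s t0) (V (ns s) t1).
Proof.
move=> nu1 g0 H0 g1 H1.
have [b ab] := next_arc g0; have [a aa] := prev_arc g1.
have rb := arc_half_return ab; have ra := arc_half_return aa.
have [_ _ gb _] := ab; have [_ ga _ _] := aa.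
have E : nu * V (ns s) t1 = nu * V (ns s) b.
  apply/le_anti/andP; split; last exact: H1.
  by rewrite -(half_return_mono nu1 ra rb); exact: H0.
suff -> : V (ns s) t1 = V (ns s) b by [].
by case: nu1 E => ->; rewrite ?mul1r ?mulN1r => // /oppr_inj.
Qed.

Hypothesis uniq : forall w : side -> R, (forall s, `|w s - yv s| < r) ->
  (forall s, half_return s (w s) (w (ns s))) -> forall s, w s = yv s.

(** The maximal crossing values on both sides close up in a single turn, whatever the
    number of turns of the orbit; so do the minimal ones. Uniqueness of the closing
    values gives maximum = minimum. *)
Lemma gate_value s t : gate s (g t) -> V s t = yv s.
Proof.
have ext (nu : R) : nu = 1 \/ nu = -1 -> forall s t, gate s (g t) -> nu * V s t <= nu * yv s.
  move=> nu1.
  have [ta ga Ha] := extremal_gate nu above; have [tb gb Hb] := extremal_gate nu below.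
  pose w s := if s is above then V above ta else V below tb.
  have wE : forall s, w s = yv s.
    apply: uniq; first by case; [exact: ga.2|exact: gb.2].
    by case; [exact: (extremal_return nu1 ga Ha gb Hb)|exact: (@extremal_return nu below _ _ nu1 gb Hb ga Ha)].
  move=> s' t' gt; rewrite -wE; case: s' gt => gt; [exact: Ha|exact: Hb].
move=> gt; apply/eqP; rewrite eq_le; apply/andP; split.
  by have := ext 1 (or_introl erefl) s t gt; rewrite !mul1r.
by have := ext (-1) (or_intror erefl) s t gt; rewrite !mulN1r lerN2.
Qed.

Hypothesis dth : forall s, domt i (th s).
Hypothesis yvE : forall s, yv s + dl s = h s * Af i (th s) (- k s).

Lemma range_cycle : range g = cycle_set yv th.
Proof.
have arcth s a b : arc s a b -> om s * (b - a) = th s /\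
    forall t, a <= t <= b -> g t = arc_point s (yv s) (om s * (t - a)).
  move=> ab; have [du E0 _ H] := arc_value ab; have [_ ga _ _] := ab.
  rewrite (gate_value ga) in E0 H; split => //.
  have nk : `|- k s| < 1 by rewrite normrN.
  have : Af i (om s * (b - a)) (- k s) = Af i (th s) (- k s).
    by apply: (mulfI (lt0r_neq0 (h0 s))); rewrite -E0.
  move=> AE; apply: le_anti.
  by rewrite -(Af_le nk du (dth s)) -(Af_le nk (dth s) du) AE lexx.
apply/seteqP; split => [_ [t _ <-]|p [s [u [/andP[u0 ut] ->]]]].
  have onarc s a b : arc s a b -> a <= t <= b -> cycle_set yv th (g t).
    move=> ab tab; have [thE H] := arcth _ _ _ ab; exists s, (om s * (t - a)).
    have /andP[at_ tb] := tab; split; last exact: H.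
    rewrite -thE mulr_ge0 ?subr_ge0//=; last exact/ltW.
    by rewrite ler_pM2l// lerD2r.
  have [zt|zt|zt] := ltgtP (zc (g t)) 0.
  - have zt0 : 0 < sgs below * zc (g t) by rewrite mulN1r oppr_gt0.
    have [a [b [ab /andP[? ?]]]] := arc_through zt0.
    by apply: (onarc _ _ _ ab); rewrite !ltW.
  - have zt0 : 0 < sgs above * zc (g t) by rewrite mul1r.
    have [a [b [ab /andP[? ?]]]] := arc_through zt0.
    by apply: (onarc _ _ _ ab); rewrite !ltW.
  have [s gs] := gates zt; have [b ab] := next_arc gs.
  apply: (onarc _ _ _ ab); rewrite lexx/=; have [? _ _ _] := ab; exact: ltW.
have [a ga] := some_gate s; have [b ab] := next_arc ga.
have [thE H] := arcth _ _ _ ab; have o0 := om0 s.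
exists (a + u / om s) => //; rewrite H.
  by congr arc_point; rewrite addrAC subrr add0r mulrC divfK// lt0r_neq0.
rewrite lerDl divr_ge0//=; last exact: ltW.
by rewrite -lerBrDl ler_pdivrMr// mulrC thE.
Qed.

End orbits.
End normal_forms.

(** * Gluing two smooth pieces into a periodic primitive *)

Section gluing.
Context {R : realType}.
Notation mu := (@lebesgue_measure R).
Implicit Types (F V f v : R -> R).

Lemma ftc_smooth F V (a b : R) : a <= b -> (forall x : R, is_derive x 1 F (V x)) ->
  (forall x, {for x, continuous V}) -> Rintegral mu `[a, b] V = F b - F a.
Proof.
rewrite le_eqVlt => /predU1P[->|ab] dF cV.
  by rewrite set_itv1 Rintegral_set1 subrr.
have cF x : {for x, continuous F} by exact: der_cont (dF x).
rewrite /Rintegral (continuous_FTC2 ab (F := F))//.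
- exact: within_cont.
- split; first by move=> x _; have [] := dF x.
    by apply: cvg_at_right_filter; exact: cF.
  by apply: cvg_at_left_filter; exact: cF.
- by move=> x _; rewrite derive1E; have [_ ->] := dF x.
Qed.

Variables (T1 T2 : R).
Hypotheses (T10 : 0 < T1) (T20 : 0 < T2).
Let T := T1 + T2.
Let T0 : 0 < T. Proof. exact: addr_gt0. Qed.

Definition phase t := t - (Num.floor (t / T))%:~R * T.

(** F1 on [0, T1] followed by F2 on [0, T2], repeated with period T1 + T2. *)
Definition cyc (A : Type) (F1 F2 : R -> A) t :=
  if phase t <= T1 then F1 (phase t) else F2 (phase t - T1).

Lemma phaseE (m : int) u : 0 <= u < T -> phase (m%:~R * T + u) = u.
Proof.
move=> /andP[u0 uT]; rewrite /phase.
have -> : Num.floor ((m%:~R * T + u) / T) = m.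
  apply: floor_def.
  by rewrite intrD ler_pdivlMr// ltr_pdivrMr// mulrDl mul1r lerDl u0 ltrD2l.
by rewrite addrAC subrr add0r.
Qed.

Lemma phase_itv t : 0 <= phase t < T.
Proof.
have := floor_itv (t / T); rewrite /phase; set m := Num.floor _.
rewrite intrD ler_pdivlMr// ltr_pdivrMr// mulrDl mul1r => /andP[a b].
by rewrite subr_ge0 a/= ltrBlDl.
Qed.

Lemma phaseK t : (Num.floor (t / T))%:~R * T + phase t = t.
Proof. by rewrite /phase addrC subrK. Qed.

Lemma phase_period t : phase (t + T) = phase t.
Proof.
rewrite -[in LHS](phaseK t) addrAC -[X in _ + X + _]mul1r -mulrDl -(intrD _ _ 1).
exact/phaseE/phase_itv.
Qed.

Lemma cyc_period (A : Type) (F1 F2 : R -> A) t : cyc F1 F2 (t + T) = cyc F1 F2 t.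
Proof. by rewrite /cyc phase_period. Qed.

Lemma cyc1 (A : Type) (F1 F2 : R -> A) (m : int) u : 0 <= u <= T1 ->
  cyc F1 F2 (m%:~R * T + u) = F1 u.
Proof.
move=> /andP[u0 u1]; rewrite /cyc phaseE ?u1// u0/=.
by apply: le_lt_trans u1 _; rewrite ltrDl.
Qed.

Lemma cyc2 (A : Type) (F1 F2 : R -> A) (m : int) u : 0 < u < T2 ->
  cyc F1 F2 (m%:~R * T + T1 + u) = F2 u.
Proof.
move=> /andP[u0 u2]; have uT : 0 <= T1 + u < T by rewrite addr_ge0 ?ltW//= ltrD2l.
by rewrite /cyc -addrA phaseE// addrAC subrr add0r leNgt ltrDl u0.
Qed.

Lemma measurable_phase : measurable_fun setT phase.
Proof.
have -> : phase = (fun t => t - (fun t => (Num.floor (t / T))%:~R * T) t) by [].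
apply: measurable_realfun.measurable_funB; first exact: measurable_id.
apply: measurable_realfun.nondecreasing_measurable => // x y xy.
rewrite ler_pM2r// ler_int; apply: le_floor.
by rewrite ler_pM2r ?invr_gt0.
Qed.

Section one_component.
Variables (F1 V1 F2 V2 : R -> R).
Hypothesis dF1 : forall x : R, is_derive x 1 F1 (V1 x).
Hypothesis dF2 : forall x : R, is_derive x 1 F2 (V2 x).
Hypothesis cV1 : forall x, {for x, continuous V1}.
Hypothesis cV2 : forall x, {for x, continuous V2}.
Hypothesis F12 : F1 T1 = F2 0.
Hypothesis F21 : F2 T2 = F1 0.
Let f := cyc F1 F2.
Let v := cyc V1 V2.

Let locv : locally_integrable setT v.
Proof.
have mv : measurable_fun setT v.
  have mV V : (forall x, {for x, continuous V}) -> measurable_fun setT V.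
    by move=> cV; apply: measurable_realfun.continuous_measurable_fun => x; exact: cV.
  apply: measurable_fun_ifT.
  - apply: measurable_realfun.measurable_fun_ler; first exact: measurable_phase.
    exact: measurable_cst.
  - exact: measurableT_comp (mV _ cV1) measurable_phase.
  - apply: measurableT_comp (mV _ cV2) _; apply: measurable_realfun.measurable_funB.
      exact: measurable_phase.
    exact: measurable_cst.
have [M1 _ b1] := bounded_itv (ltW T10) (fun y _ => @cV1 y).
have [M2 _ b2] := bounded_itv (ltW T20) (fun y _ => @cV2 y).
split => //; first exact: openT.
move=> K _ cK.
have mK : measurable K by apply: measurable_realfun.closed_measurable; exact: compact_closed cK.
have : mu.-integrable K (EFin \o v).
  apply: measurable_bounded_integrable => //.
  - exact: compact_finite_measure.
  - exact: measurable_funTS.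
  exists (Num.max M1 M2); split; first exact: num_real.
  move=> M MM t _ /=; apply/ltW/(le_lt_trans _ MM).
  have /andP[p0 pT] := phase_itv t.
  rewrite le_max /v /cyc; have [pl|pl] := leP (phase t) T1.
    by rewrite b1// p0.
  by rewrite b2 ?orbT// subr_ge0 (ltW pl)/= lerBlDl ltW.
by move=> /integrableP[].
Qed.

Let good a b := forall a' b', a <= a' -> a' <= b' -> b' <= b ->
  f b' - f a' = Rintegral mu `[a', b'] v.

Let good_cat a b c : a <= b -> b <= c -> good a b -> good b c -> good a c.
Proof.
move=> ab bc g1 g2 x y ax xy yc.
have [yb|by'] := leP y b; first exact: g1.
have [bx|xb] := leP b x; first exact: g2.
have iv := locint_itv x y locv.
have -> : f y - f x = (f b - f x) + (f y - f b) by ring.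
rewrite (g1 x b)// ?(ltW xb)// (g2 b y)// ?(ltW by')//.
have H := @Rintegral_itvB _ v (BLeft x) (BRight y) b iv.
rewrite !bnd_simp (ltW xb) (ltW by') in H; have {}H := H isT isT.
rewrite -(Rintegral_itv_obnd_cbnd (r := b)) -?H.
  by rewrite addrC subrK.
apply: integrableS iv => //; apply: subset_itvr; rewrite bnd_simp; exact: ltW.
Qed.

Let good_piece (G W : R -> R) (a l : R) : (forall x : R, is_derive x 1 G (W x)) ->
  (forall x, {for x, continuous W}) ->
  (forall u, 0 <= u <= l -> f (a + u) = G u) ->
  (forall u, 0 < u < l -> v (a + u) = W u) -> good a (a + l).
Proof.
move=> dG cW fG vW x y ax xy yl.
have E t : t = a + (t - a) by rewrite addrC subrK.
have dGa (t : R) : is_derive t 1 (fun t => G (t - a)) (W (t - a)).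
  by have H := dG (t - a); deriv; ring.
have cWa (t : R) : {for t, continuous (fun t => W (t - a))}.
  apply: continuous_comp; last exact: cW.
  by apply: cvgB; [exact: cvg_id|exact: cvg_cst].
rewrite (E x) (E y) !fG; last 2 first.
- by rewrite subr_ge0 ax lerBlDl (le_trans xy yl).
- by rewrite subr_ge0 (le_trans ax xy) lerBlDl.
rewrite -!E -(ftc_smooth xy dGa cWa); apply/esym.
apply: ae_eq_Rint; first exact: locint_itv.
  apply: continuous_compact_integrable; first exact: segment_compact.
  by apply: continuous_subspaceT => t; exact: cWa.
apply: aeW => t /andP[xt ty]; rewrite {1}(E t) vW// subr_gt0 (le_lt_trans ax xt)/=.
by rewrite ltrBlDl (lt_le_trans ty).
Qed.

(** The integral identity holds on each piece by the fundamental theorem, and is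
    additive over adjacent intervals. *)
Lemma cyc_primitive : primitive f v.
Proof.
split; first exact: locv.
have cell (m : int) : good (m%:~R * T) (m%:~R * T + T).
  have l1 : m%:~R * T <= m%:~R * T + T1 by rewrite lerDl ltW.
  have l2 : m%:~R * T + T1 <= m%:~R * T + T by rewrite lerD2l lerDl ltW.
  apply: (good_cat l1 l2).
    apply: (good_piece dF1 cV1) => u uu; first exact: cyc1.
    by apply: cyc1; move/andP: uu => [? ?]; rewrite !ltW.
  rewrite /T addrA; apply: (good_piece dF2 cV2) => u; last exact: cyc2.
  move=> /andP[]; rewrite le_eqVlt => /predU1P[<- _|u0].
    by rewrite addr0 -F12; apply: cyc1; rewrite lexx ltW.
  rewrite le_eqVlt => /predU1P[->|u2]; last by apply: cyc2; rewrite u0.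
  have -> : m%:~R * (T1 + T2) + T1 + T2 = (m + 1)%:~R * T + 0.
    by rewrite intrD /T; ring.
  rewrite F21.
  by apply: cyc1; rewrite lexx ltW.
have cells (m : int) (n : nat) : good (m%:~R * T) (m%:~R * T + n.+1%:R * T).
  elim: n => [|n IH]; first by rewrite mul1r; exact: cell.
  have l1 : m%:~R * T <= m%:~R * T + n.+1%:R * T by rewrite lerDl mulr_ge0// ltW.
  have l2 : m%:~R * T + n.+1%:R * T <= m%:~R * T + n.+2%:R * T.
    by rewrite lerD2l ler_pM2r// ler_nat.
  apply: (good_cat l1 l2 IH).
  have -> : n.+2%:R * T = n.+1%:R * T + T by rewrite -[n.+2%:R]natr1 mulrDl mul1r.
  by rewrite addrA -mulrDl -[n.+1%:R]/(n.+1%:~R) -intrD; exact: cell.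
move=> a b ab.
have /andP[m1 m2] := phase_itv a; have aE := phaseK a.
pose n := Num.truncn ((b - a) / T + 1).
have ba : 0 <= (b - a) / T + 1 by rewrite addr_ge0// divr_ge0 ?subr_ge0// ltW.
have n1 : (b - a) / T + 1 < n.+1%:R.
  by have /andP[_] := truncn_itv ba.
apply: (cells (Num.floor (a / T)) n) => //; first by rewrite -[X in _ <= X]aE lerDl.
have : b - a + T <= n.+1%:R * T.
  by rewrite -ler_pdivrMr// mulrDl divff ?lt0r_neq0// ltW.
by move: aE m2; set x := _ * T; set y := _ * T; lra.
Qed.

End one_component.
End gluing.

(** * Construction of the cycle *)

Lemma der_affine (R : realType) (f : R -> R) (x d a b c : R) :
  is_derive x 1 f d -> is_derive x 1 (fun t => a * (f t - b) - c) (a * d).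
Proof. by move=> H; deriv; ring. Qed.

Section cycles.
Context {R : realType}.
Implicit Types (s : side) (p : 'rV[R]_3).
Variables (i : family) (e : R) (om h dl k : side -> R).
Local Notation sg := (sgf i).
Local Notation apt := (arc_point i e h dl k).
Local Notation cset := (cycle_set i e h dl k).
Variable Z : side -> 'rV[R]_3 -> 'rV[R]_3.
Hypothesis nfZ : normal_form i e om h dl k Z.
Hypothesis om0 : forall s, 0 < om s.
Hypothesis h0 : forall s, 0 < h s.
Hypothesis k1 : forall s, `|k s| < 1.
Variables (yv th : side -> R).
Hypothesis dth : forall s, domt i (th s).
Hypothesis entry : forall s, yv s + dl s = h s * Af i (th s) (- k s).
Hypothesis exit : forall s, yv (ns s) = h s * Af i (th s) (k s) + dl s.

(** For s' = s this is [Af_transversal] at the start of the arc of side s; otherwise it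
    is [Af_transversal] at the end of the preceding arc, on side s'. *)
Lemma cycle_transversal s s' :
  0 < sgs s * (sgs s * yv s + sgs s' * (dl s' + k s' * (sg * h s'))).
Proof.
rewrite mulrDr sgsK; have [->|sE] := side_cases s s'.
  rewrite sgsK addrA entry.
  have nk : `|- k s| < 1 by rewrite normrN.
  have := Af_transversal nk (dth s); have h0s := h0 s => H.
  have -> : h s * Af i (th s) (- k s) + k s * (sg * h s) =
     h s * (Af i (th s) (- k s) - sg * - k s) by ring.
  by rewrite mulr_gt0// subr_gt0.
have {1}-> : s = ns s' by rewrite sE nsK.
have -> : sgs s = - sgs s' :> R by rewrite sE sgs_ns opprK.
rewrite mulNr sgsK exit; have H := Af_transversal (k1 s') (dth s').
have -> : h s' * Af i (th s') (k s') + dl s' - (dl s' + k s' * (sg * h s')) =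
   h s' * (Af i (th s') (k s') - sg * k s') by ring.
by rewrite mulr_gt0// subr_gt0.
Qed.

Lemma xc_arc s v u : xc (apt s v u) = e. Proof. exact: xc_vec3. Qed.
Lemma zc_arc s v u :
  sgs s * zc (apt s v u) = arcQ i (k s) (v + dl s) (sg * h s) u - sg * h s.
Proof. by rewrite zc_vec3 sgsK. Qed.
Lemma ord_p_arc s v u : ord_p dl s (apt s v u) = arcP i (k s) (v + dl s) (sg * h s) u.
Proof. by rewrite /ord_p xc_vec3 yc_vec3 (addrC e) subrK sgsK subrK. Qed.
Lemma ord_q_arc s v u : ord_q i h s (apt s v u) = arcQ i (k s) (v + dl s) (sg * h s) u.
Proof. by rewrite /ord_q zc_arc subrK. Qed.

Lemma arc0E s v : apt s v 0 = vec3 e (sgs s * v - e) 0.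
Proof. by rewrite /arc_point arcP0 arcQ0 addrK subrr mulr0. Qed.

Lemma arc_thE s : apt s (yv s) (th s) = apt (ns s) (yv (ns s)) 0.
Proof.
have [Q1 P1] := arc_at_return (k s) (h s) (dth s).
rewrite arc0E /arc_point entry Q1 P1 subrr mulr0 exit sgs_ns.
by congr vec3; congr (_ - _); rewrite mulNr -mulrN opprD.
Qed.

Lemma arc_side s u : 0 < u < th s -> 0 < sgs s * zc (apt s (yv s) u).
Proof.
by move=> uu; rewrite zc_arc subr_gt0 entry; apply: arc_above.
Qed.

Lemma arc_side0 s u : 0 <= u <= th s -> 0 <= sgs s * zc (apt s (yv s) u).
Proof.
move=> /andP[]; rewrite le_eqVlt => /predU1P[<- _|u0].
  by rewrite arc0E zc_vec3 mulr0.
rewrite le_eqVlt => /predU1P[->|ut]; first by rewrite arc_thE arc0E zc_vec3 mulr0.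
by apply/ltW/arc_side; rewrite u0.
Qed.

Let Ts s := th s / om s.
Let Ts0 s : 0 < Ts s. Proof. by rewrite divr_gt0// (domt_gt0 (dth s)). Qed.
Let G s t := apt s (yv s) (om s * t).
Let g := cyc (Ts above) (Ts below) (G above) (G below).
Let T := Ts above + Ts below.

Let omTs s : om s * Ts s = th s.
Proof. by rewrite /Ts mulrC divfK// lt0r_neq0. Qed.

Let GT s : G s (Ts s) = G (ns s) 0.
Proof. by rewrite /G omTs mulr0 arc_thE. Qed.

Let om_itv s t : 0 <= t <= Ts s -> 0 <= om s * t <= th s.
Proof.
move=> /andP[t0 tT]; have o0 := om0 s.
by rewrite (mulr_ge0 (ltW o0) t0)/= -(omTs s) ler_pM2l.
Qed.

Let om_itvo s t : 0 < t < Ts s -> 0 < om s * t < th s.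
Proof. by move=> /andP[t0 tT]; rewrite mulr_gt0//= -(omTs s) ltr_pM2l. Qed.

Let g_piece t : exists s u, [/\ 0 <= u <= Ts s, g t = G s u &
  cyc (Ts above) (Ts below) (fun t => Z above (G above t)) (fun t => Z below (G below t)) t
    = Z s (G s u)].
Proof.
have /andP[p0 pT] := phase_itv (Ts0 above) (Ts0 below) t.
have [pl|pl] := leP (phase (Ts above) (Ts below) t) (Ts above).
  by exists above, (phase (Ts above) (Ts below) t); rewrite /g /cyc pl p0.
exists below, (phase (Ts above) (Ts below) t - Ts above).
have pl' : phase (Ts above) (Ts below) t <= Ts above = false by apply/negbTE; rewrite -ltNge.
by rewrite /g /cyc pl' subr_ge0 (ltW pl)/= lerBlDl (ltW pT).
Qed.

Let g_solution : solution Z g.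
Proof.
pose F (c : 'rV[R]_3 -> R) s (t : R) := c (G s t).
pose V (c : 'rV[R]_3 -> R) s (t : R) := c (Z s (G s t)).
pose v := cyc (Ts above) (Ts below) (fun t => Z above (G above t)) (fun t => Z below (G below t)).
have prim (c : 'rV[R]_3 -> R) :
    (forall s (t : R), is_derive t 1 (F c s) (V c s t)) ->
    (forall s (t : R), {for t, continuous (V c s)}) ->
    primitive (fun t => c (g t)) (fun t => c (v t)).
  move=> dF cV.
  have -> : (fun t => c (g t)) = cyc (Ts above) (Ts below) (F c above) (F c below).
    by apply/funext => t; rewrite /g /cyc; case: ifP.
  have -> : (fun t => c (v t)) = cyc (Ts above) (Ts below) (V c above) (V c below).
    by apply/funext => t; rewrite /v /cyc; case: ifP.
  apply: cyc_primitive => //.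
  - by rewrite /F GT.
  - by rewrite /F GT.
have cP s (t : R) : {for t, continuous (fun t => arcP i (k s) (yv s + dl s) (sg * h s) (om s * t))}.
  exact: der_cont (der_arcP _ _ _ _ _ _).
have cQ s (t : R) : {for t, continuous (fun t => arcQ i (k s) (yv s + dl s) (sg * h s) (om s * t))}.
  exact: der_cont (der_arcQ _ _ _ _ _ _).
have VxE s : V xc s = fun=> 0.
  by apply/funext => t; rewrite /V (nfZ _ _).1 xc_arc subrr.
have VyE s : V yc s = fun t => sgs s * (om s *
    (k s * arcP i (k s) (yv s + dl s) (sg * h s) (om s * t) -
     sg * arcQ i (k s) (yv s + dl s) (sg * h s) (om s * t))).
  apply/funext => t; rewrite /V ((nfZ _ _).2 _).1; last exact: xc_arc.
  by rewrite ord_p_arc ord_q_arc.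
have VzE s : V zc s = fun t => sgs s * (om s *
    (arcP i (k s) (yv s + dl s) (sg * h s) (om s * t) +
     k s * arcQ i (k s) (yv s + dl s) (sg * h s) (om s * t))).
  apply/funext => t; rewrite /V ((nfZ _ _).2 _).2; last exact: xc_arc.
  by rewrite ord_p_arc ord_q_arc.
have px : primitive (fun t => xc (g t)) (fun t => xc (v t)).
  apply: prim => s t.
    rewrite VxE (_ : F xc s = fun=> e); first exact: der_cst.
    by apply/funext => u; exact: xc_arc.
  by rewrite VxE; exact: cvg_cst.
have py : primitive (fun t => yc (g t)) (fun t => yc (v t)).
  apply: prim => s t.
    have H := der_arcP i (k s) (yv s + dl s) (sg * h s) (om s) t.
    rewrite VyE (_ : F yc s = fun t => sgs s * (arcP i (k s) (yv s + dl s) (sg * h s) (om s * t)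
      - dl s) - e); last by apply/funext => u; exact: yc_vec3.
    exact: (der_eq (der_affine _ _ _ H)).
  rewrite VyE; do 2 (apply: cvgM; first exact: cvg_cst).
  by apply: cvgB; (apply: cvgM; first exact: cvg_cst); [exact: cP|exact: cQ].
have pz : primitive (fun t => zc (g t)) (fun t => zc (v t)).
  apply: prim => s t.
    have H := der_arcQ i (k s) (yv s + dl s) (sg * h s) (om s) t.
    rewrite VzE (_ : F zc s = fun t => sgs s * (arcQ i (k s) (yv s + dl s) (sg * h s) (om s * t)
      - sg * h s) - 0); last by apply/funext => u; rewrite subr0; exact: zc_vec3.
    exact: (der_eq (der_affine _ _ _ H)).
  rewrite VzE; do 2 (apply: cvgM; first exact: cvg_cst).
  by apply: cvgD; [exact: cP|apply: cvgM; [exact: cvg_cst|exact: cQ]].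
have jE (j : 'I_3) : [\/ j = 0, j = 1 | j = 2].
  case: j => -[|[|[|//]]] j3.
  - by apply: Or31; exact: val_inj.
  - by apply: Or32; exact: val_inj.
  - by apply: Or33; exact: val_inj.
exists v; split.
- by move=> j; case: (jE j) => ->; [have [] := px|have [] := py|have [] := pz].
- by move=> j a b ab; case: (jE j) => ->;
    [have [_ H] := px|have [_ H] := py|have [_ H] := pz]; exact: H.
apply: aeW => t; have [s [u [uu gE]]] := g_piece t; rewrite -/v => ->.
have side0 : 0 <= sgs s * zc (g t) by rewrite gE; apply/arc_side0/om_itv.
rewrite -gE; case: s side0 {uu gE} => /= [|] side0; split => // zt.
- by rewrite mul1r leNgt zt in side0.
- by exists 1; rewrite ?ler01 ?lexx// subrr scale0r addr0 scale1r.
- by rewrite mulN1r oppr_ge0 leNgt zt in side0.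
- by exists 0; rewrite ?ler01 ?lexx// subr0 scale0r add0r scale1r.
Qed.

Let g_range : range g = cset yv th.
Proof.
apply/seteqP; split=> [_ [t _ <-]|p [s [u [/andP[u0 ut] ->]]]].
  have [s [u [uu gE _]]] := g_piece t.
  by exists s, (om s * u); split; [exact: om_itv|exact: gE].
have t0 : 0 <= u / om s by rewrite divr_ge0// ltW.
have tT : u / om s <= Ts s by rewrite ler_pM2r ?invr_gt0.
have -> : apt s (yv s) u = G s (u / om s).
  by rewrite /G mulrC divfK// lt0r_neq0.
move: (u / om s) t0 tT => {u u0 ut} t t0 tT.
have ga u : 0 <= u <= Ts above -> range g (G above u).
  move=> uu; exists ((0 : int)%:~R * T + u) => //; exact: (cyc1 (Ts0 above) (Ts0 below)).
case: s t0 tT => t0 tT; first by apply: ga; rewrite t0.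
move: t0; rewrite le_eqVlt => /predU1P[<-|t0].
  by rewrite -[below]/(ns above) -GT; apply: ga; rewrite lexx ltW.
move: tT; rewrite le_eqVlt => /predU1P[->|tT].
  by rewrite GT; apply: ga; rewrite lexx ltW.
exists ((0 : int)%:~R * T + Ts above + t) => //.
by apply: (cyc2 (Ts0 above) (Ts0 below)); rewrite t0.
Qed.

Let g1 u : 0 <= u <= Ts above -> g u = G above u.
Proof.
move=> uu; have := cyc1 (Ts0 above) (Ts0 below) (G above) (G below) 0 uu.
by rewrite mul0r add0r.
Qed.

Let g2 u : 0 < u < Ts below -> g (Ts above + u) = G below u.
Proof.
move=> uu; have := cyc2 (Ts0 above) (Ts0 below) (G above) (G below) 0 uu.
by rewrite mul0r add0r.
Qed.

Let gz1 u : 0 < u < Ts above -> 0 < zc (g u).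
Proof.
move=> uu; have := arc_side (om_itvo uu); rewrite mul1r g1//.
by move/andP: uu => [? ?]; rewrite !ltW.
Qed.

Let g_periodic : periodic_solution Z g T.
Proof.
split; [exact: g_solution|exact: addr_gt0|exact: (cyc_period (Ts0 above) (Ts0 below))|].
exists (Ts above / 2) => E.
have := gz1 (u := Ts above / 2); rewrite E (g1 (u := 0)); last first.
  by rewrite lexx ltW.
have T0 := Ts0 above.
rewrite /G mulr0 arc0E zc_vec3 ltxx divr_gt0//= ltr_pdivrMr//.
suff -> : Ts above < Ts above * 2 by move=> /(_ isT).
lra.
Qed.

Lemma cycle_periodic_orbit : periodic_orbit Z (cset yv th).
Proof. by exists g, T; rewrite g_range. Qed.

Lemma cycle_crossing : crossing_periodic_orbit Z (cset yv th).
Proof.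
have cross s : crossing_point Z (G s 0).
  rewrite /G mulr0; split; first by rewrite arc0E zc_vec3.
  have zE s' : sgs s * zc (Z s' (apt s (yv s) 0)) =
      om s' * (sgs s * (sgs s * yv s + sgs s' * (dl s' + k s' * (sg * h s')))).
    rewrite ((nfZ _ _).2 (xc_arc _ _ _)).2 /ord_p /ord_q arc0E xc_vec3 yc_vec3 zc_vec3.
    rewrite (addrC e) subrK mulr0 add0r.
    transitivity (om s' * (sgs s * ((sgs s' * sgs s') * (sgs s * yv s) +
       sgs s' * (dl s' + k s' * (sg * h s'))))); first by ring.
    by rewrite sgs2 mul1r.
  have pos s' : 0 < sgs s * zc (Z s' (apt s (yv s) 0)).
    by rewrite zE mulr_gt0//; exact: cycle_transversal.
  have := mulr_gt0 (pos above) (pos below).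
  by rewrite mulrACA sgs2 mul1r.
exists g, T, (Ts above); split.
- by rewrite g_range; split => //; exact: g_periodic.
- by rewrite Ts0 ltrDl Ts0.
- by move=> t; exact: gz1.
- move=> t /andP[t1 t2]; have uu : 0 < t - Ts above < Ts below.
    by rewrite subr_gt0 t1 ltrBlDl.
  have := arc_side (om_itvo uu); rewrite -/(G _ _) -g2// mulN1r oppr_gt0.
  by rewrite addrC subrK.
by rewrite !g1 ?lexx ?ltW// GT; split; exact: cross.
Qed.

End cycles.

(** * The cycle is a limit cycle *)

Section limit_cycles.
Context {R : realType}.
Implicit Types (s : side) (p : 'rV[R]_3).
Variables (i : family) (e : R) (om h dl k : side -> R).
Local Notation sg := (sgf i).
Local Notation apt := (arc_point i e h dl k).
Local Notation cset := (cycle_set i e h dl k).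
Variable Z : side -> 'rV[R]_3 -> 'rV[R]_3.
Hypothesis nfZ : normal_form i e om h dl k Z.
Hypothesis om0 : forall s, 0 < om s.
Hypothesis h0 : forall s, 0 < h s.
Hypothesis k1 : forall s, `|k s| < 1.
Hypothesis kn0 : forall s, k s != 0.
Variables (yv th : side -> R).
Hypothesis dth : forall s, domt i (th s).
Hypothesis entry : forall s, yv s + dl s = h s * Af i (th s) (- k s).
Hypothesis exit : forall s, yv (ns s) = h s * Af i (th s) (k s) + dl s.

Lemma coord_cont (j : 'I_3) : continuous (fun p : 'rV[R]_3 => p 0 j).
Proof. exact: coord_continuous. Qed.

(** The isolating neighbourhood U removes from space only the points of z = 0 that are
    far from the two crossing points of the cycle. *)
Lemma cycle_limit (r0 : R) : 0 < r0 ->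
  (forall w : side -> R, (forall s, `|w s - yv s| < r0) ->
    (forall s, half_return i h dl k s (w s) (w (ns s))) -> forall s, w s = yv s) ->
  limit_cycle Z (cset yv th).
Proof.
move=> r00 uniq; split.
  exact: (cycle_periodic_orbit nfZ om0 h0 k1 dth entry exit).
pose m s s' := sgs s * (sgs s * yv s + sgs s' * (dl s' + k s' * (sg * h s'))).
have m0 s s' : 0 < m s s' by exact: (cycle_transversal h0 k1 dth entry exit).
(* radius of the gates: within it both fields keep crossing in the same direction *)
have [r [rr0 r_pos rm]] : exists r, [/\ r <= r0, 0 < r & forall s s', r <= m s s'].
  exists (Num.min r0 (Num.min (Num.min (m above above) (m above below))
                              (Num.min (m below above) (m below below)))).
  split; first by rewrite ge_min lexx.
    by rewrite !lt_min r00 !m0.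
  by case; case; rewrite !ge_min lexx !orbT.
have transv s s' (y : R) : `|sgs s * y - yv s| < r ->
    0 < sgs s * (y + sgs s' * (dl s' + k s' * (sg * h s'))).
  rewrite ltr_norml => /andP[H _]; have := rm s s'; rewrite /m !mulrDr sgsK; lra.
pose U : set 'rV[R]_3 := [set p | zc p != 0 \/ exists s, `|sgs s * (xc p + yc p) - yv s| < r].
have Uarc s : U (apt s (yv s) 0).
  by right; exists s; rewrite arc0E xc_vec3 yc_vec3 (addrC e) subrK sgsK subrr normr0.
exists U; split.
- have -> : U = [set p | zc p != 0] `|` ([set p | `|sgs above * (xc p + yc p) - yv above| < r]
     `|` [set p | `|sgs below * (xc p + yc p) - yv below| < r]).
    apply/seteqP; split=> p.
      by move=> [z0|[[] H]]; [left|right; left|right; right].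
    by move=> [z0|[H|H]]; [left|right; exists above|right; exists below].
  have ball_open s : open [set p | `|sgs s * (xc p + yc p) - yv s| < r].
    have -> : [set p | `|sgs s * (xc p + yc p) - yv s| < r] =
       (fun p => `|sgs s * (xc p + yc p) - yv s|) @^-1` [set x | x < r] by [].
    apply: open_comp; last exact: open_lt.
    have cw : continuous (fun p : 'rV[R]_3 => sgs s * (xc p + yc p) - yv s).
      move=> p; have c0 := @coord_cont 0 p; have c1 := @coord_cont 1 p.
      have cs (c : R) : continuous_at p (fun=> c) by exact: cst_continuous.
      exact: (cvgB (cvgM (cs (sgs s)) (cvgD c0 c1)) (cs (yv s))).
    move=> p _; exact: (cvg_norm (cw p)).
  apply: openU; last by apply: openU; exact: ball_open.
  have -> : [set p | zc p != 0] = (@zc R) @^-1` [set x | x != 0] by [].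
  by apply: open_comp; [move=> p _; exact: coord_cont|exact: open_neq].
- move=> p [s [u [/andP[u0 ut] ->]]].
  move: u0; rewrite le_eqVlt => /predU1P[<-|u0]; first exact: Uarc.
  move: ut; rewrite le_eqVlt => /predU1P[->|ut].
    by rewrite (arc_thE e dth entry exit); exact: Uarc.
  left; have uu : 0 < u < th s by rewrite u0.
  have := arc_side e h0 k1 dth entry uu.
  by apply: contraTneq => ->; rewrite mulr0 ltxx.
move=> G' [g [T [[[v [lv iv fv]] T0 gT [t0 g_moves]] ->]]] gU.
have prim j : primitive (fun t => g t 0 j) (fun t => v t 0 j).
  by split; [exact: lv|move=> a b ab; exact: iv].
apply: (range_cycle nfZ om0 h0 k1 (prim 0) (prim 1) (prim 2) fv T0 gT kn0 _ transv _ _ dth entry).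
- by exists t0.
- move=> t zt; have : U (g t) by apply: gU; exists t.
  by move=> [|[s H]]; [rewrite zt eqxx|exists s].
- move=> w wr; apply: uniq => s; exact: lt_le_trans (wr s) rr0.
Qed.

(** The cycle meets z = 0 only at the starting points of its two arcs. *)
Lemma gate_points s v p : p = apt s v 0 -> cset yv th p ->
  exists s', p = apt s' (yv s') 0.
Proof.
move=> pE [s1 [u [/andP[u0 ut] E]]].
move: u0; rewrite le_eqVlt => /predU1P[u0|u0].
  by exists s1; rewrite E -u0.
move: ut; rewrite le_eqVlt => /predU1P[uE|ut].
  by exists (ns s1); rewrite E uE (arc_thE e dth entry exit).
have uu : 0 < u < th s1 by rewrite u0.
have := arc_side e h0 k1 dth entry uu.
by rewrite -E pE arc0E zc_vec3 mulr0 ltxx.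
Qed.

End limit_cycles.

(** * The perturbation and its cycles *)

Section perturbation.
Context {R : realType}.
Implicit Types (s : side) (p : 'rV[R]_3) (e : R).
Variables (i : family) (w D : R).
Local Notation sg := (sgf i).

Definition coef (l : seq R) (j : 'I_4) : R := nth 0 l j.

(** The constant -1 in the first component produces the invariant plane x = e. The other
    coefficients are obtained by writing the fields of [perturbed_normal_form] with
    the data [omf], [dlf], [hf], [kf] and solving for the terms in e; [nth] pads the
    lists with zeros. *)
Definition alpha0 s := coef [:: -1].
Definition beta0 s := coef
  (if s is above then [:: 0; 1; 1] else [:: 1 + w; -1 + w; -1; - (sg * w)]).
Definition kappa0 s := coef
  (if s is above then [:: sg; 0; 0; 1] else [:: sg; w + sg - D; w; -1]).

(** The data of the normal form on both sides. *)
Definition om_ e s := if s is above then 1 else omf w e.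
Definition h_ e s := if s is above then 1 else hf i w D e.
Definition dl_ e s := if s is above then 0 else dlf i w D e.
Definition k_ e s := if s is above then e else - kf w e.

Lemma perturbed_normal_form e : omf w e != 0 -> omf w e ^+ 2 + sg * e ^+ 2 != 0 ->
  normal_form i e (om_ e) (h_ e) (dl_ e) (k_ e) (perturbed i alpha0 beta0 kappa0 e).
Proof.
move=> o0 q0 s p.
have X0x : xc (X0 i s p) = xc p by case: (i) => /=; rewrite xc_vec3.
have X0y : yc (X0 i s p) = - sg * zc p - sgs s.
  by case: (i) => /=; rewrite yc_vec3 ?mulN1r ?opprK ?mul1r.
have X0z : zc (X0 i s p) = xc p + yc p by case: (i) => /=; rewrite zc_vec3.
have cE (j : 'I_3) : perturbed i alpha0 beta0 kappa0 e s p 0 j =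
    X0 i s p 0 j + e * X1 alpha0 beta0 kappa0 s p 0 j by rewrite !mxE.
have xE : xc (perturbed i alpha0 beta0 kappa0 e s p) = xc p + e * affine (alpha0 s) p.
  by rewrite /xc cE -!/(xc _) X0x xc_vec3.
have yE : yc (perturbed i alpha0 beta0 kappa0 e s p) =
    - sg * zc p - sgs s + e * affine (beta0 s) p.
  by rewrite /yc cE -!/(yc _) X0y yc_vec3.
have zE : zc (perturbed i alpha0 beta0 kappa0 e s p) =
    xc p + yc p + e * affine (kappa0 s) p.
  by rewrite /zc cE -!/(zc _) X0z zc_vec3.
split=> [|xe]; first by rewrite xE /affine /alpha0 /coef /=; ring.
rewrite yE zE /affine /ord_p /ord_q xe.
move: (yc p) (zc p) => y z {cE X0x X0y X0z xE yE zE}.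
case: s => /=.
  rewrite /beta0 /kappa0 /coef /=; split; have [->|->] := @sgf_pm R i; ring.
have o0' : 1 + w * e != 0 by [].
rewrite /beta0 /kappa0 /coef /= /hf /dlf /kf /omf.
move: q0; rewrite /omf.
have [->|->] := @sgf_pm R i => q0; split; field; rewrite ?o0' ?q0//.
  by move: q0; rewrite mul1r.
by move: q0; rewrite mul1r.
Qed.

Lemma cont_omf : {for 0, continuous (omf w)}.
Proof.
have [d dE] : exists d, is_derive (0 : R) 1 (omf w) d by rewrite /omf; eexists; der.
exact: der_cont dE.
Qed.

Lemma omf0 : omf w 0 = 1. Proof. by rewrite /omf mulr0 addr0. Qed.
Lemma dlf0 : dlf i w D 0 = 0. Proof. by rewrite /dlf expr0n /= !mul0r. Qed.
Lemma hf0 : hf i w D 0 = 1. Proof. by rewrite /hf !mul0r addr0 subr0. Qed.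
Lemma kf0 : kf w 0 = 0. Proof. by rewrite /kf mul0r. Qed.

Lemma cont_dlf : {for 0, continuous (dlf i w D)}.
Proof.
have q0 : (1 + w * 0) ^+ 2 + sg * 0 ^+ 2 != 0.
  by rewrite mulr0 addr0 expr0n /= mulr0 addr0 expr1n oner_eq0.
have [d dE] : exists d, is_derive (0 : R) 1 (dlf i w D) d.
  by rewrite /dlf /omf; eexists; der; exact: q0.
exact: der_cont dE.
Qed.

Lemma cont_kf : {for 0, continuous (kf w)}.
Proof.
have q0 : 1 + w * 0 != 0 by rewrite mulr0 addr0 oner_eq0.
have [d dE] : exists d, is_derive (0 : R) 1 (kf w) d.
  by rewrite /kf /omf; eexists; der; exact: q0.
exact: der_cont dE.
Qed.

Lemma cont_hf : {for 0, continuous (hf i w D)}.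
Proof.
have cid : {for 0, continuous (fun e : R => e)} by exact: cvg_id.
apply: cvgB; first by apply: cvgD; [exact: cvg_cst|exact: cid].
apply: cvgM; first by apply: cvgM; [exact: cid|exact: cont_dlf].
by apply: cvgV; [rewrite omf0 oner_eq0|exact: cont_omf].
Qed.

Lemma dnbhs_cvg (f : R -> R) : {for 0, continuous f} -> f e @[e --> (0 : R)^'] --> f 0.
Proof. by move=> cf; apply: cvg_trans cf; apply: cvg_app; exact: nbhs_dnbhs. Qed.

Definition small e := [/\ forall s, 0 < om_ e s, forall s, 0 < h_ e s,
  forall s, `|k_ e s| < 1 & omf w e ^+ 2 + sg * e ^+ 2 != 0].

Lemma small0 : small 0.
Proof.
split.
- by case; rewrite /om_ ?omf0.
- by case; rewrite /h_ ?hf0.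
- by case; rewrite /k_ ?kf0 ?oppr0 normr0.
by rewrite omf0 expr0n mulr0 addr0 expr1n oner_eq0.
Qed.

Lemma near_small : \forall e \near (0 : R)^', [/\ small e, e != 0 & forall s, k_ e s != 0].
Proof.
have H1 : \forall e \near (0 : R)^', 0 < hf i w D e.
  by have := dnbhs_cvg cont_hf; rewrite hf0 => /cvgr_gt; apply.
near=> e.
have [e0 e1 e2 _] : [/\ e != 0, `|w| * `|e| <= 1 / 2, 4 * `|e| <= 1 &
    1 * (2 * `|e|) <= 1 / 2] by near: e; exact: near0_params.
have h1 : 0 < hf i w D e by near: e.
have /andP[om1 _] := om_bound e1; have o0 : 0 < omf w e by lra.
have kb := kf_bound e1; have en := normr_ge0 e.
split=> //; first split.
- by case; rewrite /om_.
- by case; rewrite /h_.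
- by case; rewrite /k_ ?normrN; lra.
- by have := den_bound i e1 e2; apply: contraTneq => ->; lra.
by case => //; rewrite /k_ oppr_eq0 /kf mulf_neq0// invr_eq0 lt0r_neq0.
Unshelve. all: by end_near. Qed.

(** Angles of the two arcs, and crossing values at their starting points, for arcs of
    half-angle coordinates y above and y' below. *)
Definition th_ (y y' : R) s : R := if s is above then thf i y else thf i y'.
Definition yv_ e (y : R) s : R := if s is above then Af i (thf i y) (- e) else Af i (thf i y) e.

Definition cyc_set e y y' := cycle_set i e (h_ e) (dl_ e) (k_ e) (yv_ e y) (th_ y y').

Local Notation sys := (perturbed i alpha0 beta0 kappa0).

Definition matched e y y' := [/\ domy i y, domy i y' & closing i w D e (thf i y) (thf i y')].

Lemma matched_th e y y' : matched e y y' -> forall s, domt i (th_ y y' s).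
Proof. by move=> [d d' _]; case; [case: (thfP d)|case: (thfP d')]. Qed.

Lemma matched_entry e y y' : matched e y y' -> forall s,
  yv_ e y s + dl_ e s = h_ e s * Af i (th_ y y' s) (- k_ e s).
Proof.
move=> [_ _ [c1 c2]]; case; first by rewrite /= addr0 mul1r.
by rewrite /= c2 opprK subrK.
Qed.

Lemma matched_exit e y y' : matched e y y' -> forall s,
  yv_ e y (ns s) = h_ e s * Af i (th_ y y' s) (k_ e s) + dl_ e s.
Proof.
by move=> [_ _ [c1 c2]]; case; [rewrite /= addr0 mul1r|rewrite /= c1].
Qed.

Lemma matched0 y : domy i y -> matched 0 y y.
Proof.
by move=> d; split => //; split; rewrite hf0 dlf0 kf0 oppr0 mul1r ?addr0 ?subr0.
Qed.

Lemma small_nf e : small e -> normal_form i e (om_ e) (h_ e) (dl_ e) (k_ e) (sys e).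
Proof.
by move=> [om0 _ _ q0]; apply: perturbed_normal_form => //; exact: lt0r_neq0 (om0 below).
Qed.

Lemma cyc_set_crossing y : domy i y ->
  crossing_periodic_orbit (sys 0) (cyc_set 0 y y) /\ cyc_set 0 y y `<=` planeS.
Proof.
move=> d; have m := matched0 d; have [om0 h0 k1 _] := small0.
split; last by move=> _ [s [u [_ ->]]]; exact: xc_vec3.
exact: (cycle_crossing (small_nf small0) om0 h0 k1 (matched_th m) (matched_entry m) (matched_exit m)).
Qed.

Lemma thf_lt (p q : R) : domy i p -> domy i q -> p < q -> thf i p < thf i q.
Proof.
move=> dp dq pq.
have dd (y : R) : p <= y <= q -> domy i y by exact: domy_itv.
apply: (lt_of_der (df := fun y => 2 / (1 + sg * y ^+ 2)) pq).
- by apply: within_cont_in => y py; exact: der_cont (der_thf (dd y py)).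
- by move=> y /andP[py yq]; apply/der_thf/dd; rewrite !ltW.
- by move=> y /andP[py yq]; rewrite divr_gt0//; apply/domy_q/dd; rewrite !ltW.
Qed.

Lemma thf_le (p q : R) : domy i p -> domy i q -> (thf i p <= thf i q) = (p <= q).
Proof.
move=> dp dq; have [pq|qp|->] := ltgtP p q; last exact: lexx.
  exact/ltW/thf_lt.
by apply/negbTE; rewrite -ltNge; exact: thf_lt.
Qed.

(** By monotony of A in the angle, crossing values near those of a given arc come from
    arcs whose half-angle coordinate stays in a prescribed interval. *)
Lemma half_turn_near (k y eta c : R) : `|k| < 1 -> 0 < c -> 0 < eta ->
  domy i (y - eta) -> domy i (y + eta) ->
  forall z, `|z - y| < eta -> domy i z ->
  exists2 r, 0 < r & forall u, domy i u ->
    `|c * Af i (thf i u) k - c * Af i (thf i z) k| < r -> `|u - y| <= eta.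
Proof.
move=> k1 c0 eta0 dm dp z zy dz.
have [d1 d2 d3] : [/\ domt i (thf i (y - eta)), domt i (thf i (y + eta)) & domt i (thf i z)].
  by split; [case: (thfP dm)|case: (thfP dp)|case: (thfP dz)].
move: zy; rewrite ltr_distl => /andP[z1 z2].
have A1 : c * Af i (thf i (y - eta)) k < c * Af i (thf i z) k.
  by rewrite ltr_pM2l//; apply: Af_mono => //; rewrite (domt_gt0 d1) thf_lt.
have A2 : c * Af i (thf i z) k < c * Af i (thf i (y + eta)) k.
  by rewrite ltr_pM2l//; apply: Af_mono => //; rewrite (domt_gt0 d3) thf_lt.
exists (Num.min (c * Af i (thf i z) k - c * Af i (thf i (y - eta)) k)
         (c * Af i (thf i (y + eta)) k - c * Af i (thf i z) k)).
  by rewrite lt_min !subr_gt0 A1.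
move=> u du; have [d4 _ _] := thfP du.
rewrite lt_min !ltr_norml => /andP[/andP[B1 _] /andP[_ B2]].
rewrite ler_distl; apply/andP; split.
  rewrite -thf_le// -(Af_le k1 d1 d4) -(ler_pM2l c0); lra.
rewrite -thf_le// -(Af_le k1 d4 d2) -(ler_pM2l c0); lra.
Qed.

(** Uniqueness of the closing angles in a box becomes, through [half_turn_near],
    uniqueness of the closing crossing values, as [cycle_limit] asks for. *)
Lemma matched_limit_cycle e y y' eta x : small e -> (forall s, k_ e s != 0) ->
  matched e y y' -> 0 < eta -> domy i (x - eta) -> domy i (x + eta) ->
  `|y - x| < eta -> `|y' - x| < eta ->
  (forall u u', `|u - x| <= eta -> `|u' - x| <= eta ->
     closing i w D e (thf i u) (thf i u') -> u = y /\ u' = y') ->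
  limit_cycle (sys e) (cyc_set e y y').
Proof.
move=> se kn m eta0 dm dp yx y'x uniq; have [om0 h0 k1 _] := se.
have [dy dy' _] := m.
have nk s : `|- k_ e s| < 1 by rewrite normrN.
have [r1 r10 H1] := half_turn_near (nk above) (h0 above) eta0 dm dp yx dy.
have [r2 r20 H2] := half_turn_near (nk below) (h0 below) eta0 dm dp y'x dy'.
apply: (cycle_limit (small_nf se) om0 h0 k1 kn (matched_th m) (matched_entry m) (matched_exit m)
  (r0 := Num.min r1 r2)); first by rewrite lt_min r10.
move=> v vr hr.
have [u1 [du1 E1 F1]] := hr above; have [u2 [du2 E2 F2]] := hr below.
have [z1 dz1 zE1] := domt_thf du1; have [z2 dz2 zE2] := domt_thf du2.
subst u1 u2.
have z1x : `|z1 - x| <= eta.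
  apply: H1 => //; rewrite -E1 -(matched_entry m above).
  have := vr above; rewrite lt_min => /andP[H _].
  by rewrite (_ : _ - _ = v above - yv_ e y above)//; ring.
have z2x : `|z2 - x| <= eta.
  apply: H2 => //; rewrite -E2 -(matched_entry m below).
  have := vr below; rewrite lt_min => /andP[_ H].
  by rewrite (_ : _ - _ = v below - yv_ e y below)//; ring.
move: E1 F1 E2 F2; rewrite /= addr0 !mul1r addr0 opprK => E1 F1 E2 F2.
have [|zy zy'] := uniq z1 z2 z1x z2x.
  split; first by rewrite -E1 F2.
  by rewrite -F1 -E2 addrK.
by case; rewrite /= -zy.
Qed.

End perturbation.

(** * Branches of cycles and their limits *)

Section limits.
Context {R : realType}.
Implicit Types (s : side) (p : 'rV[R]_3) (e : R).

Section joint_limits.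
Variables (i : family) (T : Type) (F : set_system T).
Context {FF : Filter F}.
Implicit Types (f k P Q u : T -> R).
Local Notation sg := (sgf i).

Lemma cvg_comp_der f (a : R) (phi dphi : R -> R) : (forall x : R, is_derive x 1 phi (dphi x)) ->
  f x @[x --> F] --> a -> phi (f x) @[x --> F] --> phi a.
Proof. by move=> dphi_ fa; apply: continuous_cvg fa; exact: der_cont (dphi_ a). Qed.

Lemma cvg_arcP k P Q u (k0 P0 Q0 u0 : R) : k x @[x --> F] --> k0 -> P x @[x --> F] --> P0 ->
  Q x @[x --> F] --> Q0 -> u x @[x --> F] --> u0 ->
  arcP i (k x) (P x) (Q x) (u x) @[x --> F] --> arcP i k0 P0 Q0 u0.
Proof.
move=> ck cP cQ cu; have cC := cvg_comp_der (@der_Cf R i) cu.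
have cS := cvg_comp_der (@der_Sf R i) cu.
have cE : expR (k x * u x) @[x --> F] --> expR (k0 * u0).
  exact: (cvg_comp_der (@is_derive_expR R) (cvgM ck cu)).
exact: (cvgM cE (cvgB (cvgM cP cC) (cvgM (cvgM (cvg_cst sg) cQ) cS))).
Qed.

Lemma cvg_arcQ k P Q u (k0 P0 Q0 u0 : R) : k x @[x --> F] --> k0 -> P x @[x --> F] --> P0 ->
  Q x @[x --> F] --> Q0 -> u x @[x --> F] --> u0 ->
  arcQ i (k x) (P x) (Q x) (u x) @[x --> F] --> arcQ i k0 P0 Q0 u0.
Proof.
move=> ck cP cQ cu; have cC := cvg_comp_der (@der_Cf R i) cu.
have cS := cvg_comp_der (@der_Sf R i) cu.
have cE : expR (k x * u x) @[x --> F] --> expR (k0 * u0).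
  exact: (cvg_comp_der (@is_derive_expR R) (cvgM ck cu)).
exact: (cvgM cE (cvgD (cvgM cQ cC) (cvgM cP cS))).
Qed.

Lemma cvg_Af k u (k0 u0 : R) : domt i u0 -> k x @[x --> F] --> k0 -> u x @[x --> F] --> u0 ->
  Af i (u x) (k x) @[x --> F] --> Af i u0 k0.
Proof.
move=> d ck cu; have cC := cvg_comp_der (@der_Cf R i) cu.
have cS := cvg_comp_der (@der_Sf R i) cu.
have cE : expR (k x * u x) @[x --> F] --> expR (k0 * u0).
  exact: (cvg_comp_der (@is_derive_expR R) (cvgM ck cu)).
have s0 := lt0r_neq0 (Sf_gt0 d).
exact: (cvgM (cvgM (cvg_cst sg) (cvgB cE cC)) (cvgV s0 cS)).
Qed.

End joint_limits.

(** Pointwise joint convergence at each m of the compact [0, 1] gives uniform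
    convergence in m. *)
Lemma unif_itv (f : R -> R -> R) (f0 : R -> R) :
  (forall m : R, 0 <= m <= 1 -> f z.2 z.1 @[z --> filter_prod (nbhs m) ((0 : R)^')] --> f0 m) ->
  (forall m : R, {for m, continuous f0}) ->
  forall eta, 0 < eta -> \forall e \near (0 : R)^', forall m, 0 <= m <= 1 ->
    `|f0 m - f e m| < eta.
Proof.
move=> cf cf0 eta eta0.
have cK : compact `[(0 : R), 1] by exact: segment_compact.
have /compact_near_coveringP := cK.
move=> /(_ R (0 : R)^' (fun e m => `|f0 m - f e m| < eta) _) H.
suff H1 : forall m, `[(0 : R), 1]%classic m -> \forall x' \near m & e \near (0 : R)^',
    `|f0 x' - f e x'| < eta.
  have := H H1; apply: filterS => e He m m01; apply: He.
  by rewrite /= in_itv.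
move=> m; rewrite /= in_itv /= => m01.
have c1 := cf m m01.
have c2 : f0 z.1 @[z --> filter_prod (nbhs m) ((0 : R)^')] --> f0 m.
  by apply: cvg_comp; [exact: cvg_fst|exact: cf0].
have FF : Filter (filter_prod (nbhs m) ((0 : R)^')) by exact: filter_prod_filter.
have c3 := @cvgB _ _ _ _ FF _ _ _ _ c2 c1; rewrite subrr in c3.
exact: (@cvgr0_norm_lt _ _ _ _ FF _ c3 _ eta0).
Qed.

Section branches.
Variables (i : family) (w D : R).
Local Notation sg := (sgf i).
Local Notation sys := (perturbed i (@alpha0 R) (beta0 i w) (kappa0 i w D)).
Local Notation cset := (cyc_set i w D).

(** The upward crossing value determines y by injectivity of A, and it cannot be a
    downward crossing value of the other cycle, by transversality. *)
Lemma cyc_set_neq e y1 y1' y2 y2' : small i w D e -> matched i w D e y1 y1' ->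
  matched i w D e y2 y2' -> y1 != y2 -> cset e y1 y1' <> cset e y2 y2'.
Proof.
move=> [om0 h0 k1 _] m1 m2 y12 E.
have in1 : cset e y1 y1' (arc_point i e (h_ i w D e) (dl_ i w D e) (k_ w e) above (yv_ i e y1 above) 0).
  exists above, 0; split => //; rewrite lexx /=; apply: ltW.
  exact: domt_gt0 (matched_th m1 above).
rewrite E in in1.
have [s] := gate_points h0 k1 (matched_th m2) (matched_entry m2) (matched_exit m2) erefl in1.
rewrite !arc0E => /(congr1 (@yc R)); rewrite !yc_vec3 mul1r => /addIr yvE.
case: s yvE => /= yvE.
  rewrite mul1r in yvE.
  have [[d1 _ _] [d2 _ _]] := (m1, m2).
  have [t1 _ _] := thfP d1; have [t2 _ _] := thfP d2.
  have nk : `|- e| < 1 by rewrite normrN; exact: (k1 above).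
  have tE : thf i y1 = thf i y2.
    by apply: le_anti; rewrite -(Af_le nk t1 t2) -(Af_le nk t2 t1) yvE lexx.
  by move/eqP: y12; apply; apply: le_anti; rewrite -(thf_le d1 d2) -(thf_le d2 d1) tE lexx.
have H1 := cycle_transversal h0 k1 (matched_th m1) (matched_entry m1) (matched_exit m1) above above.
have H2 := cycle_transversal h0 k1 (matched_th m2) (matched_entry m2) (matched_exit m2) below above.
rewrite /= yvE in H1; rewrite /= in H2; move: H1 H2.
by set X := _ + _ * (_ * _); lra.
Qed.

(** The last two coordinates of [arc_point] at the fraction m of the angle th, with
    all data made explicit in order to let them converge. *)
Definition ycomp s (k v d h th e m : R) :=
  sgs s * (arcP i k (v + d) (sg * h) (m * th) - d) - e.
Definition zcomp s (k v d h th m : R) :=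
  sgs s * (arcQ i k (v + d) (sg * h) (m * th) - sg * h).

Lemma cvg_comps (T : Type) (F : set_system T) (FF : Filter F) s (k v d h th e m : T -> R)
    (k0 v0 d0 h0 th0 e0 m0 : R) :
  k x @[x --> F] --> k0 -> v x @[x --> F] --> v0 -> d x @[x --> F] --> d0 ->
  h x @[x --> F] --> h0 -> th x @[x --> F] --> th0 -> e x @[x --> F] --> e0 ->
  m x @[x --> F] --> m0 ->
  ycomp s (k x) (v x) (d x) (h x) (th x) (e x) (m x) @[x --> F] -->
    ycomp s k0 v0 d0 h0 th0 e0 m0 /\
  zcomp s (k x) (v x) (d x) (h x) (th x) (m x) @[x --> F] --> zcomp s k0 v0 d0 h0 th0 m0.
Proof.
move=> ck cv cd ch cth ce cm.
have cP : v x + d x @[x --> F] --> v0 + d0 by exact: cvgD cv cd.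
have cQ : sg * h x @[x --> F] --> sg * h0 by exact: cvgM (cvg_cst sg) ch.
have cu : m x * th x @[x --> F] --> m0 * th0 by exact: cvgM cm cth.
have c1 := @cvg_arcP i T F FF _ _ _ _ _ _ _ _ ck cP cQ cu.
have c2 := @cvg_arcQ i T F FF _ _ _ _ _ _ _ _ ck cP cQ cu.
split; first exact: (cvgB (cvgM (cvg_cst (sgs s)) (cvgB c1 cd)) ce).
exact: (cvgM (cvg_cst (sgs s)) (cvgB c2 cQ)).
Qed.

Lemma ball_vec3 (a b c a' b' c' eta : R) : `|a - a'| < eta -> `|b - b'| < eta ->
  `|c - c'| < eta -> ball (vec3 a b c) eta (vec3 a' b' c').
Proof.
move=> H1 H2 H3; split; first exact: le_lt_trans (normr_ge0 _) H1.
by move=> u j; rewrite !mxE; case: j => -[|[|[|//]]] j3.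
Qed.

(** Points of both cycles are compared at equal fractions of the angles of the
    arcs. *)
Lemma cyc_set_cvg (Y Y' : R -> R) (ys : R) : domy i ys ->
  Y e @[e --> (0 : R)^'] --> ys -> Y' e @[e --> (0 : R)^'] --> ys ->
  hausdorff_cvg0 (fun e => cset e (Y e) (Y' e)) (cset 0 ys ys).
Proof.
move=> dys cY cY' eta eta0.
have [dth _ _] := thfP dys.
have cid : (e : R) @[e --> (0 : R)^'] --> (0 : R) by apply: dnbhs_cvg; exact: cvg_id.
have cid' : (- e : R) @[e --> (0 : R)^'] --> (- 0 : R) by exact: cvgN cid.
have ct f : f e @[e --> (0 : R)^'] --> ys -> thf i (f e) @[e --> (0 : R)^'] --> thf i ys.
  by move=> cf; apply: continuous_cvg cf; exact: der_cont (der_thf dys).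
have ck s : k_ w e s @[e --> (0 : R)^'] --> k_ w 0 s.
  by case: s => //=; apply: cvgN; exact: dnbhs_cvg (@cont_kf _ w).
have cd s : dl_ i w D e s @[e --> (0 : R)^'] --> dl_ i w D 0 s.
  by case: s => /=; [exact: cvg_cst|exact: dnbhs_cvg (@cont_dlf _ i w D)].
have ch s : h_ i w D e s @[e --> (0 : R)^'] --> h_ i w D 0 s.
  by case: s => /=; [exact: cvg_cst|exact: dnbhs_cvg (@cont_hf _ i w D)].
have cth s : th_ i (Y e) (Y' e) s @[e --> (0 : R)^'] --> th_ i ys ys s.
  by case: s => /=; exact: ct.
have cv s : yv_ i e (Y e) s @[e --> (0 : R)^'] --> yv_ i 0 ys s.
  by case: s => /=; apply: (cvg_Af dth) => //; exact: ct.
pose fy s e m := ycomp s (k_ w e s) (yv_ i e (Y e) s) (dl_ i w D e s) (h_ i w D e s)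
  (th_ i (Y e) (Y' e) s) e m.
pose fz s e m := zcomp s (k_ w e s) (yv_ i e (Y e) s) (dl_ i w D e s) (h_ i w D e s)
  (th_ i (Y e) (Y' e) s) m.
pose gy s m := ycomp s (k_ w 0 s) (yv_ i 0 ys s) (dl_ i w D 0 s) (h_ i w D 0 s)
  (th_ i ys ys s) 0 m.
pose gz s m := zcomp s (k_ w 0 s) (yv_ i 0 ys s) (dl_ i w D 0 s) (h_ i w D 0 s)
  (th_ i ys ys s) m.
have joint s (m : R) : fy s z.2 z.1 @[z --> filter_prod (nbhs m) ((0 : R)^')] --> gy s m /\
    fz s z.2 z.1 @[z --> filter_prod (nbhs m) ((0 : R)^')] --> gz s m.
  have FF : Filter (filter_prod (nbhs m) ((0 : R)^')) by exact: filter_prod_filter.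
  have c1 : z.1 @[z --> filter_prod (nbhs m) ((0 : R)^')] --> m by exact: cvg_fst.
  have c2 (f : R -> R) (l : R) : f e @[e --> (0 : R)^'] --> l ->
      f z.2 @[z --> filter_prod (nbhs m) ((0 : R)^')] --> l.
    by move=> cf; apply: cvg_comp cf; exact: cvg_snd.
  exact: (cvg_comps FF s (c2 _ _ (ck s)) (c2 _ _ (cv s)) (c2 _ _ (cd s)) (c2 _ _ (ch s))
    (c2 _ _ (cth s)) (c2 _ _ cid) c1).
have sep s (m : R) : {for m, continuous (gy s)} /\ {for m, continuous (gz s)}.
  have FF : Filter (nbhs m) by exact: nbhs_filter.
  have c1 : x @[x --> nbhs m] --> m by exact: cvg_id.
  have c2 (l : R) : l @[_ --> nbhs m] --> l by exact: cvg_cst.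
  exact: (cvg_comps FF s (c2 _) (c2 _) (c2 _) (c2 _) (c2 _) (c2 _) c1).
have uy s := unif_itv (fun m _ => (joint s m).1) (fun m => (sep s m).1) eta0.
have uz s := unif_itv (fun m _ => (joint s m).2) (fun m => (sep s m).2) eta0.
have th0 s : 0 < th_ i ys ys s by case: s; exact: domt_gt0 dth.
have nth s : \forall e \near (0 : R)^', 0 < th_ i (Y e) (Y' e) s.
  exact: cvgr_gt (cth s) _ (th0 s).
have ne : \forall e \near (0 : R)^', `|e| < eta by exact: cvgr0_norm_lt cid _ eta0.
have uyA := uy above; have uyB := uy below; have uzA := uz above; have uzB := uz below.
have nthA := nth above; have nthB := nth below.
clear uy uz nth.
near=> e.
have close s m : 0 <= m <= 1 -> ball
   (arc_point i 0 (h_ i w D 0) (dl_ i w D 0) (k_ w 0) s (yv_ i 0 ys s) (m * th_ i ys ys s)) eta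
   (arc_point i e (h_ i w D e) (dl_ i w D e) (k_ w e) s (yv_ i e (Y e) s)
      (m * th_ i (Y e) (Y' e) s)).
  move=> m01; apply: ball_vec3.
  - by rewrite sub0r normrN; near: e.
  - have H : forall m, 0 <= m <= 1 -> `|gy s m - fy s e m| < eta by case: s; near: e.
    exact: H.
  - have H : forall m, 0 <= m <= 1 -> `|gz s m - fz s e m| < eta by case: s; near: e.
    exact: H.
have thp s : 0 < th_ i (Y e) (Y' e) s by case: s; near: e.
have frac (t u : R) : 0 < t -> 0 <= u <= t -> 0 <= u / t <= 1 /\ u = u / t * t.
  move=> t0 /andP[u0 ut]; rewrite divfK ?lt0r_neq0//; split => //.
  by rewrite divr_ge0 ?(ltW t0)//= ler_pdivrMr// mul1r.
split.
  move=> _ [s [u [uu ->]]]; have [m01 uE] := frac _ _ (thp s) uu.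
  have := close s _ m01; rewrite -uE => cl.
  exists (arc_point i 0 (h_ i w D 0) (dl_ i w D 0) (k_ w 0) s (yv_ i 0 ys s)
    (u / th_ i (Y e) (Y' e) s * th_ i ys ys s)) => //.
  exists s, (u / th_ i (Y e) (Y' e) s * th_ i ys ys s); split => //.
  move/andP: m01 => [m0 m1]; rewrite mulr_ge0 ?(ltW (th0 s))//=.
  by rewrite ler_piMl// ltW.
move=> _ [s [u [uu ->]]]; have [m01 uE] := frac _ _ (th0 s) uu.
have := close s _ m01; rewrite -uE => cl.
exists (arc_point i e (h_ i w D e) (dl_ i w D e) (k_ w e) s (yv_ i e (Y e) s)
  (u / th_ i ys ys s * th_ i (Y e) (Y' e) s)); last exact: ball_sym.
exists s, (u / th_ i ys ys s * th_ i (Y e) (Y' e) s); split => //.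
move/andP: m01 => [m0 m1]; rewrite mulr_ge0 ?(ltW (thp s))//=.
by rewrite ler_piMl// ltW.
Unshelve. all: by end_near. Qed.

(** Since closing pairs in a fixed box are unique for small e, an arbitrary choice of
    one for each e is also the one which tends to (ys, ys). *)
Lemma branch (ys : R) : domy i ys ->
  (ys * dB0 i ys - B0 i ys) + w * B0 i ys + sg * D = 0 -> ys * ddB0 i ys + w * dB0 i ys != 0 ->
  exists Y Y' : R -> R, [/\ Y e @[e --> (0 : R)^'] --> ys, Y' e @[e --> (0 : R)^'] --> ys &
    \forall e \near (0 : R)^', matched i w D e (Y e) (Y' e) /\
      limit_cycle (sys e) (cset e (Y e) (Y' e))].
Proof.
move=> dys M m; have [eta0 [eta00 dm dp uniq ex]] := closing_near dys M m.
have FF : Filter ((0 : R)^') by typeclasses eauto.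
pose S e : set (R * R) := [set p | [/\ `|p.1 - ys| <= eta0, `|p.2 - ys| <= eta0 &
  closing i w D e (thf i p.1) (thf i p.2)]].
(* a closing pair in the box, if there is one *)
pose sel e := xget (ys, ys) (S e).
have loc eta : 0 < eta -> \forall e \near (0 : R)^',
    [/\ S e (sel e), `|(sel e).1 - ys| <= eta & `|(sel e).2 - ys| <= eta].
  move=> eta0'; have m0 : 0 < Num.min eta eta0 by rewrite lt_min eta0'.
  apply: (@filterS2 _ _ FF _ _ _ _ (ex _ m0) uniq) => e [y [y' [H1 H2 cl]]] un.
  move: H1 H2; rewrite !le_min => /andP[a1 b1] /andP[a2 b2].
  have Sy : S e (y, y') by split.
  have Ss : S e (sel e) by apply: xgetPex; exists (y, y').
  have [s1 s2 s3] := Ss.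
  by have [-> ->] := un _ _ _ _ s1 b1 s2 b2 s3 cl.
have lim (f : R * R -> R) : (forall eta, 0 < eta -> \forall e \near (0 : R)^',
     `|f (sel e) - ys| <= eta) -> f (sel e) @[e --> (0 : R)^'] --> ys.
  move=> H; apply/cvgrPdist_le => eps eps0.
  by apply: filterS (H _ eps0) => e; rewrite distrC.
exists (fun e => (sel e).1), (fun e => (sel e).2); split.
- by apply: lim => eta eta1; apply: filterS (loc _ eta1) => e [].
- by apply: lim => eta eta1; apply: filterS (loc _ eta1) => e [].
have e2 : 0 < eta0 / 2 by rewrite divr_gt0.
apply: (@filterS3 _ _ FF _ _ _ _ _ (loc _ e2) uniq (near_small i w D)) => e [[s1 s2 s3] n1 n2] un [se e0 kn].
have half : eta0 / 2 < eta0 by rewrite ltr_pdivrMr// ltr_pMr// ltr1n.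
have dom y : `|y - ys| <= eta0 -> domy i y.
  by rewrite ler_distl; exact: domy_itv dm dp.
have mt : matched i w D e (sel e).1 (sel e).2 by split => //; exact: dom.
split => //; apply: (matched_limit_cycle se kn mt eta00 dm dp).
- exact: le_lt_trans n1 half.
- exact: le_lt_trans n2 half.
by move=> u u' h1 h2 cl; exact: un h1 s1 h2 s2 cl s3.
Qed.

End branches.
End limits.

(** * The two limit cycles *)

Theorem theorem2 (R : realType) (i : family) :
  exists alpha beta kappa : side -> 'I_4 -> R,
  exists (G1 G2 : set 'rV[R]_3) (L1 L2 : R -> set 'rV[R]_3),
  [/\ crossing_periodic_orbit (perturbed i alpha beta kappa 0) G1
        /\ G1 `<=` planeS,
      crossing_periodic_orbit (perturbed i alpha beta kappa 0) G2
        /\ G2 `<=` planeS,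
      \forall e \near (0 : R)^',
        [/\ limit_cycle (perturbed i alpha beta kappa e) (L1 e),
            limit_cycle (perturbed i alpha beta kappa e) (L2 e)
          & L1 e <> L2 e],
      hausdorff_cvg0 L1 G1
    & hausdorff_cvg0 L2 G2].
Proof.
have FF : Filter ((0 : R)^') by typeclasses eauto.
have [E [t1 [t2 [d1 d2 t12 RE [g1 g2]]]]] := @two_zeros R i.
have [y1 dy1 yE1] := domt_thf d1; have [y2 dy2 yE2] := domt_thf d2.
pose w := 1 - Rf i E t1; pose D := sgf i * (E - 1) : R.
have [M1 m1] := simple_zero dy1 (esym yE1) (erefl w) g1.
have w2 : w = 1 - Rf i E t2 by rewrite /w RE.
have [M2 m2] := simple_zero dy2 (esym yE2) w2 g2.
have [Y1 [Y1' [c1 c1' L1]]] := branch dy1 M1 m1.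
have [Y2 [Y2' [c2 c2' L2]]] := branch dy2 M2 m2.
exists (@alpha0 R), (beta0 i w), (kappa0 i w D).
exists (cyc_set i w D 0 y1 y1), (cyc_set i w D 0 y2 y2).
exists (fun e => cyc_set i w D e (Y1 e) (Y1' e)), (fun e => cyc_set i w D e (Y2 e) (Y2' e)).
split.
- exact: cyc_set_crossing.
- exact: cyc_set_crossing.
- have y12 : y2 - y1 != 0.
    by apply: contraTneq t12 => /eqP; rewrite subr_eq0 -yE1 -yE2 => /eqP ->; rewrite ltxx.
  have ne : \forall e \near (0 : R)^', Y2 e - Y1 e != 0.
    have c3 : Y2 e - Y1 e @[e --> (0 : R)^'] --> y2 - y1 by exact: cvgB c2 c1.
    exact: cvgr_neq0 c3 y12.
  apply: (@filterS3 _ _ FF _ _ _ _ _ L1 L2 (filterI (near_small i w D) ne)) => e [mt1 l1] [mt2 l2] [[se _ _] n].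
  split => //.
  by apply: (cyc_set_neq se mt1 mt2); rewrite eq_sym -subr_eq0.
- exact: cyc_set_cvg.
- exact: cyc_set_cvg.
Qed.
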